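(* (i) Let $f,m,N,\varpi,a_0,a_\phi$ be smooth functions of $R$ on an open interval with $f,m,N>0$ and $-f(a_\phi')^2+\frac Nm(a_0'+\varpi a_\phi')^2>0$ (with $'=\frac{d}{dR}$), let $g,A$ be as in the context and $F=dA$. Let $\ell$ and $n$ be the two real null eigendirections of $F^\mu{}_\nu$ with non-zero eigenvalues. Then the null congruence $\ell$ (and likewise $n$) is geodesic if and only if $$a_\phi'a_0''-a_0'a_\phi''=0 .$$ (ii) Let $(g,A)$ be a five-dimensional charged rotating black hole with two equal-magnitude angular momenta, as defined in the context, with angular momentum parameter $\hat J\neq0$ and charge parameter $\hat Q\neq0$. Then the condition $a_\phi'a_0''-a_0'a_\phi''=0$ does not hold identically, so the congruences $\ell$ and $n$ are not geodesic. Consequently $g$ cannot be written in the Kerr--Schild form $$g_{\mu\nu}=\eta_{\mu\nu}-2\mathcal H\,k_\mu k_\nu$$ with $\eta_{\mu\nu}$ the (flat) Minkowski metric, $\mathcal H$ a scalar function, and $k$ a null vector field that is geodesic.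
   Context: The ansatz, in coordinates $(t,R,\theta,\phi,\psi)$ with $0<\theta<\pi/2$, and with $f,m,N,\varpi,a_0,a_\phi$ functions of $R$ only, is $$ds^2=-f\,dt^2+\frac{m}{f}\Big(\frac{dR^2}{4N}+d\theta^2\Big)+\frac{N}{m}\Big[\sin^2\theta\,(d\phi-\varpi\,dt)^2+\cos^2\theta\,(d\psi-\varpi\,dt)^2\Big]+\frac{m^2-fN}{m f}\sin^2\theta\cos^2\theta\,(d\phi-d\psi)^2,$$ $$A=a_0\,dt+a_\phi(\sin^2\theta\,d\phi+\cos^2\theta\,d\psi).$$ A null vector field $k$ is geodesic if $k^\nu\nabla_\nu k^\mu$ is proportional to $k^\mu$. A five-dimensional charged rotating black hole with two equal-magnitude angular momenta is a pair $(g,A)$ of this form on the exterior region $R>r_+^2$, where $f,m,N>0$, such that: (a) the Einstein--Maxwell equations hold: $\nabla^\mu F_{\mu\nu}=0$ with $F=dA$, and $R_{\mu\nu}-\frac12\mathcal R g_{\mu\nu}=2T_{\mu\nu}$ with $T_{\mu\nu}=F_{\mu\rho}F_\nu{}^\rho-\frac14g_{\mu\nu}F_{\rho\sigma}F^{\rho\sigma}$; in particular $N=(R-r_+^2)(R-r_-^2)$ with constants $r_+^2>r_-^2$, $r_+^2>0$; (b) (asymptotic flatness) as $R\to\infty$ the functions have asymptotic expansions (differentiable term by term) in integer powers of $R$ with $f=1-\hat M R^{-1}+O(R^{-2})$, $m=R+O(R^0)$, $a_\phi=O(R^{-1})$, $\varpi=\hat J R^{-2}+O(R^{-3})$, $a_0=\hat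 Q R^{-1}+O(R^{-2})$; (c) (horizon regularity) $f,m,\varpi,a_0,a_\phi$ extend smoothly in $R$ to a neighbourhood of $R=r_+^2$, with $f$ and $m$ having simple zeros there. The constants $\hat M,\hat J,\hat Q$ are proportional to the mass, angular momentum and electric charge. *)

(* Defs.v *)
From HB Require Import structures.
From mathcomp Require Import all_boot all_order all_algebra.
From mathcomp Require Import all_classical all_reals all_analysis.

Set Implicit Arguments.
Unset Strict Implicit.
Unset Printing Implicit Defensive.

Import Order.TTheory GRing.Theory Num.Theory.
Import numFieldNormedType.Exports.

Local Open Scope classical_set_scope.
Local Open Scope ring_scope.

(** * Tensor calculus in one coordinate chart of a 5-dimensional manifold

    Points are coordinate rows ['rV[R]_5]; vectors [k^mu] are columns, covectors
    [w_mu] are rows, and tensors with two lower indices are 5x5 matrices.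
    [R : realType] is the field of real numbers; the radial coordinate is called
    [rad] in indices and [r] as an argument.  *)

(** Order of the coordinates: (t, radius, theta, phi, psi). *)
Definition i_t : 'I_5 := @Ordinal 5 0 isT.
Definition i_rad : 'I_5 := @Ordinal 5 1 isT.
Definition i_th : 'I_5 := @Ordinal 5 2 isT.
Definition i_phi : 'I_5 := @Ordinal 5 3 isT.
Definition i_psi : 'I_5 := @Ordinal 5 4 isT.

Section Chart.
Variable R : realType.

Implicit Types (U : set 'rV[R]_5) (x : 'rV[R]_5) (i j a b c d e : 'I_5).
Implicit Types (g eta F : 'rV[R]_5 -> 'M[R]_5) (k l n : 'rV[R]_5 -> 'cV[R]_5).

Definition dx i : 'rV[R]_5 := delta_mx 0 i.

Definition partial i (h : 'rV[R]_5 -> R) : 'rV[R]_5 -> R :=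
  fun x => 'D_(dx i) h x.

(** C^oo on an open set: every iterated partial derivative is differentiable. *)
Definition smooth_scalar U (h : 'rV[R]_5 -> R) : Prop :=
  forall (s : seq 'I_5) x, U x -> differentiable (foldr partial h s) x.

Definition smooth_vector U k : Prop :=
  forall i, smooth_scalar U (fun y => k y i 0).

Definition smooth_tensor2 U g : Prop :=
  forall i j, smooth_scalar U (fun y => g y i j).

Definition ginv g x : 'M[R]_5 := invmx (g x).

(** [christoffel g a b c x] is Gamma^a_{bc}. *)
Definition christoffel g a b c x : R :=
  2^-1 * \sum_d ginv g x a d *
    (partial b (fun y => g y d c) x + partial c (fun y => g y d b) x
     - partial d (fun y => g y b c) x).

(** [riemann g a b c d x] is R^a_{bcd}, with the sign for which round spheres
    have positive Ricci tensor R_{bd} = R^a_{bad}. *)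
Definition riemann g a b c d x : R :=
  partial c (christoffel g a d b) x - partial d (christoffel g a c b) x
  + \sum_e (christoffel g a c e x * christoffel g e d b x
            - christoffel g a d e x * christoffel g e c b x).

Definition ricci g b d x : R := \sum_a riemann g a b a d x.

Definition scalar_curvature g x : R :=
  \sum_a \sum_b ginv g x a b * ricci g a b x.

Definition exterior_derivative (A : 'rV[R]_5 -> 'rV[R]_5) x : 'M[R]_5 :=
  \matrix_(i, j) (partial i (fun y => A y 0 j) x - partial j (fun y => A y 0 i) x).

(** nabla_c F_{ab} *)
Definition cov_deriv2 g F c a b x : R :=
  partial c (fun y => F y a b) x
  - \sum_e (christoffel g e c a x * F x e b + christoffel g e c b x * F x a e).

(** nabla_b k^a *)
Definition cov_deriv_vector g k b a x : R :=
  partial b (fun y => k y a 0) x + \sum_c christoffel g a b c x * k x c 0.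

Definition inner g x (v w : 'cV[R]_5) : R := (v^T *m g x *m w) 0 0.

(** k^nu nabla_nu k^mu is proportional to k^mu on U (no affine parametrization
    is required). *)
Definition geodesic U g k : Prop :=
  forall x, U x -> exists kappa : R, forall a,
    \sum_b k x b 0 * cov_deriv_vector g k b a x = kappa * k x a 0.

Definition maxwell U g F : Prop :=
  forall x, U x -> forall b,
    \sum_c \sum_a ginv g x c a * cov_deriv2 g F c a b x = 0.

(** F_{mu rho} F_nu^rho *)
Definition field_square g F x : 'M[R]_5 := F x *m ginv g x *m (F x)^T.

(** F_{rho sigma} F^{rho sigma} *)
Definition field_norm g F x : R := \tr (ginv g x *m field_square g F x).

Definition stress_energy g F x : 'M[R]_5 :=
  field_square g F x - (4^-1 * field_norm g F x) *: g x.

Definition einstein_maxwell U g F : Prop :=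
  maxwell U g F /\
  forall x, U x -> forall a b,
    ricci g a b x - 2^-1 * scalar_curvature g x * g x a b
    = 2 * stress_energy g F x a b.

(** v is a real null eigenvector, with non-zero eigenvalue, of the endomorphism
    F^mu_nu at x.  *)
Definition null_eigenvector g F x (v : 'cV[R]_5) : Prop :=
  [/\ v != 0, inner g x v v = 0 &
      exists2 lambda : R, lambda != 0 & ginv g x *m F x *m v = lambda *: v].

(** l and n are smooth fields spanning the two null eigendirections of F^mu_nu
    with non-zero eigenvalues: they are independent, and there are no others. *)
Definition null_eigendirections U g F l n : Prop :=
  [/\ smooth_vector U l, smooth_vector U n &
      forall x, U x ->
        [/\ null_eigenvector g F x (l x), null_eigenvector g F x (n x),
            (forall s : R, l x <> s *: n x) &
            forall v, null_eigenvector g F x v ->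
              exists s : R, v = s *: l x \/ v = s *: n x]].

Definition minkowski_form : 'M[R]_5 :=
  diag_mx (\row_i (if i == i_t then -1 else 1)).

Definition lorentzian U g : Prop :=
  forall x, U x ->
    exists2 P : 'M[R]_5, P \in unitmx & P^T *m g x *m P = minkowski_form.

(** The Minkowski metric in arbitrary coordinates: a Lorentzian metric with zero
    curvature. *)
Definition flat_minkowski U eta : Prop :=
  [/\ smooth_tensor2 U eta, lorentzian U eta &
      forall x, U x -> forall a b c d, riemann eta a b c d x = 0].

(** k_mu k_nu for the covector k_mu = g_{mu nu} k^nu.  When k is null and
    g = eta - 2 H k k, lowering with g or with eta gives the same covector, and
    k is null for g iff it is null for eta. *)
Definition lowered_square g k x : 'M[R]_5 :=
  (g x *m k x) *m (g x *m k x)^T.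

Definition kerr_schild U g : Prop :=
  exists (eta : 'rV[R]_5 -> 'M[R]_5) (H : 'rV[R]_5 -> R)
         (k : 'rV[R]_5 -> 'cV[R]_5),
    [/\ flat_minkowski U eta, smooth_scalar U H, smooth_vector U k,
        (forall x, U x -> k x != 0 /\ inner g x (k x) (k x) = 0) &
        geodesic U g k /\
        forall x, U x -> g x = eta x - (2 * H x) *: lowered_square g k x].

(** * The ansatz *)

Section Ansatz.
Variables f m N w a0 ap : R -> R.

Definition form_square (u : 'rV[R]_5) : 'M[R]_5 := u^T *m u.

Definition ansatz_metric x : 'M[R]_5 :=
  let r := x 0 i_rad in let th := x 0 i_th in
  - f r *: form_square (dx i_t)
  + (m r / f r) *: ((4 * N r)^-1 *: form_square (dx i_rad) + form_square (dx i_th))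
  + (N r / m r) *: (sin th ^+ 2 *: form_square (dx i_phi - w r *: dx i_t)
                    + cos th ^+ 2 *: form_square (dx i_psi - w r *: dx i_t))
  + ((m r ^+ 2 - f r * N r) / (m r * f r) * (sin th ^+ 2 * cos th ^+ 2))
      *: form_square (dx i_phi - dx i_psi).

Definition ansatz_potential x : 'rV[R]_5 :=
  let r := x 0 i_rad in let th := x 0 i_th in
  a0 r *: dx i_t
  + ap r *: (sin th ^+ 2 *: dx i_phi + cos th ^+ 2 *: dx i_psi).

Definition ansatz_field : 'rV[R]_5 -> 'M[R]_5 :=
  exterior_derivative ansatz_potential.

(** The quantity whose positivity makes the non-zero eigenvalues of F^mu_nu
    in the plane of l and n real. *)
Definition discriminant (r : R) : R :=
  - f r * (derive1 ap r) ^+ 2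
  + N r / m r * (derive1 a0 r + w r * derive1 ap r) ^+ 2.

Definition geodesic_condition (r : R) : Prop :=
  derive1 ap r * derive1n 2 a0 r - derive1 a0 r * derive1n 2 ap r = 0.

End Ansatz.

Definition chart_region (D : set R) : set 'rV[R]_5 :=
  [set x | D (x 0 i_rad) /\ 0 < x 0 i_th < pi / 2].

(** * Functions of the radial coordinate *)

Definition smooth_on (D : set R) (h : R -> R) : Prop :=
  forall (j : nat) r, D r -> derivable (derive1n j h) r 1.

(** h(r) ~ sum_k c_k r^(p-k) as r -> +oo, and this expansion may be
    differentiated term by term arbitrarily often. *)
Definition asymptotic_expansion (h : R -> R) (p : int) (c : nat -> R) : Prop :=
  forall K j : nat, exists C : R, \forall r \near +oo,
    `|derive1n j (fun u => h u - \sum_(k < K) c k * u ^ (p - k%:Z)) r|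
      <= C * r ^ (p - K%:Z - j%:Z).

(** ht extends h smoothly from the right of r0 to a neighbourhood of r0. *)
Definition smooth_extension (r0 : R) (h ht : R -> R) : Prop :=
  exists2 e : R, 0 < e &
    smooth_on `]r0 - e, r0 + e[ ht /\ {in `]r0, r0 + e[, h =1 ht}.

Definition simple_zero (h : R -> R) (r0 : R) : Prop :=
  h r0 = 0 /\ derive1 h r0 != 0.

(** [rp2] and [rm2] stand for the constants r_+^2 and r_-^2. *)
Definition horizon_regular (rp2 : R) (f m w a0 ap : R -> R) : Prop :=
  [/\ (exists2 ft, smooth_extension rp2 f ft & simple_zero ft rp2),
      (exists2 mt, smooth_extension rp2 m mt & simple_zero mt rp2),
      (exists wt, smooth_extension rp2 w wt),
      (exists a0t, smooth_extension rp2 a0 a0t) &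
      (exists apt, smooth_extension rp2 ap apt)].

(** [M], [J], [Q] are the hatted mass, angular momentum and charge constants. *)
Definition asymptotically_flat (M J Q : R) (f m w a0 ap : R -> R) : Prop :=
  [/\ (exists2 c : nat -> R, asymptotic_expansion f 0 c & c 0%N = 1 /\ c 1%N = - M),
      (exists2 c : nat -> R, asymptotic_expansion m 1 c & c 0%N = 1),
      (exists c : nat -> R, asymptotic_expansion ap (-1) c),
      (exists2 c : nat -> R, asymptotic_expansion w (-2) c & c 0%N = J) &
      (exists2 c : nat -> R, asymptotic_expansion a0 (-1) c & c 0%N = Q)].

Definition exterior (rp2 : R) : set R := [set r | rp2 < r].

Record charged_rotating_black_hole (rp2 rm2 M J Q : R)
    (f m N w a0 ap : R -> R) : Prop := ChargedRotatingBlackHole {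
  bh_constants : rm2 < rp2 /\ 0 < rp2;
  bh_smooth : [/\ smooth_on (exterior rp2) f, smooth_on (exterior rp2) m,
                  smooth_on (exterior rp2) N, smooth_on (exterior rp2) w &
                  smooth_on (exterior rp2) a0 /\ smooth_on (exterior rp2) ap];
  bh_positive : forall r, exterior rp2 r -> [/\ 0 < f r, 0 < m r & 0 < N r];
  bh_einstein_maxwell :
    einstein_maxwell (chart_region (exterior rp2))
      (ansatz_metric f m N w) (ansatz_field a0 ap);
  bh_N : forall r, exterior rp2 r -> N r = (r - rp2) * (r - rm2);
  bh_asymptotics : asymptotically_flat M J Q f m w a0 ap;
  bh_horizon : horizon_regular rp2 f m w a0 ap
}.

End Chart.

(* Main.v *)
Require Import Defs.
From mathcomp Require Import all_boot all_order all_algebra.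
From mathcomp Require Import all_classical all_reals all_analysis.
From mathcomp Require Import ring lra.
Import Order.TTheory GRing.Theory Num.Theory.
Import numFieldNormedType.Exports.
Local Open Scope classical_set_scope.
Local Open Scope ring_scope.
Set Implicit Arguments.
Unset Strict Implicit.
Unset Printing Implicit Defensive.

(** With [sigma = sin^2 dphi + cos^2 dpsi], a null eigenvector [k] of F^mu_nu with
    non-zero eigenvalue is determined up to scale and up to the sign of its radial part:
    the non-radial components of [k_mu] are [mu (a0' dt + ap' sigma)] for some function [mu].
    The metric is invariant along the non-radial part of [k], so off the radial direction the
    lowered acceleration is [k^b d_b k_d], and [k] is geodesic iff the pair [(a0', ap')] stays
    parallel to its derivative.

    For a black hole this condition makes [ap'] equal to [c a0'] as an expansion at infinity.
    The field equations along the Killing vectors are five ordinary differential equations; solving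
    them order by order gives [J = - c M] and [Q^3 c^3 = 0], hence [J = 0] or [Q = 0].

    If g is of Kerr-Schild form with geodesic [k], then the covariant derivatives of [k] for g
    and for the flat background differ by a multiple of [k^a k_b], and the Raychaudhuri
    identity gives Ric_g(k, k) = Ric_eta(k, k) = 0.  By the Einstein equations F k is then
    null, and it is orthogonal to [k], hence parallel to [k]: near infinity [k] is one of the
    two null eigenvectors, which are not geodesic there. *)

(** * Partial derivatives and smoothness *)

(** The curvature of the five-dimensional ansatz is never computed in full. For a Killing vector v
    with constant components, v^k Gamma^a_{kb} is half the exterior derivative of the lowered v, one
    index raised; and the lowered Killing vectors have the shape P(R) dt + Q(R) sigma of the
    potential itself. So the Maxwell and Einstein equations, contracted with Killing vectors, are
    instances of one radial operator. In part (ii) the argument lives near infinity: there the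
    discriminant behaves like Q^2 / r^3, hence is positive, whatever its sign further in. The vector
    k of a Kerr-Schild form is at each point a multiple of one of two eigenvectors, with no control
    over which one or over the factor. Hence the geodesic criterion is proved for any smooth field
    of null eigenvectors, and the factor mu, known only pointwise, is never differentiated. Four
    orders in 1/r suffice: the contradiction appears at order three of the angular Maxwell
    equation. *)

Lemma near_eq_differentiable (R : realType) (V W : normedModType R)
    (h1 h2 : V -> W) (x : V) :
  {near x, h1 =1 h2} -> differentiable h1 x -> differentiable h2 x.
Proof.
move=> ne d1.
(* The first-order expansion of [h1] at [x] is also one for [h2], which has the same value at [x];
   uniqueness of the differential then gives [dE]. *)
have ed : h2 \o shift x = cst (h2 x) + 'd h1 x +o_ 0 id.
  apply/eqaddoP => eps eps0.
  have /diff_locally/eqaddoP/(_ _ eps0) := d1.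
  have ne0 : \forall h \near (0 : V), h1 (h + x) = h2 (h + x).
    by move: ne; rewrite (near_shift 0) subr0.
  apply: filter_app; near=> h.
  by rewrite !fctE /= (nbhs_singleton ne) -(near ne0 h).
have dE : 'd h2 x = 'd h1 x :> (V -> W).
  by apply: diff_unique => //; exact: diff_continuous.
apply/diff_locallyP; rewrite dE; split=> //; exact: diff_continuous.
Unshelve. all: by end_near.
Qed.

Section Partial.
Variable R : realType.
Implicit Types (U : set 'rV[R]_5) (x : 'rV[R]_5) (i j : 'I_5) (h : 'rV[R]_5 -> R).

Lemma partial_eq_on U i h1 h2 x : open U -> U x ->
  (forall y, U y -> h1 y = h2 y) -> partial i h1 x = partial i h2 x.
Proof.
move=> oU Ux e; apply: near_eq_derive.
by apply: filterS (open_nbhs_nbhs (conj oU Ux)) => y; exact: e.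
Qed.

Lemma partial_cst i (c : R) x : partial i (fun=> c) x = 0.
Proof. exact: derive_cst. Qed.

Lemma partialD i h1 h2 x : differentiable h1 x -> differentiable h2 x ->
  partial i (fun y => h1 y + h2 y) x = partial i h1 x + partial i h2 x.
Proof. by move=> d1 d2; rewrite /partial -deriveD//; exact: diff_derivable. Qed.

Lemma partialB i h1 h2 x : differentiable h1 x -> differentiable h2 x ->
  partial i (fun y => h1 y - h2 y) x = partial i h1 x - partial i h2 x.
Proof. by move=> d1 d2; rewrite /partial -deriveB//; exact: diff_derivable. Qed.

Lemma partialM i h1 h2 x : differentiable h1 x -> differentiable h2 x ->
  partial i (fun y => h1 y * h2 y) x = partial i h1 x * h2 x + h1 x * partial i h2 x.
Proof.
move=> d1 d2; rewrite /partial (_ : (fun y => h1 y * h2 y) = h1 * h2)//.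
rewrite deriveM; [|exact: diff_derivable..].
by rewrite addrC [X in X + _]mulrC.
Qed.

Lemma partialV i h x : h x != 0 -> differentiable h x ->
  partial i (fun y => (h y)^-1) x = - (h x) ^- 2 * partial i h x.
Proof.
by move=> h0 d; rewrite /partial deriveV//; exact: diff_derivable.
Qed.

Lemma differentiableD_fun h1 h2 x : differentiable h1 x -> differentiable h2 x ->
  differentiable (fun y => h1 y + h2 y) x.
Proof. exact: differentiableD. Qed.

Lemma differentiableB_fun h1 h2 x : differentiable h1 x -> differentiable h2 x ->
  differentiable (fun y => h1 y - h2 y) x.
Proof. exact: differentiableB. Qed.

Lemma differentiableM_fun h1 h2 x : differentiable h1 x -> differentiable h2 x ->
  differentiable (fun y => h1 y * h2 y) x.
Proof. exact: differentiableM. Qed.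

(** The operation is arbitrary so that one induction serves sums and the products in a
    determinant. *)
Lemma differentiable_bigop (op : R -> R -> R) (idx : R) (I : Type) (r : seq I) (P : pred I)
    (F : I -> 'rV[R]_5 -> R) x :
  (forall h1 h2, differentiable h1 x -> differentiable h2 x ->
     differentiable (fun y => op (h1 y) (h2 y)) x) ->
  (forall k, differentiable (F k) x) ->
  differentiable (fun y => \big[op/idx]_(k <- r | P k) F k y) x.
Proof.
move=> dop dF; elim: r => [|k r IH].
  under eq_fun do rewrite big_nil; exact: differentiable_cst.
under eq_fun do rewrite big_cons.
by case: (P k) => //; exact: dop.
Qed.

Lemma differentiable_sum_fun (I : Type) (r : seq I) (P : pred I) (F : I -> 'rV[R]_5 -> R) x :
  (forall k, differentiable (F k) x) ->
  differentiable (fun y => \sum_(k <- r | P k) F k y) x.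
Proof. by apply: differentiable_bigop => h1 h2; exact: differentiableD_fun. Qed.

Lemma partial_sum i (I : Type) (r : seq I) (P : pred I)
    (F : I -> 'rV[R]_5 -> R) x :
  (forall k, differentiable (F k) x) ->
  partial i (fun y => \sum_(k <- r | P k) F k y) x
  = \sum_(k <- r | P k) partial i (F k) x.
Proof.
move=> dF; elim: r => [|k r IH].
  under eq_fun do rewrite big_nil; by rewrite big_nil partial_cst.
under eq_fun do rewrite big_cons.
rewrite big_cons; case: (P k) => //.
by rewrite partialD// ?IH//; exact: differentiable_sum_fun.
Qed.

Lemma differentiable_near_eq U h1 h2 x : open U -> U x ->
  (forall y, U y -> h1 y = h2 y) -> differentiable h1 x -> differentiable h2 x.
Proof.
move=> oU Ux e; apply: near_eq_differentiable.
by apply: filterS (open_nbhs_nbhs (conj oU Ux)) => y; exact: e.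
Qed.

Lemma differentiable_coord_comp (h : R -> R) j x :
  derivable h (x 0 j) 1 -> differentiable (fun y : 'rV[R]_5 => h (y 0 j)) x.
Proof.
move=> /derivable1_diffP dh.
apply: (@differentiable_comp _ _ _ _ (fun y : 'rV[R]_5 => y 0 j) h) => //.
exact: differentiable_coord.
Qed.

Lemma partial_coord i j x : partial i (fun y : 'rV[R]_5 => y 0 j) x = (i == j)%:R.
Proof.
rewrite /partial deriveE; last exact: differentiable_coord.
have @f : {linear 'rV[R]_5 -> R}.
  by exists (fun N : 'rV[R]_5 => N 0 j); do 2![eexists]; do ?[constructor];
     rewrite ?mxE// => ? *; rewrite ?mxE//; move=> ?; rewrite !mxE.
rewrite (_ : (fun _ => _) = f)// diff_lin//=; last exact: coord_continuous.
by rewrite /dx mxE eqxx eq_sym.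
Qed.

Lemma partial_coord_comp (h : R -> R) i j x : derivable h (x 0 j) 1 ->
  partial i (fun y : 'rV[R]_5 => h (y 0 j)) x = (i == j)%:R * derive1 h (x 0 j).
Proof.
move=> dh; have /derivable1_diffP dh' := dh.
rewrite /partial deriveE; last exact: differentiable_coord_comp.
rewrite (_ : (fun y => _) = h \o (fun y : 'rV[R]_5 => y 0 j))//.
rewrite diff_comp//=; last exact: differentiable_coord.
rewrite deriv1E//= -deriveE; last exact: differentiable_coord.
by have := partial_coord i j x; rewrite /partial => ->; rewrite /GRing.scale/=.
Qed.

End Partial.

Section Smoothness.
Variable R : realType.
Implicit Types (U : set 'rV[R]_5) (x : 'rV[R]_5) (i : 'I_5) (h : 'rV[R]_5 -> R).

(** Smoothness cut at a finite order. The derivative of a product or an inverse contains the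
    functions themselves, which are available one order lower, so closure properties follow by
    induction on the order. *)
Fixpoint cdiff (n : nat) U h : Prop :=
  (forall x, U x -> differentiable h x) /\
  (if n is n'.+1 then forall i, cdiff n' U (partial i h) else True).

Lemma cdiff_differentiable n U h x : cdiff n U h -> U x -> differentiable h x.
Proof. by case: n => [|n] [d _]; exact: d. Qed.

Lemma cdiff_partial n U h i : cdiff n.+1 U h -> cdiff n U (partial i h).
Proof. by case=> _; exact. Qed.

Lemma cdiffW n U h : cdiff n.+1 U h -> cdiff n U h.
Proof.
elim: n h => [|n IH] h [d dp]; split=> //; move=> i; exact: IH.
Qed.

Lemma smooth_scalarP U h : smooth_scalar U h <-> forall n, cdiff n U h.
Proof.
split=> [sh n|ch s x Ux].
  elim: n h sh => [|n IH] h sh; split=> //; try by move=> x /(sh [::]).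
  move=> i; apply: IH => s x Ux.
  (* The derivative taken first stands last in the word. *)
  by have := sh (rcons s i) x Ux; rewrite foldr_rcons.
elim/last_ind: s h ch => [|s i IH] h ch; first exact: cdiff_differentiable (ch 0%N) Ux.
by rewrite foldr_rcons; apply: IH => n; apply: cdiff_partial (ch n.+1).
Qed.

Lemma cdiff_ext n U h1 h2 : open U -> (forall y, U y -> h1 y = h2 y) ->
  cdiff n U h1 -> cdiff n U h2.
Proof.
move=> oU; elim: n h1 h2 => [|n IH] h1 h2 e [d dp]; split=> //;
  try by move=> x Ux; exact: differentiable_near_eq oU Ux e (d x Ux).
by move=> i; apply: IH (dp i) => y Uy; exact: partial_eq_on oU Uy e.
Qed.

Lemma cdiff_cst n U c : cdiff n U (fun=> c).
Proof.
elim: n c => [|n IH] c; split=> //; try by move=> *; exact: differentiable_cst.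
move=> i; rewrite (_ : partial i _ = fun=> 0); first exact: IH.
by apply/funext => x; rewrite partial_cst.
Qed.

Section Open.
Variable U : set 'rV[R]_5.
Hypothesis oU : open U.

Lemma cdiffD n h1 h2 : cdiff n U h1 -> cdiff n U h2 ->
  cdiff n U (fun y => h1 y + h2 y).
Proof.
elim: n h1 h2 => [|n IH] h1 h2 [d1 p1] [d2 p2]; split=> //;
  try by move=> x Ux; exact: (differentiableD_fun (d1 x Ux) (d2 x Ux)).
move=> i; apply: cdiff_ext (IH _ _ (p1 i) (p2 i)) => // y Uy.
by rewrite (partialD _ (d1 y Uy) (d2 y Uy)).
Qed.

Lemma cdiffM n h1 h2 : cdiff n U h1 -> cdiff n U h2 ->
  cdiff n U (fun y => h1 y * h2 y).
Proof.
elim: n h1 h2 => [|n IH] h1 h2 c1 c2.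
  case: c1 c2 => d1 _ [d2 _]; split=> // x Ux.
  exact: (differentiableM_fun (d1 x Ux) (d2 x Ux)).
have [d1 p1] := c1; have [d2 p2] := c2; split.
  by move=> x Ux; exact: (differentiableM_fun (d1 x Ux) (d2 x Ux)).
move=> i; apply: (@cdiff_ext _ _ (fun y => partial i h1 y * h2 y + h1 y * partial i h2 y)) => //.
  by move=> y Uy; rewrite (partialM _ (d1 y Uy) (d2 y Uy)).
by apply: cdiffD; apply: IH; first [exact: cdiffW|exact: cdiff_partial].
Qed.

Lemma cdiffN n h : cdiff n U h -> cdiff n U (fun y => - h y).
Proof.
move=> ch; apply: cdiff_ext (cdiffM (cdiff_cst n U (-1)) ch) => // y _.
by rewrite mulN1r.
Qed.

Lemma cdiffB n h1 h2 : cdiff n U h1 -> cdiff n U h2 ->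
  cdiff n U (fun y => h1 y - h2 y).
Proof. by move=> c1 c2; apply: cdiffD => //; exact: cdiffN. Qed.

Lemma cdiffX n h k : cdiff n U h -> cdiff n U (fun y => h y ^+ k).
Proof.
move=> ch; elim: k => [|k IH].
  by under eq_fun do rewrite expr0; exact: cdiff_cst.
by under eq_fun do rewrite exprS; exact: cdiffM.
Qed.

(** The derivative of 1/h is made of 1/h and a derivative of [h], so it asks for 1/h only at one
    order less. *)
Lemma cdiffV n h : (forall y, U y -> h y != 0) -> cdiff n U h ->
  cdiff n U (fun y => (h y)^-1).
Proof.
move=> h0; elim: n => [|n IH] ch; have d := fun x (Ux : U x) => cdiff_differentiable ch Ux.
  by split=> // x Ux; apply: (differentiableV (d x Ux) (h0 x Ux)).
split; first by move=> x Ux; apply: (differentiableV (d x Ux) (h0 x Ux)).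
move=> i; apply: (@cdiff_ext _ _ (fun y => - ((h y)^-1 * (h y)^-1) * partial i h y)) => //.
  by move=> y Uy; rewrite partialV ?h0//; [rewrite expr2 invfM|exact: d].
apply: cdiffM; last exact: cdiff_partial.
by apply: cdiffN; apply: cdiffM; apply: IH; exact: cdiffW.
Qed.

Lemma differentiable_sqrt h x : differentiable h x -> 0 < h x ->
  differentiable (fun y => Num.sqrt (h y)) x.
Proof.
move=> dh h0; apply: (@differentiable_comp _ _ _ _ h Num.sqrt) => //.
by apply/derivable1_diffP; have [] := is_derive1_sqrt h0.
Qed.

Lemma cdiff_sqrt n h : (forall y, U y -> 0 < h y) -> cdiff n U h ->
  cdiff n U (fun y => Num.sqrt (h y)).
Proof.
move=> h0; elim: n => [|n IH] ch; have d := fun x (Ux : U x) => cdiff_differentiable ch Ux.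
  by split=> // x Ux; exact: (differentiable_sqrt (d x Ux) (h0 x Ux)).
split; first by move=> x Ux; exact: (differentiable_sqrt (d x Ux) (h0 x Ux)).
move=> i; apply: (@cdiff_ext _ _ (fun y => 2^-1 * (Num.sqrt (h y))^-1 * partial i h y)) => //.
  move=> y Uy; have s0 : Num.sqrt (h y) != 0 by rewrite gt_eqF// sqrtr_gt0 h0.
  have ds := differentiable_sqrt (d _ Uy) (h0 _ Uy).
  (* The derivative of the root is read off from that of its square. *)
  have : partial i h y = partial i (fun y => Num.sqrt (h y) * Num.sqrt (h y)) y.
    by apply: (partial_eq_on i oU Uy) => z Uz; rewrite -expr2 sqr_sqrtr// ltW// h0.
  by rewrite partialM// => ->; field; rewrite s0.
apply: cdiffM; last exact: cdiff_partial.
apply: cdiffM; first exact: cdiff_cst.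
apply: cdiffV; last by apply: IH; exact: cdiffW.
by move=> y Uy; rewrite gt_eqF// sqrtr_gt0 h0.
Qed.

Lemma cdiff_coord_comp n (D : set R) (p : R -> R) j :
  (forall y, U y -> D (y 0 j)) -> smooth_on D p ->
  cdiff n U (fun y => p (y 0 j)).
Proof.
move=> UD; elim: n p => [|n IH] p sp.
  by split=> // x Ux; apply: differentiable_coord_comp; apply: (sp 0%N); exact: UD.
split; first by move=> x Ux; apply: differentiable_coord_comp; apply: (sp 0%N); exact: UD.
move=> i; apply: (@cdiff_ext _ _ (fun y => (i == j)%:R * derive1 p (y 0 j))) => //.
  by move=> y Uy; rewrite partial_coord_comp//; apply: (sp 0%N); exact: UD.
apply: cdiffM; first exact: cdiff_cst.
by apply: IH => k r Dr; rewrite -derive1Sn; exact: (sp k.+1).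
Qed.

End Open.

Lemma smooth_on_derive1 (D : set R) (p : R -> R) :
  smooth_on D p -> smooth_on D (derive1 p).
Proof. by move=> sp k r Dr; rewrite -derive1Sn; exact: (sp k.+1). Qed.

Lemma derive1_sin : derive1 (@sin R) = cos.
Proof. by apply/funext => t; rewrite derive1E derive_val. Qed.

Lemma derive1_cos : derive1 (@cos R) = (fun t => - sin t).
Proof. by apply/funext => t; rewrite derive1E derive_val. Qed.

(** Derivatives run through sin, cos, -sin and -cos, so the induction carries all four functions. *)
Lemma smooth_on_sin_cos (D : set R) : smooth_on D (@sin R) /\ smooth_on D (@cos R).
Proof.
have key n : (forall t, derivable (derive1n n (@sin R)) t 1 /\ derivable (derive1n n (@cos R)) t 1) /\
   (forall t, derivable (derive1n n (fun t => - @sin R t)) t 1 /\ derivable (derive1n n (fun t => - @cos R t)) t 1).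
  have dN (p : R -> R) : (forall t, derivable p t 1) -> derive1 (fun t => - p t) = (fun t => - derive1 p t).
    by move=> dp; apply/funext => t; rewrite !derive1E deriveN.
  elim: n => [|n [IH IHN]].
    have ds t : derivable (@sin R) t 1 by exact: ex_derive.
    have dc t : derivable (@cos R) t 1 by exact: ex_derive.
    by split=> t /=; split=> //; apply: (@derivableN _ _ _ _ t 1).
  split=> t; rewrite !derive1Sn ?dN.
    rewrite derive1_sin derive1_cos; split; [exact: (IH t).2|exact: (IHN t).1].
  - rewrite derive1_sin derive1_cos; split; first exact: (IHN t).2.
    rewrite (_ : (fun t => - - sin t) = @sin R); first exact: (IH t).1.
    by apply/funext => ?; rewrite opprK.
  - by move=> ?; exact: ex_derive.
  - by move=> ?; exact: ex_derive.
split=> n t _; have [h _] := key n; [exact: (h t).1|exact: (h t).2].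
Qed.

Lemma chart_region_open (D : set R) : open D -> open (chart_region D).
Proof.
move=> oD.
have -> : chart_region D = (fun x : 'rV[R]_5 => x 0 i_rad) @^-1` D `&`
    (fun x : 'rV[R]_5 => x 0 i_th) @^-1` [set t | 0 < t < pi / 2].
  by apply/seteqP; split=> x.
have cc j : continuous (fun x : 'rV[R]_5 => x 0 j) by move=> x; exact: coord_continuous.
apply: openI; apply: open_comp => //; try by move=> x _; exact: cc.
by rewrite (_ : [set t | _] = `]0, pi / 2[%classic); [exact: interval_open|apply/seteqP; split=> t /=; rewrite in_itv].
Qed.

Lemma cdiff_radial n (D : set R) (p : R -> R) : open D -> smooth_on D p ->
  cdiff n (chart_region D) (fun y => p (y 0 i_rad)).
Proof.
by move=> oD; apply: cdiff_coord_comp => //; [exact: chart_region_open|move=> y []].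
Qed.

End Smoothness.

(** * Smooth functions of the radial coordinate alone *)

Section SmoothOn.
Variable R : realType.
Variable D : set R.
Hypothesis oD : open D.
Implicit Types (p q : R -> R).

Fixpoint rdiff (n : nat) p : Prop :=
  (forall r, D r -> derivable p r 1) /\
  (if n is n'.+1 then rdiff n' (derive1 p) else True).

Lemma smooth_onP p : smooth_on D p <-> forall n, rdiff n p.
Proof.
split=> [sp n|rp j].
  elim: n p sp => [|n IH] p sp; split=> //; try by move=> r /(sp 0%N).
  by apply: IH; exact: smooth_on_derive1.
elim: j p rp => [|j IH] p rp r Dr; first exact: (rp 0%N).1.
by rewrite derive1Sn; apply: IH Dr => n; exact: (rp n.+1).2.
Qed.

Lemma rdiffW n p : rdiff n.+1 p -> rdiff n p.
Proof. by elim: n p => [|n IH] p [d dp]; split=> //; exact: IH. Qed.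

Lemma near_on p q r : D r -> (forall t, D t -> p t = q t) -> \forall t \near r, p t = q t.
Proof.
by move=> Dr e; apply: filterS (open_nbhs_nbhs (conj oD Dr)) => t; exact: e.
Qed.

Lemma derive1_eq_on p q r : D r -> (forall t, D t -> p t = q t) -> derive1 p r = derive1 q r.
Proof. by move=> Dr e; rewrite !derive1E; apply: near_eq_derive; exact: near_on. Qed.

Lemma rdiff_ext n p q : (forall t, D t -> p t = q t) -> rdiff n p -> rdiff n q.
Proof.
elim: n p q => [|n IH] p q e [d dp].
  by split=> [r Dr|//]; apply: near_eq_derivable (d _ Dr); exact: near_on.
split; first by move=> r Dr; apply: near_eq_derivable (d _ Dr); exact: near_on.
by apply: IH dp => t Dt; exact: derive1_eq_on.
Qed.

Lemma derivableD1 p q r : derivable p r 1 -> derivable q r 1 ->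
  derivable (fun t => p t + q t) r 1.
Proof. by move=> dp dq; exact: (derivableD dp dq). Qed.

Lemma derivableM1 p q r : derivable p r 1 -> derivable q r 1 ->
  derivable (fun t => p t * q t) r 1.
Proof. by move=> dp dq; exact: (derivableM dp dq). Qed.

Lemma derivableV1 p r : p r != 0 -> derivable p r 1 ->
  derivable (fun t => (p t)^-1) r 1.
Proof. by move=> p0 dp; exact: (derivableV p0 dp). Qed.

Lemma derive1D p q r : derivable p r 1 -> derivable q r 1 ->
  derive1 (fun t => p t + q t) r = derive1 p r + derive1 q r.
Proof. by move=> dp dq; rewrite !derive1E; exact: (deriveD dp dq). Qed.

Lemma derive1M p q r : derivable p r 1 -> derivable q r 1 ->
  derive1 (fun t => p t * q t) r = derive1 p r * q r + p r * derive1 q r.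
Proof.
move=> dp dq; rewrite !derive1E; have := deriveM dp dq.
by rewrite [in RHS]addrC /GRing.scale/= (mulrC (q r)) => <-.
Qed.

Lemma derive1V p r : p r != 0 -> derivable p r 1 ->
  derive1 (fun t => (p t)^-1) r = - derive1 p r / p r ^+ 2.
Proof.
move=> p0 dp; rewrite !derive1E; have := deriveV p0 dp.
by rewrite /GRing.scale/= => ->; rewrite mulNr mulrC mulNr.
Qed.

Lemma rdiff_cst n c : rdiff n (fun=> c).
Proof.
elim: n c => [|n IH] c; split=> //; try by move=> r _; exact: derivable_cst.
rewrite (_ : derive1 _ = fun=> 0); first exact: IH.
by apply/funext => t; rewrite derive1_cst.
Qed.

Lemma rdiffD n p q : rdiff n p -> rdiff n q -> rdiff n (fun t => p t + q t).
Proof.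
elim: n p q => [|n IH] p q [d1 p1] [d2 p2].
  by split=> [r Dr|//]; exact: (derivableD1 (d1 r Dr) (d2 r Dr)).
split; first by move=> r Dr; exact: (derivableD1 (d1 r Dr) (d2 r Dr)).
apply: rdiff_ext (IH _ _ p1 p2) => t Dt.
by rewrite (derive1D (d1 _ Dt) (d2 _ Dt)).
Qed.

Lemma rdiffM n p q : rdiff n p -> rdiff n q -> rdiff n (fun t => p t * q t).
Proof.
elim: n p q => [|n IH] p q c1 c2.
  by case: c1 c2 => d1 _ [d2 _]; split=> [r Dr|//]; exact: (derivableM1 (d1 r Dr) (d2 r Dr)).
have [d1 p1] := c1; have [d2 p2] := c2; split.
  by move=> r Dr; exact: (derivableM1 (d1 r Dr) (d2 r Dr)).
apply: (@rdiff_ext _ (fun t => derive1 p t * q t + p t * derive1 q t)).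
  by move=> t Dt; rewrite (derive1M (d1 _ Dt) (d2 _ Dt)).
by apply: rdiffD; apply: IH; [exact: p1|exact: (rdiffW c2)|exact: (rdiffW c1)|exact: p2].
Qed.

Lemma rdiffV n p : (forall t, D t -> p t != 0) -> rdiff n p -> rdiff n (fun t => (p t)^-1).
Proof.
move=> p0; elim: n => [|n IH] cp; have [d p1] := cp.
  by split=> [r Dr|//]; exact: (derivableV1 (p0 r Dr) (d r Dr)).
split; first by move=> r Dr; exact: (derivableV1 (p0 r Dr) (d r Dr)).
apply: (@rdiff_ext _ (fun t => -1 * derive1 p t * ((p t)^-1 * (p t)^-1))).
  by move=> t Dt; rewrite (derive1V (p0 _ Dt) (d _ Dt)) mulN1r expr2 invfM.
have IH' := IH (rdiffW cp).
by apply: rdiffM; apply: rdiffM => //; exact: rdiff_cst.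
Qed.

Lemma smooth_cst c : smooth_on D (fun=> c).
Proof. by apply/smooth_onP => n; exact: rdiff_cst. Qed.

Lemma smoothD p q : smooth_on D p -> smooth_on D q -> smooth_on D (fun t => p t + q t).
Proof. by move=> /smooth_onP sp /smooth_onP sq; apply/smooth_onP => n; exact: rdiffD. Qed.

Lemma smoothM p q : smooth_on D p -> smooth_on D q -> smooth_on D (fun t => p t * q t).
Proof. by move=> /smooth_onP sp /smooth_onP sq; apply/smooth_onP => n; exact: rdiffM. Qed.

Lemma smoothN p : smooth_on D p -> smooth_on D (fun t => - p t).
Proof.
move=> /smooth_onP sp; apply/smooth_onP => n.
apply: rdiff_ext (rdiffM (rdiff_cst n (-1)) (sp n)) => t _.
by rewrite mulN1r.
Qed.

Lemma smoothX p k : smooth_on D p -> smooth_on D (fun t => p t ^+ k).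
Proof.
move=> sp; elim: k => [|k IH].
  by under eq_fun do rewrite expr0; exact: smooth_cst.
by under eq_fun do rewrite exprS; exact: smoothM.
Qed.

Lemma smoothV p : (forall t, D t -> p t != 0) -> smooth_on D p -> smooth_on D (fun t => (p t)^-1).
Proof. by move=> p0 /smooth_onP sp; apply/smooth_onP => n; exact: rdiffV. Qed.

End SmoothOn.

(** * The ansatz metric *)

Lemma sum5 (V : nmodType) (F : 'I_5 -> V) :
  \sum_i F i = F i_t + F i_rad + F i_th + F i_phi + F i_psi.
Proof.
rewrite !big_ord_recl big_ord0 addr0 !addrA.
by congr (F _ + F _ + F _ + F _ + F _); apply/val_inj.
Qed.

Lemma ind5 (P : 'I_5 -> Prop) :
  P i_t -> P i_rad -> P i_th -> P i_phi -> P i_psi -> forall i, P i.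
Proof.
move=> p0 p1 p2 p3 p4 [[|[|[|[|[|k]]]]] ik] //.
- by rewrite (_ : Ordinal _ = i_t)//; exact/val_inj.
- by rewrite (_ : Ordinal _ = i_rad)//; exact/val_inj.
- by rewrite (_ : Ordinal _ = i_th)//; exact/val_inj.
- by rewrite (_ : Ordinal _ = i_phi)//; exact/val_inj.
- by rewrite (_ : Ordinal _ = i_psi)//; exact/val_inj.
Qed.

Section Geometry.
Variable R : realType.
Implicit Types (x : 'rV[R]_5) (i j k : 'I_5) (th : R).

Definition dt i : R := (i == i_t)%:R.
Definition dr i : R := (i == i_rad)%:R.
Definition dth i : R := (i == i_th)%:R.
Definition dphi i : R := (i == i_phi)%:R.
Definition dpsi i : R := (i == i_psi)%:R.
Definition dchi i : R := dphi i - dpsi i.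
Definition sig th i : R := sin th ^+ 2 * dphi i + cos th ^+ 2 * dpsi i.
(** Read as vectors, [xi] and [evec] form the basis of the (phi, psi) plane dual to the covectors
    [sig] and [dchi]. *)
Definition xi i : R := dphi i + dpsi i.
Definition evec th i : R := cos th ^+ 2 * dphi i - sin th ^+ 2 * dpsi i.

Lemma sin2cos2 th : sin th ^+ 2 = 1 - cos th ^+ 2.
Proof. by rewrite -(cos2Dsin2 th) addrAC subrr add0r. Qed.

Lemma dxE i j : @dx R i 0 j = (j == i)%:R.
Proof. by rewrite mxE eqxx. Qed.

Variables f m N w : R -> R.
Definition bb r : R := N r / m r.
Definition gtt r : R := - f r + bb r * w r ^+ 2.
Definition gts r : R := - (bb r * w r).
Definition grr r : R := m r / (4 * f r * N r).
Definition aa r : R := m r / f r.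

(** With s = sin and c = cos, s^2 (dphi - w dt)^2 + c^2 (dpsi - w dt)^2 = (sigma - w dt)^2 + s^2 c^2
    dchi^2. The last term of the ansatz then combines with s^2 c^2 dchi^2 to give the coefficient
    m/f, and the metric is orthogonal in the coframe dt, dR, dtheta, sigma - w dt, dchi. *)
Definition gmx (r th : R) i j : R :=
  gtt r * (dt i * dt j) + gts r * (dt i * sig th j + sig th i * dt j)
  + bb r * (sig th i * sig th j) + grr r * (dr i * dr j)
  + aa r * (dth i * dth j + (sin th * cos th) ^+ 2 * (dchi i * dchi j)).

(** The inverse metric in the dual frame: d_t + w xi is dual to dt, xi to sigma - w dt, and evec to
    dchi. *)
Definition hmx (r th : R) i j : R :=
  - (f r)^-1 * ((dt i + w r * xi i) * (dt j + w r * xi j))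
  + (bb r)^-1 * (xi i * xi j) + (grr r)^-1 * (dr i * dr j)
  + (aa r)^-1 * (dth i * dth j + (sin th * cos th) ^- 2 * (evec th i * evec th j)).

Local Notation g := (ansatz_metric f m N w).

Lemma ansatz_metricE x i j : let r := x 0 i_rad in let th := x 0 i_th in
  f r != 0 -> m r != 0 -> N r != 0 -> g x i j = gmx r th i j.
Proof.
move=> r th f0 m0 N0; rewrite /ansatz_metric -/r -/th /form_square.
rewrite !(mxE, big_ord_recl, big_ord0) /=.
rewrite /gmx /gtt /gts /bb /grr /aa /sig /dchi /dt /dr /dth /dphi /dpsi.
rewrite exprMn sin2cos2; field.
by rewrite N0 m0 f0.
Qed.

Lemma gmx_sym r th i j : gmx r th i j = gmx r th j i.
Proof. by rewrite /gmx; ring. Qed.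

Lemma gmx_hmx r th i k : f r != 0 -> m r != 0 -> N r != 0 ->
  sin th != 0 -> cos th != 0 ->
  \sum_j gmx r th i j * hmx r th j k = (i == k)%:R.
Proof.
move=> f0 m0 N0 s0 c0; rewrite sum5 /gmx /hmx /gtt /gts /bb /grr /aa /sig /xi /evec /dchi /dt /dr /dth /dphi /dpsi.
(* Only squares of sine and cosine occur, so each entry becomes a rational identity in c = cos^2. *)
move: s0 c0; rewrite -!(sqrf_eq0 (sin _)) -!(sqrf_eq0 (cos _)) exprMn sin2cos2.
set c := cos th ^+ 2 => s0 c0.
elim/ind5: i; elim/ind5: k; rewrite /=; field; by rewrite ?f0 ?m0 ?N0 ?s0 ?c0.
Qed.

End Geometry.

Section AngularDerivatives.
Variable R : realType.
Implicit Types (i : 'I_5) (th : R).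

Lemma derive1_is (h : R -> R) (t d : R) : is_derive t 1 h d -> derive1 h t = d.
Proof. by move=> hd; rewrite derive1E derive_val. Qed.

(** This is sin(2 theta), the derivative of sin^2. *)
Definition sc2 th : R := 2 * sin th * cos th.

Lemma is_derive_sig i th : is_derive th 1 (fun t : R => sig t i) (sc2 th * dchi R i).
Proof.
rewrite /sig; apply: is_derive_eq.
by rewrite /GRing.scale/= /dchi /sc2; ring.
Qed.

Lemma is_derive_sinocos th :
  is_derive th 1 (fun t : R => (sin t * cos t) ^+ 2)
    (sc2 th * (cos th ^+ 2 - sin th ^+ 2)).
Proof.
apply: is_derive_eq.
by rewrite /GRing.scale/= /sc2; ring.
Qed.

End AngularDerivatives.

Section Chart.
Variable R : realType.
Implicit Types (x y : 'rV[R]_5) (i j k : 'I_5).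
Variables (D : set R) (f m N w : R -> R).
Hypotheses (oD : open D) (sf : smooth_on D f) (sm : smooth_on D m) (sN : smooth_on D N)
  (sw : smooth_on D w) (pos : forall r, D r -> [/\ 0 < f r, 0 < m r & 0 < N r]).
Local Notation U := (chart_region D).
Local Notation g := (ansatz_metric f m N w).
Local Notation rad x := (x 0 i_rad).
Local Notation tht x := (x 0 i_th).

Lemma f_neq0 r : D r -> f r != 0. Proof. by case/pos => h _ _; rewrite gt_eqF. Qed.
Lemma m_neq0 r : D r -> m r != 0. Proof. by case/pos => _ h _; rewrite gt_eqF. Qed.
Lemma N_neq0 r : D r -> N r != 0. Proof. by case/pos => _ _ h; rewrite gt_eqF. Qed.

Lemma chart_sin_gt0 x : U x -> 0 < sin (tht x).
Proof. by case=> _; exact: sin_gt0_pihalf. Qed.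

Lemma chart_cos_gt0 x : U x -> 0 < cos (tht x).
Proof.
case=> _ /andP[h0 h1]; apply: cos_gt0_pihalf; rewrite h1 andbT.
by apply: lt_trans h0; rewrite oppr_lt0 divr_gt0// pi_gt0.
Qed.

Lemma smooth_bb : smooth_on D (bb m N).
Proof. exact: (smoothM oD sN (smoothV oD m_neq0 sm)). Qed.

Lemma smooth_gtt : smooth_on D (gtt f m N w).
Proof. exact: (smoothD oD (smoothN oD sf) (smoothM oD smooth_bb (smoothX (k := 2%N) oD sw))). Qed.

Lemma smooth_gts : smooth_on D (gts m N w).
Proof. exact: (smoothN oD (smoothM oD smooth_bb sw)). Qed.

Lemma smooth_grr : smooth_on D (grr f m N).
Proof.
apply: (smoothM oD sm); apply: (smoothV oD).
  by move=> r Dr; rewrite !mulf_neq0// ?f_neq0 ?N_neq0// pnatr_eq0.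
exact: (smoothM oD (smoothM oD (@smooth_cst R D 4) sf) sN).
Qed.

Lemma smooth_aa : smooth_on D (aa f m).
Proof. exact: (smoothM oD sm (smoothV oD f_neq0 sf)). Qed.

Lemma metricE x i j : U x -> g x i j = gmx f m N w (rad x) (tht x) i j.
Proof.
by move=> Ux; have [Dr _] := Ux; apply: ansatz_metricE; [exact: f_neq0|exact: m_neq0|exact: N_neq0].
Qed.

Lemma ansatz_metric_sym x i j : U x -> g x i j = g x j i.
Proof. by move=> Ux; rewrite !metricE// gmx_sym. Qed.

Lemma metric_mul_hmx x : U x ->
  g x *m \matrix_(i, j) hmx f m N w (rad x) (tht x) i j = 1%:M.
Proof.
move=> Ux; have [Dr _] := Ux; apply/matrixP => i k; rewrite !mxE.
under eq_bigr do rewrite metricE// mxE.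
rewrite gmx_hmx ?f_neq0 ?m_neq0 ?N_neq0//.
  by rewrite gt_eqF// chart_sin_gt0.
by rewrite gt_eqF// chart_cos_gt0.
Qed.

Lemma metric_unit x : U x -> g x \in unitmx.
Proof. by move=> /metric_mul_hmx/mulmx1_unit[]. Qed.

Lemma ginvE x i j : U x -> ginv g x i j = hmx f m N w (rad x) (tht x) i j.
Proof.
move=> Ux; rewrite /ginv.
have -> : invmx (g x) = \matrix_(i, j) hmx f m N w (rad x) (tht x) i j.
  by rewrite -[LHS]mulmx1 -(metric_mul_hmx Ux) mulKmx// metric_unit.
by rewrite mxE.
Qed.

Lemma differentiable_sep (a b : R -> R) x :
  derivable a (rad x) 1 -> derivable b (tht x) 1 ->
  differentiable (fun y : 'rV[R]_5 => a (rad y) * b (tht y)) x.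
Proof. by move=> da db; apply: differentiableM_fun; exact: differentiable_coord_comp. Qed.

Lemma partial_sep k (a b : R -> R) x :
  derivable a (rad x) 1 -> derivable b (tht x) 1 ->
  partial k (fun y : 'rV[R]_5 => a (rad y) * b (tht y)) x
  = dr R k * (derive1 a (rad x) * b (tht x)) + dth R k * (a (rad x) * derive1 b (tht x)).
Proof.
move=> da db; rewrite partialM; try exact: differentiable_coord_comp.
by rewrite !partial_coord_comp// /dr /dth; ring.
Qed.

Definition gmx_dr (r th : R) i j : R :=
  derive1 (gtt f m N w) r * (dt R i * dt R j)
  + derive1 (gts m N w) r * (dt R i * sig th j + sig th i * dt R j)
  + derive1 (bb m N) r * (sig th i * sig th j) + derive1 (grr f m N) r * (dr R i * dr R j)
  + derive1 (aa f m) r * (dth R i * dth R j + (sin th * cos th) ^+ 2 * (dchi R i * dchi R j)).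

Definition gmx_dth (r th : R) i j : R := sc2 th *
  (gts m N w r * (dt R i * dchi R j + dchi R i * dt R j)
  + bb m N r * (dchi R i * sig th j + sig th i * dchi R j)
  + aa f m r * ((cos th ^+ 2 - sin th ^+ 2) * (dchi R i * dchi R j))).

(** Every summand of [gmx] is a radial function times an angular one, so the derivative is taken
    term by term with [partial_sep]. *)
Lemma partial_metric k i j x : U x ->
  partial k (fun y => g y i j) x
  = dr R k * gmx_dr (rad x) (tht x) i j + dth R k * gmx_dth (rad x) (tht x) i j.
Proof.
move=> Ux; have [Dr _] := Ux.
have oU : open U by exact: chart_region_open.
rewrite (@partial_eq_on _ U k _ (fun y => gmx f m N w (rad y) (tht y) i j) x)//; last first.
  by move=> y Uy; rewrite metricE.
have d1 : derivable (gtt f m N w) (rad x) 1 := smooth_gtt (j := 0%N) Dr.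
have d2 : derivable (gts m N w) (rad x) 1 := smooth_gts (j := 0%N) Dr.
have d3 : derivable (bb m N) (rad x) 1 := smooth_bb (j := 0%N) Dr.
have d4 : derivable (grr f m N) (rad x) 1 := smooth_grr (j := 0%N) Dr.
have d5 : derivable (aa f m) (rad x) 1 := smooth_aa (j := 0%N) Dr.
have e1 : is_derive (tht x) 1 (fun t : R => dt R i * dt R j) 0 by exact: is_derive_cst.
have e2 : is_derive (tht x) 1 (fun t : R => dt R i * sig t j + sig t i * dt R j)
   (sc2 (tht x) * (dt R i * dchi R j + dchi R i * dt R j)).
  have := is_derive_sig i (tht x); have := is_derive_sig j (tht x) => ? ?.
  by apply: is_derive_eq; rewrite /GRing.scale/=; ring.
have e3 : is_derive (tht x) 1 (fun t : R => sig t i * sig t j)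
   (sc2 (tht x) * (dchi R i * sig (tht x) j + sig (tht x) i * dchi R j)).
  have := is_derive_sig i (tht x); have := is_derive_sig j (tht x) => ? ?.
  by apply: is_derive_eq; rewrite /GRing.scale/=; ring.
have e4 : is_derive (tht x) 1 (fun t : R => dr R i * dr R j) 0 by exact: is_derive_cst.
have e5 : is_derive (tht x) 1
    (fun t : R => dth R i * dth R j + (sin t * cos t) ^+ 2 * (dchi R i * dchi R j))
   (sc2 (tht x) * ((cos (tht x) ^+ 2 - sin (tht x) ^+ 2) * (dchi R i * dchi R j))).
  have := is_derive_sinocos (tht x) => ?.
  by apply: is_derive_eq; rewrite /GRing.scale/=; ring.
have s1 := @ex_derive _ _ _ _ _ _ _ e1; have s2 := @ex_derive _ _ _ _ _ _ _ e2.
have s3 := @ex_derive _ _ _ _ _ _ _ e3; have s4 := @ex_derive _ _ _ _ _ _ _ e4.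
have s5 := @ex_derive _ _ _ _ _ _ _ e5.
have t1 := differentiable_sep d1 s1; have t2 := differentiable_sep d2 s2.
have t3 := differentiable_sep d3 s3; have t4 := differentiable_sep d4 s4.
have t5 := differentiable_sep d5 s5.
rewrite /gmx.
rewrite (partialD _ (differentiableD_fun (differentiableD_fun (differentiableD_fun t1 t2) t3) t4) t5).
rewrite (partialD _ (differentiableD_fun (differentiableD_fun t1 t2) t3) t4).
rewrite (partialD _ (differentiableD_fun t1 t2) t3) (partialD _ t1 t2).
rewrite (partial_sep k d1 s1) (partial_sep k d2 s2) (partial_sep k d3 s3).
rewrite (partial_sep k d4 s4) (partial_sep k d5 s5).
rewrite (derive1_is e1) (derive1_is e2) (derive1_is e3) (derive1_is e4) (derive1_is e5).
by rewrite /gmx_dr /gmx_dth; ring.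
Qed.

Lemma cdiff_angular n l : [/\ cdiff n U (fun y => sin (tht y)), cdiff n U (fun y => cos (tht y)) &
  cdiff n U (fun y => sig (tht y) l)].
Proof.
have oU : open U by exact: chart_region_open.
have [ss sc] := smooth_on_sin_cos (@setT R).
have csin : cdiff n U (fun y => sin (tht y)) := @cdiff_coord_comp _ _ oU n setT _ _ (fun _ _ => I) ss.
have ccos : cdiff n U (fun y => cos (tht y)) := @cdiff_coord_comp _ _ oU n setT _ _ (fun _ _ => I) sc.
have cc c : cdiff n U (fun=> c) := cdiff_cst n U c.
split=> //; exact: (cdiffD oU (cdiffM oU (cdiffX oU 2 csin) (cc _)) (cdiffM oU (cdiffX oU 2 ccos) (cc _))).
Qed.

Lemma cdiff_metric n i j : cdiff n U (fun y => g y i j).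
Proof.
have oU : open U by exact: chart_region_open.
apply: (@cdiff_ext _ _ _ (fun y => gmx f m N w (rad y) (tht y) i j)) => //.
  by move=> y Uy; rewrite metricE.
have [csin ccos _] := cdiff_angular n i.
have crad p : smooth_on D p -> cdiff n U (fun y => p (rad y)) by exact: cdiff_radial.
have cc c : cdiff n U (fun=> c) by exact: cdiff_cst.
have csig l : cdiff n U (fun y => sig (tht y) l) by have [] := cdiff_angular n l.
have cM h1 h2 := @cdiffM R U oU n h1 h2; have cD h1 h2 := @cdiffD R U oU n h1 h2.
rewrite /gmx; apply: (cD _ _); first apply: (cD _ _); first apply: (cD _ _); first apply: (cD _ _).
- exact: (cM _ _ (crad _ smooth_gtt) (cc _)).
- apply: (cM _ _ (crad _ smooth_gts)); apply: (cD _ _).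
    exact: (cM _ _ (cc _) (csig _)).
  exact: (cM _ _ (csig _) (cc _)).
- exact: (cM _ _ (crad _ smooth_bb) (cM _ _ (csig _) (csig _))).
- exact: (cM _ _ (crad _ smooth_grr) (cc _)).
- apply: (cM _ _ (crad _ smooth_aa)); apply: (cD _ _ (cc _)).
  exact: (cM _ _ (cdiffX oU 2 (cM _ _ csin ccos)) (cc _)).
Qed.

End Chart.

(** * Covariant derivatives *)

Section InverseMatrix.
Variable R : realType.

Lemma differentiable_det n (M : 'rV[R]_5 -> 'M[R]_n) x :
  (forall i j, differentiable (fun y => M y i j) x) ->
  differentiable (fun y => \det (M y)) x.
Proof.
move=> dM; rewrite /determinant; apply: differentiable_sum_fun => s.
apply: differentiableM_fun; first exact: differentiable_cst.
by apply: differentiable_bigop => [h1 h2|i]; [exact: differentiableM_fun|exact: dM].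
Qed.

(** Cramer's formula: each entry of the inverse is a quotient of determinants. *)
Lemma differentiable_invmx (U : set 'rV[R]_5) (M : 'rV[R]_5 -> 'M[R]_5) x i j :
  open U -> U x -> (forall y, U y -> M y \in unitmx) ->
  (forall i j, differentiable (fun y => M y i j) x) ->
  differentiable (fun y => invmx (M y) i j) x.
Proof.
move=> oU Ux uM dM.
apply: (@differentiable_near_eq _ U (fun y => (\det (M y))^-1 * cofactor (M y) j i)) => //.
  by move=> y Uy; rewrite /invmx uM// !mxE.
apply: differentiableM_fun.
  apply: differentiableV; first exact: differentiable_det.
  by have := uM x Ux; rewrite unitmxE unitfE.
apply: differentiableM_fun; first exact: differentiable_cst.
apply: differentiable_det => k l.
by under eq_fun do rewrite !mxE; exact: dM.
Qed.

End InverseMatrix.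

Section Tensor.
Variable R : realType.
Implicit Types (a b c d e i j : 'I_5).
Variables (U : set 'rV[R]_5) (g : 'rV[R]_5 -> 'M[R]_5).
Hypotheses (oU : open U) (gsym : forall y i j, U y -> g y i j = g y j i)
  (gunit : forall y, U y -> g y \in unitmx) (g_smooth : forall i j, cdiff 1 U (fun y => g y i j)).

Let dg x (Ux : U x) i j : differentiable (fun y => g y i j) x.
Proof. exact: (cdiff_differentiable (g_smooth i j) Ux). Qed.

Local Notation dG b i j x := (partial b (fun y => g y i j) x).

Lemma partial_metric_sym x b i j : U x -> dG b i j x = dG b j i x.
Proof. by move=> Ux; apply: (partial_eq_on _ oU Ux) => y Uy; exact: gsym. Qed.

Lemma christoffel_sym x a b c : U x -> christoffel g a b c x = christoffel g a c b x.
Proof.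
move=> Ux; rewrite /christoffel; congr (_ * _); apply: eq_bigr => d _.
by rewrite (partial_metric_sym d b c Ux); ring.
Qed.

Lemma sum_metric_ginv x d (F : 'I_5 -> R) : U x ->
  \sum_a g x d a * (\sum_e ginv g x a e * F e) = F d.
Proof.
move=> Ux; under eq_bigr do rewrite mulr_sumr.
rewrite exchange_big /=.
transitivity (\sum_e (1%:M : 'M[R]_5) d e * F e).
  apply: eq_bigr => e _; rewrite -(mulmxV (gunit Ux)) mxE mulr_suml.
  by apply: eq_bigr => a _; rewrite mulrA.
rewrite (bigD1 d)//= mxE eqxx mul1r big1 ?addr0// => e /negbTE ed.
by rewrite mxE eq_sym ed mul0r.
Qed.

Lemma sum_ginv_metric x d (F : 'I_5 -> R) : U x ->
  \sum_a ginv g x d a * (\sum_e g x a e * F e) = F d.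
Proof.
move=> Ux; under eq_bigr do rewrite mulr_sumr.
rewrite exchange_big /=.
transitivity (\sum_e (1%:M : 'M[R]_5) d e * F e).
  apply: eq_bigr => e _; rewrite -(mulVmx (gunit Ux)) mxE mulr_suml.
  by apply: eq_bigr => a _; rewrite mulrA.
rewrite (bigD1 d)//= mxE eqxx mul1r big1 ?addr0// => e /negbTE ed.
by rewrite mxE eq_sym ed mul0r.
Qed.

Lemma christoffel_low x b c d : U x ->
  \sum_a g x d a * christoffel g a b c x
  = 2^-1 * (dG b d c x + dG c d b x - dG d b c x).
Proof.
move=> Ux; rewrite /christoffel.
under eq_bigr do rewrite mulrCA.
by rewrite -mulr_sumr sum_metric_ginv.
Qed.

Section Field.
Variable k : 'rV[R]_5 -> 'cV[R]_5.
Hypothesis k_smooth : forall i, cdiff 1 U (fun y => k y i 0).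

Let dk_ x (Ux : U x) i : differentiable (fun y => k y i 0) x.
Proof. exact: (cdiff_differentiable (k_smooth i) Ux). Qed.

Definition lower y d : R := \sum_a g y d a * k y a 0.

Local Notation dk b a x := (partial b (fun y => k y a 0) x).
Local Notation dlow b d x := (partial b (fun y => lower y d) x).

Lemma differentiable_lower x d : U x -> differentiable (fun y => lower y d) x.
Proof.
move=> Ux; apply: differentiable_sum_fun => a.
by apply: differentiableM_fun; [exact: dg|exact: dk_].
Qed.

Lemma partial_lower x b d : U x ->
  dlow b d x = \sum_a (dG b d a x * k x a 0 + g x d a * dk b a x).
Proof.
move=> Ux; rewrite /lower partial_sum => [|a]; last first.
  by apply: differentiableM_fun; [exact: dg|exact: dk_].
by apply: eq_bigr => a _; rewrite partialM//; [exact: dg|exact: dk_].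
Qed.

Lemma cov_low x b d : U x ->
  \sum_a g x d a * cov_deriv_vector g k b a x
  = \sum_a g x d a * dk b a x
    + 2^-1 * \sum_c (dG b d c x + dG c d b x - dG d b c x) * k x c 0.
Proof.
move=> Ux; rewrite /cov_deriv_vector.
under eq_bigr do rewrite mulrDr mulr_sumr.
rewrite big_split /=; congr (_ + _).
rewrite exchange_big /= mulr_sumr; apply: eq_bigr => c _.
rewrite mulrA -christoffel_low// mulr_suml.
by apply: eq_bigr => a _; rewrite mulrA.
Qed.

(* The symmetric part of the lowered covariant derivative is half the Lie
   derivative of the metric along [k]. *)
Lemma cov_low_lie x b d : U x ->
  \sum_a g x d a * cov_deriv_vector g k b a x
  = 2^-1 * (dlow b d x - dlow d b x)
    + 2^-1 * (\sum_c k x c 0 * dG c d b x + \sum_a g x d a * dk b a x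
              + \sum_a g x b a * dk d a x).
Proof.
move=> Ux; rewrite cov_low// !partial_lower//.
have -> : \sum_c (dG b d c x + dG c d b x - dG d b c x) * k x c 0
   = \sum_c dG b d c x * k x c 0 + \sum_c k x c 0 * dG c d b x
     - \sum_c dG d b c x * k x c 0.
  by rewrite -big_split -sumrB; apply: eq_bigr => c _; rewrite /=; ring.
by rewrite 2!big_split /=; field.
Qed.

(** The geodesic equation in Euler-Lagrange form. Two of the three Christoffel terms agree after
    contraction with k^b k^c and merge into the derivative of the lowered vector; what remains is a
    derivative of the metric in direction d, which vanishes for a cyclic coordinate. *)
Lemma accel_low x d : U x ->
  \sum_a g x d a * (\sum_b k x b 0 * cov_deriv_vector g k b a x)
  = \sum_b k x b 0 * dlow b d x
    - 2^-1 * \sum_b \sum_c dG d b c x * k x b 0 * k x c 0.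
Proof.
move=> Ux.
under eq_bigr do rewrite mulr_sumr.
rewrite exchange_big /=.
transitivity (\sum_b k x b 0 * (\sum_a g x d a * cov_deriv_vector g k b a x)).
  by apply: eq_bigr => b _; rewrite mulr_sumr; apply: eq_bigr => a _; rewrite mulrCA.
have -> : \sum_b k x b 0 * (\sum_a g x d a * cov_deriv_vector g k b a x)
   = \sum_b k x b 0 * (\sum_a g x d a * dk b a x)
     + \sum_b k x b 0 * (2^-1 * \sum_c (dG b d c x + dG c d b x - dG d b c x) * k x c 0).
  by rewrite -big_split; apply: eq_bigr => b _; rewrite cov_low// mulrDr.
have -> : \sum_b k x b 0 * dlow b d x = \sum_b k x b 0 * (\sum_a dG b d a x * k x a 0)
    + \sum_b k x b 0 * (\sum_a g x d a * dk b a x).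
  rewrite -big_split; apply: eq_bigr => b _.
  by rewrite partial_lower// big_split mulrDr.
suff -> : \sum_b k x b 0 * (2^-1 * \sum_c (dG b d c x + dG c d b x - dG d b c x) * k x c 0)
  = \sum_b k x b 0 * (\sum_a dG b d a x * k x a 0)
    - 2^-1 * \sum_b \sum_c dG d b c x * k x b 0 * k x c 0.
  by ring.
have E1 : \sum_b \sum_c k x b 0 * (dG b d c x * k x c 0)
   = \sum_b \sum_c k x b 0 * (dG c d b x * k x c 0).
  by rewrite exchange_big; apply: eq_bigr => b _; apply: eq_bigr => c _; rewrite mulrCA mulrA mulrC.
under [in RHS]eq_bigr do rewrite mulr_sumr.
transitivity (2^-1 * (\sum_b \sum_c k x b 0 * (dG b d c x * k x c 0)
   + \sum_b \sum_c k x b 0 * (dG c d b x * k x c 0)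
   - \sum_b \sum_c dG d b c x * k x b 0 * k x c 0)).
  rewrite -big_split -sumrB mulr_sumr; apply: eq_bigr => b _.
  rewrite mulrCA mulr_sumr -big_split -sumrB /=; congr (_ * _).
  by apply: eq_bigr => c _; ring.
by rewrite -E1; field.
Qed.

(** Metric compatibility in coordinates: the contraction is half the derivative of the squared
    length of [k]. *)
Lemma null_cov x b : U x ->
  (forall y, U y -> \sum_d k y d 0 * lower y d = 0) ->
  \sum_a lower x a * cov_deriv_vector g k b a x = 0.
Proof.
move=> Ux null.
have dl d := differentiable_lower d Ux.
have n0 : \sum_d (dk b d x * lower x d + k x d 0 * dlow b d x) = 0.
  transitivity (partial b (fun y => \sum_d k y d 0 * lower y d) x).
    rewrite partial_sum => [|d]; last first.
      by apply: differentiableM_fun; [exact: dk_|exact: dl].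
    by apply: eq_bigr => d _; rewrite (partialM _ (dk_ Ux d) (dl d)).
  by rewrite (partial_eq_on _ oU Ux null) partial_cst.
pose Z := \sum_d \sum_c k x d 0 * (dG b d c x * k x c 0).
pose Y := \sum_a lower x a * dk b a x.
have gY : \sum_d k x d 0 * (\sum_a g x d a * dk b a x) = Y.
  under eq_bigr do rewrite mulr_sumr.
  rewrite exchange_big; apply: eq_bigr => a _; rewrite /lower mulr_suml.
  by apply: eq_bigr => d _; rewrite (gsym d a Ux); ring.
(* The derivative of the null condition. The contraction sought comes out as Y + Z / 2, since its
   other two Christoffel terms cancel by symmetry. *)
have {}n0 : 2 * Y + Z = 0.
  rewrite -n0 big_split /=.
  have -> : \sum_d dk b d x * lower x d = Y by apply: eq_bigr => d _; rewrite mulrC.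
  have -> : \sum_d k x d 0 * dlow b d x = Z + Y.
    rewrite -gY -big_split; apply: eq_bigr => d _.
    by rewrite partial_lower// big_split /= mulrDr; congr (_ + _); rewrite mulr_sumr.
  by ring.
transitivity (\sum_d k x d 0 * (\sum_a g x d a * cov_deriv_vector g k b a x)).
  under [RHS]eq_bigr do rewrite mulr_sumr.
  rewrite exchange_big; apply: eq_bigr => a _; rewrite /lower mulr_suml.
  by apply: eq_bigr => d _; rewrite (gsym d a Ux); ring.
transitivity (Y + 2^-1 * (Z + (\sum_d \sum_c k x d 0 * (dG c d b x * k x c 0)
    - \sum_d \sum_c k x d 0 * (dG d b c x * k x c 0)))).
  rewrite -gY /Z -sumrB -big_split mulr_sumr -big_split; apply: eq_bigr => d _.
  rewrite cov_low// mulrDr; congr (_ + _); rewrite mulrCA; congr (_ * _).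
  rewrite mulr_sumr -sumrB -big_split; apply: eq_bigr => c _ /=; ring.
have -> : \sum_d \sum_c k x d 0 * (dG c d b x * k x c 0)
    = \sum_d \sum_c k x d 0 * (dG d b c x * k x c 0).
  rewrite exchange_big; apply: eq_bigr => d _; apply: eq_bigr => c _.
  by rewrite (partial_metric_sym d c b Ux); ring.
rewrite subrr addr0; have -> : Z = - (2 * Y) by rewrite -[Z](addKr (2 * Y)) n0 addr0.
by field.
Qed.

End Field.

Lemma christoffel_differentiable x a b c : U x -> differentiable (christoffel g a b c) x.
Proof.
move=> Ux; rewrite /christoffel.
apply: differentiableM_fun; first exact: differentiable_cst.
apply: differentiable_sum_fun => d; apply: differentiableM_fun.
  by apply: (differentiable_invmx _ _ oU Ux gunit) => i j; exact: dg.
have dp i j l : differentiable (partial l (fun y => g y i j)) x.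
  exact: (cdiff_differentiable (cdiff_partial l (g_smooth i j)) Ux).
by apply: differentiableB_fun; [apply: differentiableD_fun; exact: dp|exact: dp].
Qed.

End Tensor.

(** * The electromagnetic field and its null eigenvectors *)

Section OneForms.
Variable R : realType.
Implicit Types (x y : 'rV[R]_5) (i j : 'I_5).
Local Notation rad x := (x 0 i_rad).
Local Notation tht x := (x 0 i_th).

(** The common shape of the potential and of the lowered Killing vectors; both are differentiated
    through it. *)
Definition oneform (p q : R -> R) y j : R := p (rad y) * dt R j + q (rad y) * sig (tht y) j.

(** The components of the exterior derivative of [oneform p q]; the last term comes from d sigma =
    sin(2 theta) dtheta ^ dchi. *)
Definition fmx (p q : R -> R) (r th : R) i j : R :=
  dr R i * (derive1 p r * dt R j + derive1 q r * sig th j)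
  - dr R j * (derive1 p r * dt R i + derive1 q r * sig th i)
  + q r * sc2 th * (dth R i * dchi R j - dth R j * dchi R i).

Lemma partial_oneform (p q : R -> R) x i j :
  derivable p (rad x) 1 -> derivable q (rad x) 1 ->
  partial i (fun y => oneform p q y j) x
  = dr R i * (derive1 p (rad x) * dt R j + derive1 q (rad x) * sig (tht x) j)
    + dth R i * (q (rad x) * (sc2 (tht x) * dchi R j)).
Proof.
move=> dp dq.
have e1 : is_derive (tht x) 1 (fun t : R => dt R j) 0 by exact: is_derive_cst.
have e2 := is_derive_sig j (tht x).
have s1 := @ex_derive _ _ _ _ _ _ _ e1; have s2 := @ex_derive _ _ _ _ _ _ _ e2.
rewrite /oneform (partialD _ (differentiable_sep dp s1) (differentiable_sep dq s2)).
rewrite (partial_sep i dp s1) (partial_sep i dq s2) (derive1_is e1) (derive1_is e2).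
by ring.
Qed.

Lemma ansatz_potentialE a0 ap y j : ansatz_potential a0 ap y 0 j = oneform a0 ap y j.
Proof.
rewrite /ansatz_potential !mxE /= /oneform /sig /dt /dphi /dpsi; ring.
Qed.

Lemma fieldE (a0 ap : R -> R) x i j : derivable a0 (rad x) 1 -> derivable ap (rad x) 1 ->
  ansatz_field a0 ap x i j = fmx a0 ap (rad x) (tht x) i j.
Proof.
move=> d0 dp; rewrite /ansatz_field /exterior_derivative mxE.
under [X in partial i X]eq_fun do rewrite ansatz_potentialE.
under [X in partial j X]eq_fun do rewrite ansatz_potentialE.
rewrite !partial_oneform// /fmx; ring.
Qed.

End OneForms.

Section MetricAction.
Variable R : realType.
Implicit Types (v : 'I_5 -> R).
Variables f m N w : R -> R.

(** The value of the covector sigma - w dt on [v]. *)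
Definition vS r th v : R := sin th ^+ 2 * v i_phi + cos th ^+ 2 * v i_psi - w r * v i_t.

Lemma sum_gmx r th v :
  let S := vS r th v in let C := v i_phi - v i_psi in
  let s := sin th in let c := cos th in
  [/\ \sum_j gmx f m N w r th i_t j * v j = - f r * v i_t - w r * bb m N r * S,
   \sum_j gmx f m N w r th i_rad j * v j = grr f m N r * v i_rad,
   \sum_j gmx f m N w r th i_th j * v j = aa f m r * v i_th,
   \sum_j gmx f m N w r th i_phi j * v j = s ^+ 2 * (bb m N r * S) + aa f m r * (s * c) ^+ 2 * C &
   \sum_j gmx f m N w r th i_psi j * v j = c ^+ 2 * (bb m N r * S) - aa f m r * (s * c) ^+ 2 * C].
Proof.
split; rewrite sum5 /gmx /vS /gtt /gts /dt /dr /dth /dchi /sig /dphi /dpsi /=; ring.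
Qed.

Variables a0 ap : R -> R.
Lemma sum_fmx r th v :
  let s := sin th in let c := cos th in
  [/\ \sum_j fmx a0 ap r th i_t j * v j = - derive1 a0 r * v i_rad,
   \sum_j fmx a0 ap r th i_rad j * v j = derive1 a0 r * v i_t
      + derive1 ap r * (s ^+ 2 * v i_phi + c ^+ 2 * v i_psi),
   \sum_j fmx a0 ap r th i_th j * v j = ap r * sc2 th * (v i_phi - v i_psi),
   \sum_j fmx a0 ap r th i_phi j * v j = - s ^+ 2 * derive1 ap r * v i_rad - ap r * sc2 th * v i_th &
   \sum_j fmx a0 ap r th i_psi j * v j = - c ^+ 2 * derive1 ap r * v i_rad + ap r * sc2 th * v i_th].
Proof.
split; rewrite sum5 /fmx /dt /dr /dth /dchi /sig /dphi /dpsi /=; ring.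
Qed.

End MetricAction.

Section NullEigen.
Variable R : realType.
Implicit Types (x : 'rV[R]_5) (i j : 'I_5) (v : 'cV[R]_5).
Variables (D : set R) (f m N w a0 ap : R -> R).
Hypotheses (sa0 : smooth_on D a0) (sap : smooth_on D ap)
  (pos : forall r, D r -> [/\ 0 < f r, 0 < m r & 0 < N r]).
Local Notation U := (chart_region D).
Local Notation g := (ansatz_metric f m N w).
Local Notation F := (ansatz_field a0 ap).
Local Notation disc := (discriminant f m N w a0 ap).
Local Notation rad x := (x 0 i_rad).
Local Notation tht x := (x 0 i_th).

(** The electric component in the orthogonal coframe: a0' dt + ap' sigma = (a0' + w ap') dt + ap'
    (sigma - w dt). *)
Definition efield r : R := derive1 a0 r + w r * derive1 ap r.

Lemma bb_gt0 r : D r -> 0 < bb m N r.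
Proof. by case/pos => _ m0 N0; exact: divr_gt0. Qed.

Lemma aa_gt0 r : D r -> 0 < aa f m r.
Proof. by case/pos => f0 m0 _; exact: divr_gt0. Qed.

Lemma grr_gt0 r : D r -> 0 < grr f m N r.
Proof. by case/pos => f0 m0 N0; rewrite divr_gt0// !mulr_gt0. Qed.

Lemma discE r : disc r = - f r * derive1 ap r ^+ 2 + bb m N r * efield r ^+ 2.
Proof. by []. Qed.

Lemma metric_action x v : U x -> let r := rad x in let th := tht x in
  let S := vS w r th (fun i => v i 0) in let C := v i_phi 0 - v i_psi 0 in
  let s := sin th in let c := cos th in
  [/\ lower g (fun=> v) x i_t = - f r * v i_t 0 - w r * bb m N r * S,
      lower g (fun=> v) x i_rad = grr f m N r * v i_rad 0,
      lower g (fun=> v) x i_th = aa f m r * v i_th 0,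
      lower g (fun=> v) x i_phi = s ^+ 2 * (bb m N r * S) + aa f m r * (s * c) ^+ 2 * C &
      lower g (fun=> v) x i_psi = c ^+ 2 * (bb m N r * S) - aa f m r * (s * c) ^+ 2 * C].
Proof.
move=> Ux r th S C s c.
have E d : lower g (fun=> v) x d = \sum_j gmx f m N w r th d j * v j 0.
  by apply: eq_bigr => j _; rewrite (metricE w pos _ _ Ux).
rewrite !E; exact: sum_gmx.
Qed.

Lemma field_action x v : U x -> let r := rad x in let th := tht x in
  let s := sin th in let c := cos th in
  [/\ (F x *m v) i_t 0 = - derive1 a0 r * v i_rad 0,
   (F x *m v) i_rad 0 = derive1 a0 r * v i_t 0
      + derive1 ap r * (s ^+ 2 * v i_phi 0 + c ^+ 2 * v i_psi 0),
   (F x *m v) i_th 0 = ap r * sc2 th * (v i_phi 0 - v i_psi 0),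
   (F x *m v) i_phi 0 = - s ^+ 2 * derive1 ap r * v i_rad 0 - ap r * sc2 th * v i_th 0 &
   (F x *m v) i_psi 0 = - c ^+ 2 * derive1 ap r * v i_rad 0 + ap r * sc2 th * v i_th 0].
Proof.
move=> Ux r th s c; have [Dr _] := Ux.
have E d : (F x *m v) d 0 = \sum_j fmx a0 ap r th d j * v j 0.
  rewrite mxE; apply: eq_bigr => j _; rewrite fieldE//.
    exact: (sa0 (j := 0%N) Dr).
  exact: (sap (j := 0%N) Dr).
rewrite !E; exact: (sum_fmx a0 ap r th (fun i => v i 0)).
Qed.

Lemma innerE x v v' : inner g x v v' = \sum_d v d 0 * lower g (fun=> v') x d.
Proof.
rewrite /inner -mulmxA mxE; apply: eq_bigr => d _.
by rewrite !mxE.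
Qed.

Lemma eigen_low x v lam : U x ->
  ginv g x *m F x *m v = lam *: v <-> forall d, (F x *m v) d 0 = lam * lower g (fun=> v) x d.
Proof.
move=> Ux; have gu := metric_unit w pos Ux.
have L d : lower g (fun=> v) x d = (g x *m v) d 0 by rewrite mxE.
split=> [e d|e].
  have : g x *m (ginv g x *m F x *m v) = g x *m (lam *: v) by rewrite e.
  rewrite !mulmxA mulmxV// mul1mx -scalemxAr => /matrixP/(_ d 0) ->.
  by rewrite mxE L.
rewrite -mulmxA; have -> : F x *m v = lam *: (g x *m v).
  by apply/matrixP => d z; rewrite ord1 e L [RHS]mxE.
by rewrite -scalemxAr mulKmx.
Qed.

Lemma efield_neq0 r : D r -> 0 < disc r -> efield r != 0.
Proof.
move=> Dr d0; apply/eqP => X0; move: d0; rewrite discE X0 expr0n mulr0 addr0.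
have [f0 _ _] := pos Dr.
by rewrite mulNr oppr_gt0 ltNge mulr_ge0// ?sqr_ge0// ltW.
Qed.

(* In the basis dual to (dt, dr, dth, sigma - w dt, dphi - dpsi): a null
   eigenvector is the radial direction plus a multiple of the vector dual to
   a0' dt + ap' sigma. *)
Lemma null_eigenvector_components x v : U x -> null_eigenvector g F x v ->
  exists2 mu : R, mu != 0 &
  [/\ v i_th 0 = 0, v i_phi 0 = v i_psi 0,
   lower g (fun=> v) x i_t = mu * derive1 a0 (rad x),
   bb m N (rad x) * vS w (rad x) (tht x) (fun i => v i 0) = mu * derive1 ap (rad x) &
   v i_rad 0 != 0].
Proof.
move=> Ux [v0 vn [lam l0 /(eigen_low _ _ Ux) e]]; have [Dr _] := Ux.
have [Ft Fr Fh Fp Fs] := field_action v Ux.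
have [Gt Gr Gh Gp Gs] := metric_action v Ux.
have et := e i_t; have er := e i_rad; have eh := e i_th; have ep := e i_phi.
have es := e i_psi.
rewrite {e} Ft Fr Fh Fp Fs in et er eh ep es.
have s0 := chart_sin_gt0 Ux; have c0 := chart_cos_gt0 Ux.
have A0 := aa_gt0 Dr; have B0 := bb_gt0 Dr; have G0 := grr_gt0 Dr.
have [f0 _ _] := pos Dr.
move: Gt Gr Gh Gp Gs et er eh ep es.
set S := vS _ _ _ _.
set r := rad x in Dr A0 B0 G0 f0 *; set th := tht x in s0 c0 *.
set T := v i_t 0; set rho := v i_rad 0; set h := v i_th 0.
set p := v i_phi 0; set q := v i_psi 0.
set A := aa f m r in A0 *; set B := bb m N r in B0 *; set G := grr f m N r in G0 *.
move=> Gt Gr Gh Gp Gs; rewrite Gt Gr Gh Gp Gs.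
have cs := cos2Dsin2 th; rewrite /sc2.
set s := sin th in s0 cs *; set c := cos th in c0 cs *.
set a0' := derive1 a0 r; set ap' := derive1 ap r; set al := ap r.
move=> et er eh ep es.
have sE : s ^+ 2 = 1 - c ^+ 2 by rewrite -cs addrAC subrr add0r.
(* The phi and psi rows are recombined: their weighted difference isolates the dchi direction here,
   their sum isolates sigma in [eX]. *)
have hC : al * (2 * s * c) * h = - lam * A * (s * c) ^+ 2 * (p - q).
  have -> : al * (2 * s * c) * h = s ^+ 2 * (- c ^+ 2 * ap' * rho + al * (2 * s * c) * h)
     - c ^+ 2 * (- s ^+ 2 * ap' * rho - al * (2 * s * c) * h).
    by rewrite sE; ring.
  by rewrite es ep sE; ring.
have eX : lam * (B * S) = - ap' * rho.
  have -> : lam * (B * S) = lam * (s ^+ 2 * (B * S) + A * (s * c) ^+ 2 * (p - q))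
     + lam * (c ^+ 2 * (B * S) - A * (s * c) ^+ 2 * (p - q)) by rewrite sE; ring.
  by rewrite -ep -es sE; ring.
(* On the (theta, dchi) plane the field acts as a rotation generator, whose eigenvalues are
   imaginary; a non-zero real [lam] leaves no component there. Algebraically, a sum of two squares
   with one positive multiplies p - q. *)
have pq : p = q.
  apply/eqP; rewrite -subr_eq0; set C := p - q in eh hC *.
  have : (s * c) ^+ 2 * C * ((lam * A) ^+ 2 + 4 * al ^+ 2) = 0.
    have -> : (s * c) ^+ 2 * C * ((lam * A) ^+ 2 + 4 * al ^+ 2) =
       - (lam * A) * (- lam * A * (s * c) ^+ 2 * C) + al * (2 * s * c) * (al * (2 * s * c) * C).
      by ring.
    by rewrite -hC eh; ring.
  have nz : (lam * A) ^+ 2 + 4 * al ^+ 2 != 0.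
    have h1 : 0 < (lam * A) ^+ 2 by rewrite exprn_even_gt0//= mulf_neq0// gt_eqF.
    by rewrite gt_eqF// ltr_wpDr// mulr_ge0// sqr_ge0.
  have sc0 : (s * c) ^+ 2 != 0 by rewrite expf_neq0// mulf_neq0// gt_eqF.
  by move/eqP; rewrite mulf_eq0 (negbTE nz) orbF mulf_eq0 (negbTE sc0).
have h0 : h = 0.
  have lA : lam * A != 0 by rewrite mulf_neq0// gt_eqF.
  by apply: (mulfI lA); rewrite -mulrA -eh pq subrr !mulr0.
have rho0 : rho != 0.
  apply: contra_neq v0 => r0.
  have S0 : S = 0.
    have lB : lam * B != 0 by rewrite mulf_neq0// gt_eqF.
    by apply: (mulfI lB); rewrite -mulrA eX r0 !mulr0.
  have T0 : T = 0.
    have lf : lam * - f r != 0 by rewrite mulf_neq0// oppr_eq0 gt_eqF.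
    apply: (mulfI lf); rewrite mulr0 -mulrA.
    have -> : - f r * T = - f r * T - w r * B * S by rewrite S0 mulr0 subr0.
    by rewrite -et r0 mulr0.
  have p0 : p = 0.
    move: S0; rewrite /S /vS -/p -/q -/T T0 mulr0 subr0 -pq -/s -/c => <-.
    by rewrite sE; ring.
  apply/matrixP => i z; rewrite ord1 mxE; elim/ind5: i => //.
  by rewrite -/q -pq.
(* The t row of the eigenvalue equation reads - a0' rho = lam v_t, which dictates [mu]. *)
exists (- rho / lam); first by rewrite mulf_neq0// ?oppr_eq0// invr_eq0.
split=> //.
  apply: (mulfI l0); rewrite -et; field.
  exact: l0.
apply: (mulfI l0); rewrite eX; field.
exact: l0.
Qed.

(** Raising mu (a0' dt + ap' sigma) gives the non-radial components. That covector has squared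
    length - mu^2 disc / (f B) with B = N/m, and g_RR = 1 / (4 f B), so nullness fixes the square of
    the radial component: this is the origin of the discriminant, and the sign left free separates
    the two eigendirections. *)
Lemma null_components_rad x v mu : U x -> inner g x v v = 0 ->
  v i_th 0 = 0 -> v i_phi 0 = v i_psi 0 ->
  lower g (fun=> v) x i_t = mu * derive1 a0 (rad x) ->
  bb m N (rad x) * vS w (rad x) (tht x) (fun i => v i 0) = mu * derive1 ap (rad x) ->
  [/\ v i_t 0 = - mu * efield (rad x) / f (rad x),
      v i_phi 0 = mu * (derive1 ap (rad x) / bb m N (rad x) - w (rad x) * efield (rad x) / f (rad x)) &
      v i_rad 0 ^+ 2 = mu ^+ 2 * (4 * disc (rad x))].
Proof.
move=> Ux vn h0 pq Lt LS; have [Dr _] := Ux.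
have [Gt Gr Gh Gp Gs] := metric_action v Ux.
move: vn; rewrite innerE sum5 Gr Gh Gp Gs h0 pq subrr Lt.
move: Gt LS; rewrite Lt discE.
have B0 := bb_gt0 Dr; have [f0 m0 N0] := pos Dr.
have sE := sin2cos2 (tht x).
rewrite /vS pq sE.
have -> T : (1 - cos (tht x) ^+ 2) * v i_psi 0 + cos (tht x) ^+ 2 * v i_psi 0 - T = v i_psi 0 - T by ring.
move: (cos (tht x)) => c.
have GE : grr f m N (rad x) = (4 * f (rad x) * bb m N (rad x))^-1.
  by rewrite /grr /bb; field; rewrite !gt_eqF.
rewrite GE /efield; move: (bb m N (rad x)) B0 => B B0.
move: (f (rad x)) f0 (w (rad x)) => f' f0 w'.
move: (v i_t 0) (v i_rad 0) (v i_psi 0) (derive1 a0 _) (derive1 ap _) => T rho p e b.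
move=> Gt LS vn.
have SE : p - w' * T = mu * b / B by apply: (mulfI (lt0r_neq0 B0)); rewrite LS; field; rewrite gt_eqF.
have TE : T = - mu * (e + w' * b) / f'.
  apply: (mulfI (lt0r_neq0 f0)); apply: oppr_inj.
  have -> : - (f' * T) = (- f' * T - w' * B * (p - w' * T)) + w' * (B * (p - w' * T)) by ring.
  by rewrite -Gt LS; field; rewrite gt_eqF.
have pE : p = mu * b / B + w' * T by rewrite -SE; ring.
split=> //.
  by rewrite pE TE; field; rewrite !gt_eqF.
have h : (4 * f' * B)^-1 * rho ^+ 2 = - (T * (mu * e) + p * (mu * b)).
  apply/eqP; rewrite -subr_eq0 opprK; apply/eqP; rewrite -vn LS; ring.
have -> : rho ^+ 2 = (4 * f' * B) * ((4 * f' * B)^-1 * rho ^+ 2) by field; rewrite !gt_eqF.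
by rewrite h pE TE; field; rewrite !gt_eqF.
Qed.

End NullEigen.

Lemma sum_dr_linear (R : realType) (v A B C : 'I_5 -> R) (q p e : R) :
  v i_rad * q + (p * (\sum_b v b * A b) - e * (\sum_b v b * B b + \sum_b v b * C b))
  = \sum_b v b * (dr R b * q + (p * A b - e * (B b + C b))).
Proof. by rewrite !sum5 /dr /=; ring. Qed.

(** Recovers the radial component of an identity between covectors from its contraction with a
    vector whose radial component is non-zero. *)
Lemma sum_off_rad (R : realType) (v A B : 'I_5 -> R) (c : R) :
  (forall d, d != i_rad -> A d = c * B d) ->
  v i_rad * (A i_rad - c * B i_rad) = \sum_d v d * A d - c * \sum_d v d * B d.
Proof.
move=> AB; rewrite mulr_sumr -sumrB (bigD1 i_rad)//= big1 ?addr0 => [|d dr0]; first by ring.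
by rewrite AB//; ring.
Qed.

(** * The acceleration of a field of null eigenvectors *)

Section Geodesic.
Variable R : realType.
Implicit Types (x y : 'rV[R]_5) (i j : 'I_5).
Variables (D : set R) (f m N w a0 ap : R -> R).
Hypotheses (oD : open D) (sf : smooth_on D f) (sm : smooth_on D m) (sN : smooth_on D N)
  (sw : smooth_on D w) (sa0 : smooth_on D a0) (sap : smooth_on D ap)
  (pos : forall r, D r -> [/\ 0 < f r, 0 < m r & 0 < N r])
  (disc_gt0 : forall r, D r -> 0 < discriminant f m N w a0 ap r).
Local Notation U := (chart_region D).
Local Notation g := (ansatz_metric f m N w).
Local Notation F := (ansatz_field a0 ap).
Local Notation rad x := (x 0 i_rad).
Local Notation tht x := (x 0 i_th).

Variable k : 'rV[R]_5 -> 'cV[R]_5.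
Hypotheses (sk : forall i, cdiff 1 U (fun y => k y i 0))
  (nk : forall y, U y -> null_eigenvector g F y (k y)).

Local Notation L := (lower g k).
Local Notation acc x a := (\sum_b k x b 0 * cov_deriv_vector g k b a x).
Local Notation W x d := (\sum_a g x d a * acc x a).
Local Notation V x d := (\sum_b k x b 0 * partial b (fun y => L y d) x).

Let oU : open U := chart_region_open oD.
Let gS y i j (Uy : U y) : g y i j = g y j i := ansatz_metric_sym w pos i j Uy.
Let gu y (Uy : U y) : g y \in unitmx := metric_unit w pos Uy.
Let gs i j : cdiff 1 U (fun y => g y i j) := cdiff_metric oD sf sm sN sw pos 1 i j.

Lemma lower_components y : U y -> exists2 mu : R, mu != 0 &
  [/\ k y i_th 0 = 0, k y i_phi 0 = k y i_psi 0, k y i_rad 0 != 0,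
      L y i_t = mu * derive1 a0 (rad y) &
   [/\ L y i_th = 0, L y i_phi = sin (tht y) ^+ 2 * (mu * derive1 ap (rad y)) &
      L y i_psi = cos (tht y) ^+ 2 * (mu * derive1 ap (rad y))]].
Proof.
move=> Uy.
have [mu mu0 [h0 pq Lt LS r0]] := null_eigenvector_components sa0 sap pos Uy (nk Uy).
have [_ _ Gh Gp Gs] := metric_action w pos (k y) Uy.
exists mu => //; split=> //.
move: Gh Gp Gs; rewrite h0 pq subrr LS !mulr0 addr0 subr0.
by split.
Qed.

Lemma lower_null y : U y -> \sum_d k y d 0 * L y d = 0.
Proof.
move=> Uy; transitivity (inner g y (k y) (k y)); last by have [] := nk Uy.
by rewrite innerE.
Qed.

(** For t, phi and psi the metric is invariant. For theta, every term of [gmx_dth] has a factor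
    dchi, and dchi vanishes on [k] because its phi and psi components agree. *)
Lemma sum_partial_metric_killing x d : U x -> d != i_rad ->
  \sum_b \sum_c partial d (fun y => g y b c) x * k x b 0 * k x c 0 = 0.
Proof.
move=> Ux dr0; have [mu mu0 [h0 pq _ _ _]] := lower_components Ux.
under eq_bigr do under eq_bigr do rewrite (partial_metric oD sf sm sN sw pos)//.
have -> : dr R d = 0 by rewrite /dr (negbTE dr0).
rewrite !sum5 h0 pq /gmx_dth /dchi /sig /dt /dphi /dpsi /=; ring.
Qed.

Lemma accel_lowE x d : U x -> d != i_rad -> W x d = V x d.
Proof.
move=> Ux d0; rewrite (accel_low gu gs sk)// sum_partial_metric_killing//.
by rewrite mulr0 subr0.
Qed.

Lemma sum_accel_low x : U x -> \sum_d k x d 0 * W x d = 0.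
Proof.
move=> Ux.
transitivity (\sum_b k x b 0 * (\sum_a L x a * cov_deriv_vector g k b a x)).
  transitivity (\sum_a L x a * acc x a).
    under eq_bigr do rewrite mulr_sumr.
    rewrite exchange_big; apply: eq_bigr => a _; rewrite /lower mulr_suml.
    by apply: eq_bigr => d _; rewrite (gS d a Ux); ring.
  under eq_bigr do rewrite mulr_sumr.
  rewrite exchange_big; apply: eq_bigr => b _; rewrite mulr_sumr.
  by apply: eq_bigr => a _; ring.
by apply: big1 => b _; rewrite (null_cov oU gS gu gs sk b Ux lower_null) mulr0.
Qed.

Let dL x d (Ux : U x) : differentiable (fun y => L y d) x := differentiable_lower gs sk d Ux.

(** The identity L_phi = sin^2 (L_phi + L_psi) holds on the whole region; differentiated along [k],
    the factor sin^2 behaves as a constant because [k] has no theta component. *)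
Lemma partial_lower_phi x b : U x -> k x i_th 0 = 0 ->
  k x b 0 * partial b (fun y => L y i_phi) x
  = k x b 0 * (sin (tht x) ^+ 2 * (partial b (fun y => L y i_phi) x + partial b (fun y => L y i_psi) x)).
Proof.
move=> Ux h0.
have e : partial b (fun y => L y i_phi) x
       = partial b (fun y => sin (tht y) ^+ 2 * (L y i_phi + L y i_psi)) x.
  apply: (partial_eq_on _ oU Ux) => y Uy.
  have [mu _ [_ _ _ _ [_ -> ->]]] := lower_components Uy.
  by rewrite sin2cos2; ring.
have ds : is_derive (tht x) 1 (fun t : R => sin t ^+ 2) (2 * sin (tht x) * cos (tht x)).
  by apply: is_derive_eq; rewrite /GRing.scale/=; ring.
have ds' := @ex_derive _ _ _ _ _ _ _ ds.
rewrite {1}e partialM; first last.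
- exact: differentiableD_fun (dL _ Ux) (dL _ Ux).
- exact: (differentiable_coord_comp ds').
rewrite (partialD _ (dL _ Ux) (dL _ Ux)) (partial_coord_comp _ ds') mulrDr.
have [-> |bh] := eqVneq b i_th; first by rewrite h0 !mul0r addr0.
by rewrite !mul0r mulr0 add0r.
Qed.

(** The combination ap' L_t - a0' (L_phi + L_psi) vanishes identically whatever [mu] is. Its
    derivative along [k] ties the lowered acceleration to the Wronskian of a0' and ap', with the
    non-zero factor mu k^R. *)
Lemma geodesic_point x : U x ->
  (exists kappa : R, forall a, acc x a = kappa * k x a 0) <-> geodesic_condition a0 ap (rad x).
Proof.
move=> Ux; have [Dr _] := Ux.
have [mu mu0 [h0 pq r0 Lt [Lh Lp Ls]]] := lower_components Ux.
have d0 : derivable a0 (rad x) 1 := sa0 (j := 0%N) Dr.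
have dp : derivable ap (rad x) 1 := sap (j := 0%N) Dr.
have d0' : derivable (derive1 a0) (rad x) 1 := smooth_on_derive1 sa0 (j := 0%N) Dr.
have dp' : derivable (derive1 ap) (rad x) 1 := smooth_on_derive1 sap (j := 0%N) Dr.
have sE := sin2cos2 (tht x).
pose e := derive1 a0 (rad x); pose p := derive1 ap (rad x).
pose e' := derive1 (derive1 a0) (rad x); pose p' := derive1 (derive1 ap) (rad x).
(* The derivative along [k] of the vanishing combination; [Y] is the same statement for a single
   coordinate direction. *)
have key : k x i_rad 0 * (p' * (mu * e) - e' * (mu * p)) + (p * V x i_t - e * (V x i_phi + V x i_psi)) = 0.
  have q1 : differentiable (fun y : 'rV[R]_5 => derive1 ap (rad y)) x := differentiable_coord_comp dp'.
  have q2 : differentiable (fun y : 'rV[R]_5 => derive1 a0 (rad y)) x := differentiable_coord_comp d0'.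
  have q3 := differentiableD_fun (dL i_phi Ux) (dL i_psi Ux).
  have Y b : dr R b * (p' * (mu * e) - e' * (mu * p))
     + (p * partial b (fun y => L y i_t) x
       - e * (partial b (fun y => L y i_phi) x + partial b (fun y => L y i_psi) x)) = 0.
    transitivity (partial b (fun y => derive1 ap (rad y) * L y i_t
        - derive1 a0 (rad y) * (L y i_phi + L y i_psi)) x); last first.
      rewrite -[RHS](@partial_cst R b 0 x); apply: (partial_eq_on _ oU Ux) => y Uy.
      have [mu' _ [_ _ _ -> [_ -> ->]]] := lower_components Uy.
      by rewrite sin2cos2; ring.
    rewrite (partialB _ (differentiableM_fun q1 (dL _ Ux)) (differentiableM_fun q2 q3)).
    rewrite (partialM _ q1 (dL _ Ux)) (partialM _ q2 q3) (partialD _ (dL _ Ux) (dL _ Ux)).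
    rewrite (partial_coord_comp b dp') (partial_coord_comp b d0') Lt Lp Ls sE /dr.
    by rewrite -/e -/p -/e' -/p'; ring.
  transitivity (\sum_b k x b 0 * (dr R b * (p' * (mu * e) - e' * (mu * p))
     + (p * partial b (fun y => L y i_t) x
       - e * (partial b (fun y => L y i_phi) x + partial b (fun y => L y i_psi) x)))).
    by rewrite sum_dr_linear.
  by apply: big1 => b _; rewrite Y mulr0.
have gc : geodesic_condition a0 ap (rad x) <-> p * e' - e * p' = 0 by [].
split=> [[kap eq]|/gc cond].
  have WE d : W x d = kap * L x d.
    rewrite /lower mulr_sumr; apply: eq_bigr => a _.
    by rewrite eq mulrCA.
  move: key; rewrite -!accel_lowE// !WE Lt Lp Ls sE => key.
  apply/gc; apply: (mulfI mu0); apply: (mulfI r0); rewrite !mulr0.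
  apply: oppr_inj; rewrite oppr0 -[RHS]key -/e -/p; ring.
(* The pair (a0', ap') is non-zero where the discriminant is positive; this allows the
   proportionality factor to be recovered by projection. *)
have D0 : e ^+ 2 + p ^+ 2 != 0.
  have := efield_neq0 pos Dr (disc_gt0 Dr); rewrite /efield -/e -/p.
  apply: contra_neq => /eqP; rewrite paddr_eq0 ?sqr_ge0// !sqrf_eq0 => /andP[/eqP -> /eqP ->].
  by rewrite mulr0 addr0.
have {}key : p * V x i_t = e * (V x i_phi + V x i_psi).
  apply/eqP; rewrite -subr_eq0; apply/eqP; rewrite -[RHS]key.
  have -> : p' * (mu * e) - e' * (mu * p) = - mu * (p * e' - e * p') by ring.
  by rewrite cond !mulr0 add0r.
pose Vx := V x i_phi + V x i_psi.
(* The orthogonal projection of (V_t, Vx) on mu (e, p); [key] says that the two pairs are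
   parallel. *)
pose kap := (V x i_t * e + Vx * p) / (mu * (e ^+ 2 + p ^+ 2)).
have VpE : V x i_phi = sin (tht x) ^+ 2 * Vx.
  rewrite /Vx mulrDr !mulr_sumr -big_split; apply: eq_bigr => b _.
  by rewrite [LHS]partial_lower_phi//=; ring.
have VsE : V x i_psi = cos (tht x) ^+ 2 * Vx.
  have -> : V x i_psi = Vx - V x i_phi by rewrite /Vx addrAC subrr add0r.
  by rewrite VpE sE; ring.
have kt : V x i_t = kap * (mu * e).
  apply: (mulfI D0).
  have -> : (e ^+ 2 + p ^+ 2) * (kap * (mu * e)) = e * (V x i_t * e + Vx * p).
    by rewrite /kap; field; rewrite D0 mu0.
  have -> : (e ^+ 2 + p ^+ 2) * V x i_t = e ^+ 2 * V x i_t + p * (p * V x i_t) by ring.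
  by rewrite key -/Vx; ring.
have kx : Vx = kap * (mu * p).
  apply: (mulfI D0).
  have -> : (e ^+ 2 + p ^+ 2) * (kap * (mu * p)) = V x i_t * e * p + Vx * p ^+ 2.
    by rewrite /kap; field; rewrite D0 mu0.
  have -> : V x i_t * e * p = e * (p * V x i_t) by ring.
  by rewrite key -/Vx; ring.
have Vh : V x i_th = 0.
  apply: big1 => b _; rewrite (partial_eq_on _ oU Ux (h2 := fun=> 0)) ?partial_cst ?mulr0// => y Uy.
  by have [? _ [_ _ _ _ [-> _ _]]] := lower_components Uy.
have WE d : d != i_rad -> W x d = kap * L x d.
  move=> dr0; rewrite accel_lowE//; elim/ind5: d dr0 => // _.
  - by rewrite kt Lt.
  - by rewrite Vh Lh mulr0.
  - by rewrite VpE Lp kx -/p; ring.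
  - by rewrite VsE Ls kx -/p; ring.
(* The radial row follows from the others: both the acceleration and [k] are orthogonal to [k], and
   k^R is non-zero. *)
have WrE : W x i_rad = kap * L x i_rad.
  apply: (mulfI r0); have h1 := sum_accel_low Ux; have h2 := lower_null Ux.
  have : k x i_rad 0 * (W x i_rad - kap * L x i_rad)
      = \sum_d k x d 0 * W x d - kap * \sum_d k x d 0 * L x d.
    exact: (sum_off_rad (fun d => k x d 0) (A := fun d => W x d) (B := L x) WE).
  rewrite h1 h2 mulr0 subr0 mulrBr => /eqP.
  by rewrite subr_eq0 => /eqP.
exists kap => a.
rewrite -(sum_ginv_metric gu a (fun a => acc x a) Ux) -(sum_ginv_metric gu a (fun a => k x a 0) Ux) mulr_sumr.
apply: eq_bigr => d _.
have -> : W x d = kap * L x d by have [->//|] := eqVneq d i_rad; exact: WE.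
by rewrite mulrCA.
Qed.

End Geodesic.

(** * The two null eigendirections, and the geodesic criterion for smooth fields *)

Section PrincipalNull.
Variable R : realType.
Implicit Types (x y : 'rV[R]_5) (i : 'I_5) (v : 'cV[R]_5).
Variables (D : set R) (f m N w a0 ap : R -> R).
Hypotheses (oD : open D) (sf : smooth_on D f) (sm : smooth_on D m) (sN : smooth_on D N)
  (sw : smooth_on D w) (sa0 : smooth_on D a0) (sap : smooth_on D ap)
  (pos : forall r, D r -> [/\ 0 < f r, 0 < m r & 0 < N r])
  (disc_gt0 : forall r, D r -> 0 < discriminant f m N w a0 ap r).
Local Notation U := (chart_region D).
Local Notation g := (ansatz_metric f m N w).
Local Notation F := (ansatz_field a0 ap).
Local Notation disc := (discriminant f m N w a0 ap).
Local Notation X := (efield w a0 ap).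
Local Notation rad x := (x 0 i_rad).
Local Notation tht x := (x 0 i_th).

Let oU : open U := chart_region_open oD.

(** These are the components found in [null_components_rad] for mu = 1; the sign [s] in [pnull]
    selects the root for the radial part. *)
Definition pnull_t r : R := - X r / f r.
Definition pnull_phi r : R := derive1 ap r / bb m N r - w r * X r / f r.
Definition pnull_rad r : R := 2 * Num.sqrt (disc r).
Definition pnull (s : R) y : 'cV[R]_5 :=
  \col_i (pnull_t (rad y) * dt R i + s * pnull_rad (rad y) * dr R i + pnull_phi (rad y) * xi R i).

Lemma pnullE s y : [/\ pnull s y i_t 0 = pnull_t (rad y),
  pnull s y i_rad 0 = s * pnull_rad (rad y), pnull s y i_th 0 = 0,
  pnull s y i_phi 0 = pnull_phi (rad y) & pnull s y i_psi 0 = pnull_phi (rad y)].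
Proof.
by split; rewrite mxE /dt /dr /xi /dphi /dpsi /= ?(mulr0, mulr1, addr0, add0r).
Qed.

Lemma pnull_rad_gt0 r : D r -> 0 < pnull_rad r.
Proof. by move=> Dr; rewrite mulr_gt0// sqrtr_gt0 disc_gt0. Qed.

Lemma sqr_pnull_rad r : D r -> pnull_rad r ^+ 2 = 4 * disc r.
Proof. by move=> Dr; rewrite exprMn sqr_sqrtr ?ltW ?disc_gt0// -natrX. Qed.

Lemma pnull_null_eigenvector s y : s ^+ 2 = 1 -> U y -> null_eigenvector g F y (pnull s y).
Proof.
move=> s1 Uy; have [Dr _] := Uy; have [f0 m0 N0] := pos Dr.
have [Et Er Eh Ep Es] := pnullE s y.
have L0 := pnull_rad_gt0 Dr; have L2 := sqr_pnull_rad Dr.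
have B0 := bb_gt0 pos Dr.
have s0 : s != 0 by apply: contra_eq_neq s1 => ->; rewrite expr0n eq_sym oner_eq0.
have [Gt Gr Gh Gp Gs] := metric_action w pos (pnull s y) Uy.
have [Ft Fr Fh Fp Fs] := field_action sa0 sap (pnull s y) Uy.
have sE := sin2cos2 (tht y).
rewrite Et Er Eh Ep Es subrr ?mulr0 ?addr0 ?subr0 in Gt Gr Gh Gp Gs Ft Fr Fh Fp Fs.
have SE : vS w (rad y) (tht y) (fun i => pnull s y i 0) = derive1 ap (rad y) / bb m N (rad y).
  rewrite /vS Et Ep Es sE /pnull_phi /pnull_t; field.
  by rewrite !gt_eqF.
rewrite SE in Gt Gp Gs.
have GE : grr f m N (rad y) = (4 * f (rad y) * bb m N (rad y))^-1.
  by rewrite /grr /bb; field; rewrite !gt_eqF.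
split.
- apply/eqP => /matrixP/(_ i_rad 0); rewrite Er mxE => /eqP.
  by rewrite mulf_eq0 (negbTE s0) gt_eqF.
- rewrite innerE sum5 Gt Gr Gh Gp Gs Et Er Eh Ep Es GE sE.
  have -> Z : s * pnull_rad (rad y) * (Z * (s * pnull_rad (rad y)))
    = Z * (s ^+ 2 * pnull_rad (rad y) ^+ 2) by ring.
  rewrite s1 L2 discE /pnull_t /pnull_phi /efield; field.
  by rewrite !gt_eqF.
(* With mu = 1 the t row forces the eigenvalue to be minus the radial component. *)
- exists (- (s * pnull_rad (rad y))).
    by rewrite oppr_eq0 mulf_neq0// gt_eqF.
  apply/(eigen_low w a0 ap pos _ _ Uy); elim/ind5.
  + by rewrite Ft Gt /pnull_t /efield; field; rewrite !gt_eqF.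
  + rewrite Fr Gr GE.
    have -> Z : - (s * pnull_rad (rad y)) * (Z * (s * pnull_rad (rad y)))
      = - Z * (s ^+ 2 * pnull_rad (rad y) ^+ 2) by ring.
    rewrite s1 L2 discE /pnull_t /pnull_phi /efield sE; field.
    by rewrite !gt_eqF.
  + by rewrite Fh Gh !mulr0.
  + by rewrite Fp Gp; field; rewrite !gt_eqF.
  + by rewrite Fs Gs; field; rewrite !gt_eqF.
Qed.

Lemma null_eigenvector_pnull y v : U y -> null_eigenvector g F y v ->
  exists s : R, v = s *: pnull 1 y \/ v = s *: pnull (-1) y.
Proof.
move=> Uy nv; have [Dr _] := Uy.
have [mu mu0 [h0 pq Lt LS r0]] := null_eigenvector_components sa0 sap pos Uy nv.
have [_ vn _] := nv.
have [vt vp vr] := null_components_rad pos Uy vn h0 pq Lt LS.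
have vps : v i_psi 0 = mu * pnull_phi (rad y) by rewrite -pq vp.
have vtt : v i_t 0 = mu * pnull_t (rad y) by rewrite vt /pnull_t; ring.
rewrite -sqr_pnull_rad// -exprMn in vr.
have [Et Er Eh Ep Es] := pnullE 1 y; have [Et' Er' Eh' Ep' Es'] := pnullE (-1) y.
exists mu; move/eqP: vr; rewrite eqf_sqr => /orP[/eqP vr|/eqP vr]; [left|right];
  apply/matrixP => i z; rewrite ord1 mxE; elim/ind5: i;
  rewrite ?(Et, Er, Eh, Ep, Es) ?(Et', Er', Eh', Ep', Es') ?h0 ?mulr0//.
- by rewrite vr mul1r.
- by rewrite vr; ring.
Qed.

Let sX : smooth_on D X := smoothD oD (smooth_on_derive1 sa0) (smoothM oD sw (smooth_on_derive1 sap)).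

Lemma smooth_disc : smooth_on D disc.
Proof.
exact: (smoothD oD (smoothM oD (smoothN oD sf) (smoothX (k := 2%N) oD (smooth_on_derive1 sap)))
  (smoothM oD (smooth_bb oD sm sN pos) (smoothX (k := 2%N) oD sX))).
Qed.

Lemma pnull_smooth s : smooth_vector U (pnull s).
Proof.
move=> i; apply/smooth_scalarP => n.
have st : smooth_on D pnull_t := smoothM oD (smoothN oD sX) (smoothV oD (f_neq0 pos) sf).
have sp : smooth_on D pnull_phi.
  have b0 r : D r -> bb m N r != 0 by move=> Dr; rewrite gt_eqF// (bb_gt0 pos).
  exact: (smoothD oD (smoothM oD (smooth_on_derive1 sap) (smoothV oD b0 (smooth_bb oD sm sN pos)))
    (smoothN oD (smoothM oD (smoothM oD sw sX) (smoothV oD (f_neq0 pos) sf)))).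
have cr : cdiff n U (fun y => pnull_rad (rad y)).
  apply: (cdiffM oU (cdiff_cst n U 2)); apply: (cdiff_sqrt oU).
    by move=> y [Dr _]; exact: disc_gt0.
  exact: (cdiff_radial n oD smooth_disc).
apply: (@cdiff_ext _ _ _ (fun y => pnull_t (rad y) * dt R i + s * pnull_rad (rad y) * dr R i + pnull_phi (rad y) * xi R i)).
- exact: oU.
- by move=> y _; rewrite mxE.
have cc c := @cdiff_cst R n U c.
exact: (cdiffD oU (cdiffD oU (cdiffM oU (cdiff_radial n oD st) (cc _))
  (cdiffM oU (cdiffM oU (cc _) cr) (cc _))) (cdiffM oU (cdiff_radial n oD sp) (cc _))).
Qed.

Lemma pnull_eigendirections : null_eigendirections U g F (pnull 1) (pnull (-1)).
Proof.
split; [exact: pnull_smooth|exact: pnull_smooth|move=> x Ux; have [Dr _] := Ux].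
have [Et Er _ _ _] := pnullE 1 x; have [Et' Er' _ _ _] := pnullE (-1) x.
split.
- by apply: pnull_null_eigenvector => //; rewrite expr1n.
- by apply: pnull_null_eigenvector => //; rewrite sqrrN expr1n.
(* The two vectors share a non-zero t component, so the factor would be 1, but their radial
   components are opposite. *)
- move=> s e; have [f0 _ _] := pos Dr.
  have t0 : pnull_t (rad x) != 0.
    by rewrite /pnull_t mulf_neq0 ?oppr_eq0 ?invr_eq0 ?(efield_neq0 pos) ?disc_gt0// gt_eqF.
  have s1 : s = 1.
    apply: (mulIf t0); rewrite mul1r -[RHS]Et e mxE.
    by rewrite Et'.
  have := congr1 (fun u : 'cV[R]_5 => u i_rad 0) e; rewrite /= Er mxE Er' s1 !mul1r => h.
  have := pnull_rad_gt0 Dr; lra.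
- by move=> v nv; exact: null_eigenvector_pnull nv.
Qed.

(** Lifts a radial value to a point of the chart, so that tensor identities yield statements about
    functions of [r]. *)
Lemma chart_region_halfway r : D r -> exists2 x : 'rV[R]_5, U x & rad x = r.
Proof.
move=> Dr; exists (\row_i (r * dr R i + pi / 4 * dth R i)); last first.
  by rewrite mxE /dr /dth /=; ring.
have p0 := pi_gt0 R.
split; rewrite !mxE /dr /dth /= ?mulr0 ?mulr1 ?addr0 ?add0r//.
by apply/andP; split; lra.
Qed.

(** The field is only required to be an eigenvector at each point, without saying which of the two;
    this is the form in which the vector of a Kerr-Schild metric is obtained. *)
Lemma geodesic_iff (k : 'rV[R]_5 -> 'cV[R]_5) : smooth_vector U k ->
  (forall y, U y -> null_eigenvector g F y (k y)) ->
  (geodesic U g k <-> forall r, D r -> geodesic_condition a0 ap r).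
Proof.
move=> sk nk.
have sk1 i : cdiff 1 U (fun y => k y i 0) by have /smooth_scalarP := sk i; exact.
have GP x (Ux : U x) := geodesic_point oD sf sm sN sw sa0 sap pos disc_gt0 sk1 nk Ux.
split=> [gk r Dr|c x Ux].
  have [x Ux <-] := chart_region_halfway Dr.
  by apply/(GP x Ux); exact: gk.
by apply/(GP x Ux); have [Dr _] := Ux; exact: c.
Qed.

Theorem null_eigendirections_geodesic :
  (exists l n, null_eigendirections U g F l n) /\
  (forall l n, null_eigendirections U g F l n ->
    (geodesic U g l <-> forall r, D r -> geodesic_condition a0 ap r) /\
    (geodesic U g n <-> forall r, D r -> geodesic_condition a0 ap r)).
Proof.
split; first by exists (pnull 1), (pnull (-1)); exact: pnull_eigendirections.
move=> l n [sl sn h]; split; apply: geodesic_iff => // y Uy.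
  by have [] := h y Uy.
by have [] := h y Uy.
Qed.

End PrincipalNull.

(** * Kerr-Schild metrics *)

Section RaychaudhuriAlgebra.
Variable R : realType.
Variable I : finType.
Variables (k : I -> R) (P : I -> I -> R) (G : I -> I -> I -> R)
  (dG : I -> I -> I -> I -> R) (PP : I -> I -> I -> R).
Hypothesis Gsym : forall a b c, G a b c = G a c b.
Local Notation B a b := (P a b + \sum_c G a b c * k c).

(** The contracted Ricci identity Ric(k,k) = div(acc) - (nabla_a k^b)(nabla_b k^a) - k(div k) as a
    polynomial identity. Here P a b stands for d_b k^a, dG e a b c for d_e Gamma^a_{bc}, and PP d a
    b for d_d d_b k^a. The final bracket compensates for not assuming that second derivatives
    commute. *)
Lemma raychaudhuri_algebra :
  \sum_b \sum_d (\sum_a (dG a a d b - dG d a a b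
      + \sum_e (G a a e * G e d b - G a d e * G e a b))) * k b * k d
  = \sum_a (\sum_b (P b a * B a b + k b * (PP a a b + \sum_c (dG a a b c * k c + G a b c * P c a))))
    + \sum_a \sum_e G a a e * (\sum_b k b * B e b)
    - \sum_a \sum_b B a b * B b a
    - \sum_d k d * (\sum_a (PP d a a + \sum_c (dG d a a c * k c + G a a c * P c d)))
    + (\sum_d \sum_a k d * PP d a a - \sum_a \sum_d k d * PP a a d).
Proof.
(* Both sides are expanded in the nine sums named here: derivatives of Christoffel symbols (T1, S2),
   second derivatives of k (T2, S1), mixed products (T3, S3) and quadratic terms (Q0, Q1, Q2). *)
pose T1 := \sum_a \sum_b \sum_c k b * dG a a b c * k c.
pose T2 := \sum_a \sum_b k b * PP a a b.
pose T3 := \sum_a \sum_b \sum_c P b a * (G a b c * k c).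
pose Q0 := \sum_a \sum_b P b a * P a b.
pose Q1 := \sum_a \sum_e \sum_b \sum_c G a a e * G e b c * k b * k c.
pose Q2 := \sum_a \sum_b \sum_c \sum_d G a b c * k c * (G b a d * k d).
pose S1 := \sum_d \sum_a k d * PP d a a.
pose S2 := \sum_d \sum_a \sum_c k d * dG d a a c * k c.
pose S3 := \sum_d \sum_a \sum_c k d * G a a c * P c d.
have -> : \sum_a (\sum_b (P b a * B a b + k b * (PP a a b + \sum_c (dG a a b c * k c + G a b c * P c a))))
   = (Q0 + T3) + (T2 + (T1 + T3)).
  transitivity (\sum_a \sum_b (P b a * P a b + \sum_c P b a * (G a b c * k c)
     + (k b * PP a a b + (\sum_c k b * dG a a b c * k c + \sum_c k b * G a b c * P c a)))).
    apply: eq_bigr => a _; apply: eq_bigr => b _.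
    rewrite !mulrDr -mulr_sumr; congr (_ + (_ + _)).
    by rewrite -big_split mulr_sumr; apply: eq_bigr => c _ /=; ring.
  have -> : T1 + T3 = T1 + \sum_a \sum_b \sum_c k b * G a b c * P c a.
    congr (_ + _); apply: eq_bigr => a _; rewrite exchange_big.
    by apply: eq_bigr => b _; apply: eq_bigr => c _; rewrite (Gsym a c b); ring.
  rewrite /Q0 /T3 /T2 /T1 -!big_split; apply: eq_bigr => a _.
  by rewrite /= -!big_split; apply: eq_bigr => b _.
have -> : \sum_a \sum_e G a a e * (\sum_b k b * B e b) = S3 + Q1.
  transitivity (\sum_a \sum_e (\sum_b k b * G a a e * P e b
      + \sum_b \sum_c G a a e * G e b c * k b * k c)).
    apply: eq_bigr => a _; apply: eq_bigr => e _.
    rewrite mulr_sumr -big_split; apply: eq_bigr => b _.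
    rewrite /= mulrDr mulrDr; congr (_ + _); first by ring.
    by rewrite mulrA mulr_sumr; apply: eq_bigr => c _; ring.
  under eq_bigr do rewrite big_split.
  rewrite big_split /=; congr (_ + _).
  rewrite /S3 [RHS]exchange_big; apply: eq_bigr => a _ /=.
  by rewrite [RHS]exchange_big.
have -> : \sum_a \sum_b B a b * B b a = Q0 + 2 * T3 + Q2.
  transitivity (\sum_a \sum_b (P b a * P a b + \sum_c P a b * (G b a c * k c)
     + (\sum_c P b a * (G a b c * k c) + \sum_c \sum_d G a b c * k c * (G b a d * k d)))).
    apply: eq_bigr => a _; apply: eq_bigr => b _.
    rewrite mulrDl mulrDr [P a b * P b a]mulrC mulr_sumr; congr (_ + _).
    rewrite mulrDr; congr (_ + _); rewrite mulr_suml; apply: eq_bigr => c _.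
      by rewrite mulrC.
    by rewrite mulr_sumr.
  have -> : Q0 + 2 * T3 + Q2 = Q0 + \sum_a \sum_b \sum_c P a b * (G b a c * k c) + (T3 + Q2).
    by rewrite (exchange_big _ _ _ _ _ (fun a b => \sum_c P a b * (G b a c * k c))) -/T3; ring.
  rewrite /Q0 /T3 /Q2 -!big_split; apply: eq_bigr => a _.
  by rewrite /= -!big_split; apply: eq_bigr => b _.
have -> : \sum_d k d * (\sum_a (PP d a a + \sum_c (dG d a a c * k c + G a a c * P c d)))
   = S1 + (S2 + S3).
  rewrite /S1 /S2 /S3 -!big_split; apply: eq_bigr => d _.
  rewrite /= -!big_split mulr_sumr; apply: eq_bigr => a _.
  rewrite /= -big_split mulrDr; congr (_ + _); rewrite mulr_sumr.
  by apply: eq_bigr => c _ /=; ring.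
have -> : \sum_b \sum_d (\sum_a (dG a a d b - dG d a a b
      + \sum_e (G a a e * G e d b - G a d e * G e a b))) * k b * k d
  = T1 - S2 + (Q1 - Q2).
  transitivity (\sum_b \sum_d \sum_a (k d * dG a a d b * k b - k d * dG d a a b * k b
    + (\sum_e (G a a e * G e d b * k d * k b) - \sum_e G a e d * k d * (G e a b * k b)))).
    apply: eq_bigr => b _; apply: eq_bigr => d _; rewrite !mulr_suml; apply: eq_bigr => a _.
    rewrite mulrDl mulrDl; congr (_ + _); first by ring.
    rewrite -sumrB !mulr_suml; apply: eq_bigr => e _.
    by rewrite (Gsym a d e); ring.
  rewrite (eq_bigr (fun b => (\sum_d \sum_a k d * dG a a d b * k b - \sum_d \sum_a k d * dG d a a b * k b)
    + (\sum_d \sum_a \sum_e (G a a e * G e d b * k d * k b)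
       - \sum_d \sum_a \sum_e G a e d * k d * (G e a b * k b)))); last first.
    move=> b _; rewrite -!sumrB -big_split; apply: eq_bigr => d _.
    by rewrite /= -!sumrB -big_split.
  rewrite big_split !sumrB /=; congr (_ - _ + (_ - _)).
  - rewrite exchange_big /=.
    under eq_bigr do rewrite exchange_big.
    by rewrite exchange_big /=.
  - by rewrite exchange_big; apply: eq_bigr => d _; rewrite exchange_big.
  - rewrite /Q1 exchange_big /=.
    transitivity (\sum_d \sum_a \sum_b \sum_e G a a e * G e d b * k d * k b).
      by apply: eq_bigr => d _; rewrite exchange_big.
    rewrite exchange_big; apply: eq_bigr => a _ /=.
    transitivity (\sum_d \sum_e \sum_b G a a e * G e d b * k d * k b).
      by apply: eq_bigr => d _; rewrite exchange_big.
    by rewrite exchange_big.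
  - rewrite /Q2 exchange_big /=.
    transitivity (\sum_d \sum_a \sum_b \sum_e G a e d * k d * (G e a b * k b)).
      by apply: eq_bigr => d _; rewrite exchange_big.
    rewrite exchange_big; apply: eq_bigr => a _ /=.
    transitivity (\sum_d \sum_e \sum_b G a e d * k d * (G e a b * k b)).
      by apply: eq_bigr => d _; rewrite exchange_big.
    by rewrite exchange_big.
rewrite -/T2 -/S1; ring.
Qed.

End RaychaudhuriAlgebra.

Section Raychaudhuri.
Variable R : realType.
Implicit Types (a b c d e i j : 'I_5).
Variables (U : set 'rV[R]_5) (g : 'rV[R]_5 -> 'M[R]_5).
Hypotheses (oU : open U) (gsym : forall y i j, U y -> g y i j = g y j i)
  (gunit : forall y, U y -> g y \in unitmx) (g_smooth : forall i j, cdiff 1 U (fun y => g y i j)).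
Variable k : 'rV[R]_5 -> 'cV[R]_5.
Hypothesis k_smooth : forall i, cdiff 1 U (fun y => k y i 0).

Local Notation P a b x := (partial b (fun y => k y a 0) x).
Local Notation B a b := (cov_deriv_vector g k b a).

Let dk x i (Ux : U x) : differentiable (fun y => k y i 0) x.
Proof. exact: (cdiff_differentiable (k_smooth i) Ux). Qed.

Let dP x a b (Ux : U x) : differentiable (partial b (fun y => k y a 0)) x.
Proof. exact: (cdiff_differentiable (cdiff_partial b (k_smooth a)) Ux). Qed.

Let dGm x a b c (Ux : U x) : differentiable (christoffel g a b c) x :=
  christoffel_differentiable oU gunit g_smooth a b c Ux.

Lemma cov_differentiable x a b : U x -> differentiable (B a b) x.
Proof.
move=> Ux; apply: (differentiableD_fun (dP _ _ Ux)); apply: differentiable_sum_fun => c.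
exact: (differentiableM_fun (dGm _ _ _ Ux) (dk _ Ux)).
Qed.

Lemma partial_cov x a b d : U x -> partial d (B a b) x
  = partial d (partial b (fun y => k y a 0)) x
    + \sum_c (partial d (christoffel g a b c) x * k x c 0 + christoffel g a b c x * P c d x).
Proof.
move=> Ux; rewrite /cov_deriv_vector.
have dGk c := differentiableM_fun (dGm a b c Ux) (dk c Ux).
rewrite (partialD _ (dP _ _ Ux) (differentiable_sum_fun _ _ dGk)); congr (_ + _).
by rewrite partial_sum//; apply: eq_bigr => c _; rewrite (partialM _ (dGm _ _ _ Ux) (dk _ Ux)).
Qed.

(* The last bracket vanishes by symmetry of second derivatives, but it does not
   depend on the metric and cancels when two metrics are compared. *)
Lemma raychaudhuri x : U x ->
  \sum_b \sum_d ricci g b d x * k x b 0 * k x d 0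
  = \sum_a partial a (fun y => \sum_b k y b 0 * B a b y) x
    + \sum_a \sum_e christoffel g a a e x * (\sum_b k x b 0 * B e b x)
    - \sum_a \sum_b B a b x * B b a x
    - \sum_d k x d 0 * partial d (fun y => \sum_a B a a y) x
    + (\sum_d \sum_a k x d 0 * partial d (partial a (fun y => k y a 0)) x
       - \sum_a \sum_d k x d 0 * partial a (partial d (fun y => k y a 0)) x).
Proof.
move=> Ux.
have := raychaudhuri_algebra (fun i => k x i 0) (fun a b => P a b x)
  (fun e a b c => partial e (christoffel g a b c) x)
  (fun d a b => partial d (partial b (fun y => k y a 0)) x)
  (fun a b c => christoffel_sym oU gsym a b c Ux).
rewrite /ricci /riemann => ->.
congr (_ + _ - _ - _ + _).
- apply: eq_bigr => a _; rewrite partial_sum => [|b]; last first.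
    exact: (differentiableM_fun (dk _ Ux) (cov_differentiable _ _ Ux)).
  apply: eq_bigr => b _; rewrite (partialM _ (dk _ Ux) (cov_differentiable _ _ Ux)).
  by rewrite (partial_cov _ _ _ Ux).
- apply: eq_bigr => d _; rewrite partial_sum => [|a]; last exact: cov_differentiable.
  by congr (_ * _); apply: eq_bigr => a _; rewrite (partial_cov _ _ _ Ux).
Qed.

End Raychaudhuri.

Lemma sum_kerr_schild_variation (R : realType) (v A B C E : 'I_5 -> R) (p h q r : R) :
  \sum_c v c * (A c - 2 * (B c * p + h * (C c * r + q * E c)))
  = \sum_c v c * A c - 2 * ((\sum_c v c * B c) * p
      + h * ((\sum_c v c * C c) * r + q * (\sum_c v c * E c))).
Proof. by rewrite !sum5; ring. Qed.

(** Each correction contains l contracted with B or with v; for a null vector v, with l its lowered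
    form and B its covariant derivative, all of them vanish. *)
Lemma sum_rank_one (R : realType) (v l : 'I_5 -> R) (B : 'I_5 -> 'I_5 -> R) (rho : R) :
  \sum_a \sum_b (B a b - rho * (v a * l b)) * (B b a - rho * (v b * l a))
  = \sum_a \sum_b (B a b * B b a) - rho * (\sum_a \sum_b v b * (l a * B a b))
    - rho * \sum_a v a * (\sum_b l b * B b a)
    + rho ^+ 2 * (\sum_a v a * l a) * (\sum_b v b * l b).
Proof.
rewrite -mulrA mulr_suml.
have -> : \sum_a v a * (\sum_b l b * B b a) = \sum_a \sum_b v a * (l b * B b a).
  by apply: eq_bigr => a _; rewrite mulr_sumr.
have -> : \sum_a v a * l a * (\sum_b v b * l b) = \sum_a \sum_b v a * l a * (v b * l b).
  by apply: eq_bigr => a _; rewrite mulr_sumr.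
rewrite 3!mulr_sumr -!sumrB -big_split; apply: eq_bigr => a _.
rewrite /= 3!mulr_sumr -!sumrB -big_split; apply: eq_bigr => b _ /=; ring.
Qed.

(** * Comparison of a Kerr-Schild metric with its background *)

Section KerrSchild.
Variable R : realType.
Implicit Types (a b c d e i j : 'I_5).
Variables (U : set 'rV[R]_5) (g eta : 'rV[R]_5 -> 'M[R]_5).
Hypotheses (oU : open U) (gsym : forall y i j, U y -> g y i j = g y j i)
  (gunit : forall y, U y -> g y \in unitmx) (g_smooth : forall i j, cdiff 1 U (fun y => g y i j))
  (etasym : forall y i j, U y -> eta y i j = eta y j i) (eunit : forall y, U y -> eta y \in unitmx)
  (e_smooth : forall i j, cdiff 1 U (fun y => eta y i j)).
Variables (k : 'rV[R]_5 -> 'cV[R]_5) (H : 'rV[R]_5 -> R).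
Hypotheses (k_smooth : forall i, cdiff 1 U (fun y => k y i 0)) (H_smooth : cdiff 1 U H).
Local Notation L := (lower g k).
Hypotheses (ks : forall y i j, U y -> g y i j = eta y i j - 2 * H y * (L y i * L y j))
  (null : forall y, U y -> \sum_d k y d 0 * L y d = 0) (geo : geodesic U g k).

Local Notation Bg a b := (cov_deriv_vector g k b a).
Local Notation Be a b := (cov_deriv_vector eta k b a).

Lemma lower_background y d : U y -> lower eta k y d = L y d.
Proof.
move=> Uy; transitivity (\sum_a (g y d a * k y a 0 + 2 * H y * L y d * (k y a 0 * L y a))).
  by apply: eq_bigr => a _; rewrite ks//; ring.
by rewrite big_split -mulr_sumr /= null// mulr0 addr0.
Qed.

Lemma null_background y : U y -> \sum_d k y d 0 * lower eta k y d = 0.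
Proof.
by move=> Uy; rewrite -[RHS](null Uy); apply: eq_bigr => d _; rewrite lower_background.
Qed.

Lemma null_cov_background x b : U x -> \sum_a L x a * Be a b x = 0.
Proof.
move=> Ux; rewrite -[RHS](null_cov oU etasym eunit e_smooth k_smooth b Ux null_background).
by apply: eq_bigr => a _; rewrite lower_background.
Qed.

Let null_cov_g x b (Ux : U x) : \sum_a L x a * Bg a b x = 0 :=
  null_cov oU gsym gunit g_smooth k_smooth b Ux null.

Let dL x d (Ux : U x) : differentiable (fun y => L y d) x :=
  differentiable_lower g_smooth k_smooth d Ux.

Let dk x i (Ux : U x) : differentiable (fun y => k y i 0) x.
Proof. exact: (cdiff_differentiable (k_smooth i) Ux). Qed.

(** The left side is the Lie derivative of the lowered vector along [k]. It equals the lowered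
    acceleration plus k_a nabla_d k^a, and the latter vanishes for a null vector. *)
Lemma lie_covector x d kap : U x ->
  (forall a, \sum_b k x b 0 * Bg a b x = kap * k x a 0) ->
  \sum_b k x b 0 * partial b (fun y => L y d) x
  + \sum_a L x a * partial d (fun y => k y a 0) x = kap * L x d.
Proof.
move=> Ux geox.
have n1 : \sum_a (partial d (fun y => k y a 0) x * L x a + k x a 0 * partial d (fun y => L y a) x) = 0.
  rewrite -[RHS](@partial_cst R d 0 x) -(partial_eq_on d oU Ux null).
  rewrite partial_sum => [|a]; last exact: (differentiableM_fun (dk _ Ux) (dL _ Ux)).
  by apply: eq_bigr => a _; rewrite (partialM _ (dk _ Ux) (dL _ Ux)).
have e1 : \sum_a L x a * partial d (fun y => k y a 0) x = - \sum_b k x b 0 * partial d (fun y => L y b) x.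
  apply/eqP; rewrite -subr_eq0 opprK; apply/eqP; rewrite -[RHS]n1 big_split; congr (_ + _).
  by apply: eq_bigr => a _; rewrite mulrC.
rewrite e1.
transitivity (\sum_b k x b 0 * (\sum_a g x d a * Bg a b x - \sum_a g x b a * Bg a d x)).
  rewrite -sumrB; apply: eq_bigr => b _; rewrite -mulrBr; congr (_ * _).
  rewrite (cov_low_lie gunit g_smooth k_smooth b d Ux).
  rewrite (cov_low_lie gunit g_smooth k_smooth d b Ux).
  under [X in _ = _ - (_ + _ * (X + _ + _))]eq_bigr do rewrite (partial_metric_sym oU gsym _ _ _ Ux).
  by field.
under eq_bigr do rewrite mulrBr.
rewrite sumrB; have -> : \sum_b k x b 0 * (\sum_a g x b a * Bg a d x) = \sum_a L x a * Bg a d x.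
  under eq_bigr do rewrite mulr_sumr.
  rewrite exchange_big; apply: eq_bigr => a _; rewrite /lower mulr_suml.
  by apply: eq_bigr => b _; rewrite (gsym b a Ux); ring.
rewrite null_cov_g// subr0.
under eq_bigr do rewrite mulr_sumr.
rewrite exchange_big /lower mulr_sumr; apply: eq_bigr => a _ /=.
under eq_bigr do rewrite mulrCA.
by rewrite -mulr_sumr geox; ring.
Qed.

(** The lowered covariant derivative splits into half the exterior derivative of the covector, which
    is the same for both metrics, and half the Lie derivative of the metric. By [lie_covector], the
    Lie derivative of 2 H k_a k_b is 2 (k(H) + 2 H kap) k_a k_b, which gives [rho]. *)
Lemma cov_background x : U x -> exists rho : R,
  forall a b, Bg a b x = Be a b x - rho * (k x a 0 * L x b).
Proof.
move=> Ux; have [kap geox] := geo Ux.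
pose kH := \sum_c k x c 0 * partial c H x.
exists (kH + 2 * H x * kap).
have dH : differentiable H x := cdiff_differentiable H_smooth Ux.
have pks c i j : partial c (fun y => g y i j) x = partial c (fun y => eta y i j) x
   - 2 * (partial c H x * (L x i * L x j)
     + H x * (partial c (fun y => L y i) x * L x j + L x i * partial c (fun y => L y j) x)).
  have de : differentiable (fun y => eta y i j) x := cdiff_differentiable (e_smooth i j) Ux.
  have dLL := differentiableM_fun (dL i Ux) (dL j Ux).
  have d2 : differentiable (fun _ : 'rV[R]_5 => 2 : R) x by exact: differentiable_cst.
  have d2H : differentiable (fun y => 2 * H y) x := differentiableM_fun d2 dH.
  rewrite (partial_eq_on c oU Ux (fun y => @ks y i j)).
  rewrite (partialB _ de (differentiableM_fun d2H dLL)) (partialM _ d2H dLL).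
  rewrite (partialM _ (dL i Ux) (dL j Ux)) (partialM _ d2 dH) partial_cst.
  by ring.
have low d b : \sum_a g x d a * Bg a b x = \sum_a eta x d a * Be a b x
    - (kH + 2 * H x * kap) * (L x d * L x b).
  rewrite (cov_low_lie gunit g_smooth k_smooth b d Ux).
  rewrite (cov_low_lie eunit e_smooth k_smooth b d Ux).
  rewrite !(partial_eq_on _ oU Ux (fun y => @lower_background y _)).
  have E1 : \sum_c k x c 0 * partial c (fun y => g y d b) x =
     \sum_c k x c 0 * partial c (fun y => eta y d b) x
     - 2 * (kH * (L x d * L x b) + H x * ((\sum_c k x c 0 * partial c (fun y => L y d) x) * L x b
         + L x d * (\sum_c k x c 0 * partial c (fun y => L y b) x))).
    by under eq_bigr do rewrite pks; rewrite sum_kerr_schild_variation.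
  have E2 i j : \sum_a g x i a * partial j (fun y => k y a 0) x =
     \sum_a eta x i a * partial j (fun y => k y a 0) x
     - 2 * H x * L x i * \sum_a L x a * partial j (fun y => k y a 0) x.
    by rewrite mulr_sumr -sumrB; apply: eq_bigr => a _; rewrite ks//; ring.
  rewrite E1 !E2.
  have h1 := lie_covector d Ux geox; have h2 := lie_covector b Ux geox.
  move: h1 h2 => /(canRL (addrK _)) -> /(canRL (addrK _)) ->.
  by field.
move=> a b.
suff h d : \sum_a g x d a * (Bg a b x - Be a b x + (kH + 2 * H x * kap) * (k x a 0 * L x b)) = 0.
  have := sum_ginv_metric gunit a (fun a => Bg a b x - Be a b x + (kH + 2 * H x * kap) * (k x a 0 * L x b)) Ux.
  rewrite big1 => [h0|d _]; last by rewrite h mulr0.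
  by apply/eqP; rewrite -subr_eq0 opprB addrA addrAC; apply/eqP; rewrite [RHS]h0; ring.
transitivity (\sum_a g x d a * Bg a b x - \sum_a g x d a * Be a b x
   + (kH + 2 * H x * kap) * (L x d * L x b)).
  rewrite [L x d]/lower mulr_suml mulr_sumr -sumrB -big_split.
  by apply: eq_bigr => c _ /=; ring.
rewrite low.
(* Lowering with [eta] instead of [g] changes nothing, since the covariant derivative of a null
   vector is orthogonal to it. *)
have -> : \sum_a g x d a * Be a b x = \sum_a eta x d a * Be a b x - 2 * H x * L x d * \sum_a L x a * Be a b x.
  by rewrite mulr_sumr -sumrB; apply: eq_bigr => c _; rewrite ks//; ring.
by rewrite null_cov_background//; ring.
Qed.

Theorem kerr_schild_ricci_null x : U x ->
  \sum_b \sum_d ricci g b d x * k x b 0 * k x d 0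
  = \sum_b \sum_d ricci eta b d x * k x b 0 * k x d 0.
Proof.
move=> Ux.
rewrite (raychaudhuri oU gsym gunit g_smooth k_smooth Ux).
rewrite (raychaudhuri oU etasym eunit e_smooth k_smooth Ux).
(* The rank-one difference disappears in the acceleration and in the trace alike, because k^b k_b =
   0. *)
have accE y a : U y -> \sum_b k y b 0 * Bg a b y = \sum_b k y b 0 * Be a b y.
  move=> Uy; have [rho e] := cov_background Uy.
  transitivity (\sum_b k y b 0 * Be a b y - rho * k y a 0 * \sum_b k y b 0 * L y b).
    by rewrite mulr_sumr -sumrB; apply: eq_bigr => b _; rewrite e; ring.
  by rewrite null// mulr0 subr0.
have trE y : U y -> \sum_a Bg a a y = \sum_a Be a a y.
  move=> Uy; have [rho e] := cov_background Uy.
  transitivity (\sum_a Be a a y - rho * \sum_b k y b 0 * L y b).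
    by rewrite mulr_sumr -sumrB; apply: eq_bigr => b _; rewrite e; ring.
  by rewrite null// mulr0 subr0.
have h1 : \sum_a partial a (fun y => \sum_b k y b 0 * Bg a b y) x
    = \sum_a partial a (fun y => \sum_b k y b 0 * Be a b y) x.
  by apply: eq_bigr => a _; apply: (partial_eq_on _ oU Ux) => y Uy; exact: accE.
(* The Christoffel traces need no direct comparison: since the acceleration is kap k, each side is
   kap times the covariant minus the coordinate divergence of [k], and the covariant divergences
   agree. *)
have h2 : \sum_a \sum_e christoffel g a a e x * (\sum_b k x b 0 * Bg e b x)
    = \sum_a \sum_e christoffel eta a a e x * (\sum_b k x b 0 * Be e b x).
  have [kap geox] := geo Ux.
  have T (h : 'rV[R]_5 -> 'M[R]_5) : (forall a, \sum_b k x b 0 * cov_deriv_vector h k b a x = kap * k x a 0) ->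
    \sum_a \sum_e christoffel h a a e x * (\sum_b k x b 0 * cov_deriv_vector h k b e x)
    = kap * (\sum_a cov_deriv_vector h k a a x - \sum_a partial a (fun y => k y a 0) x).
    move=> hx; rewrite -sumrB mulr_sumr; apply: eq_bigr => a _.
    rewrite /cov_deriv_vector addrAC subrr add0r mulr_sumr; apply: eq_bigr => e _.
    by rewrite hx; ring.
  have geoe a : \sum_b k x b 0 * Be a b x = kap * k x a 0 by rewrite -(accE x a Ux) geox.
  refine (etrans (T g geox) (etrans _ (esym (T eta geoe)))).
  by rewrite (trE x Ux).
have h3 : \sum_a \sum_b Bg a b x * Bg b a x = \sum_a \sum_b Be a b x * Be b a x.
  have [rho e] := cov_background Ux.
  transitivity (\sum_a \sum_b (Be a b x * Be b a x) - rho * (\sum_a \sum_b k x b 0 * (L x a * Be a b x))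
    - rho * \sum_a k x a 0 * (\sum_b L x b * Be b a x)
    + rho ^+ 2 * (\sum_a k x a 0 * L x a) * (\sum_b k x b 0 * L x b)).
    rewrite -sum_rank_one; apply: eq_bigr => a _; apply: eq_bigr => b _.
    by rewrite !e.
  have n1 : \sum_a \sum_b k x b 0 * (L x a * Be a b x) = 0.
    rewrite exchange_big; apply: big1 => b _.
    transitivity (k x b 0 * \sum_a L x a * Be a b x); first by rewrite mulr_sumr.
    by rewrite (null_cov_background b Ux) mulr0.
  have n2 : \sum_a k x a 0 * (\sum_b L x b * Be b a x) = 0.
    by apply: big1 => b _; rewrite (null_cov_background b Ux) mulr0.
  by rewrite n1 n2 (null Ux) !mulr0 !subr0 addr0.
have h4 : \sum_d k x d 0 * partial d (fun y => \sum_a Bg a a y) x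
    = \sum_d k x d 0 * partial d (fun y => \sum_a Be a a y) x.
  by apply: eq_bigr => d _; rewrite (partial_eq_on d oU Ux trE).
have combine A A' B B' C C' E E' Z : A = A' -> B = B' -> C = C' -> E = E' ->
    A + B - C - E + Z = A' + B' - C' - E' + Z :> R by move=> -> -> -> ->.
exact (combine _ _ _ _ _ _ _ _ _ h1 h2 h3 h4).
Qed.

End KerrSchild.

(** * The field equations along Killing vectors *)

Section Contractions.
Variable R : realType.
Implicit Types (a c d e : 'I_5) (th r : R) (P Q : R -> R).
Variables f m N w : R -> R.
Local Notation hmx' := (hmx f m N w).

(** The covector P' dt + Q' sigma with its index raised. *)
Definition vdual P Q r a : R :=
  - (f r)^-1 * (derive1 P r + w r * derive1 Q r) * (dt R a + w r * xi R a)
  + derive1 Q r / bb m N r * xi R a.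

(** The second index of [fmx P Q] raised by the inverse metric, as [sum_hmx_fmx] states. *)
Definition kmx P Q r th a e : R :=
  dr R e * vdual P Q r a - dr R a / grr f m N r * (derive1 P r * dt R e + derive1 Q r * sig th e)
  + Q r * sc2 th / aa f m r *
    (dth R e * ((sin th * cos th) ^- 2 * evec th a) - dth R a * dchi R e).

Lemma sum_hmx_fmx P Q r th a e : sin th != 0 -> cos th != 0 ->
  \sum_d hmx' r th a d * fmx P Q r th e d = kmx P Q r th a e.
Proof.
move=> s0 c0; rewrite sum5 /hmx /fmx /kmx /vdual.
have sE := sin2cos2 th.
have E1 : sin th ^+ 2 * (sin th * cos th) ^- 2 * cos th ^+ 2 = 1.
  by field; rewrite s0 c0.
rewrite /dt /dr /dth /dchi /xi /sig /evec /dphi /dpsi.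
rewrite sE in E1 *.
move: ((sin th * cos th) ^- 2) E1 => Z E1.
move: (f r)^-1 (bb m N r)^-1 (grr f m N r)^-1 (aa f m r)^-1 (derive1 P r) (derive1 Q r) => F B G A p q.
elim/ind5: a; elim/ind5: e; rewrite /=; ring: E1.
Qed.

(** Minus the full contraction of the exterior derivatives of the two forms; the angle cancels,
    leaving a radial function. *)
Definition pairing P1 Q1 P2 Q2 r : R :=
  - 2 * (- (derive1 P1 r + w r * derive1 Q1 r) * (derive1 P2 r + w r * derive1 Q2 r) / f r
         + derive1 Q1 r * derive1 Q2 r / bb m N r) / grr f m N r
  - 8 * (Q1 r / aa f m r) * (Q2 r / aa f m r).

Lemma sum_kmx P1 Q1 P2 Q2 r th : sin th != 0 -> cos th != 0 ->
  \sum_a \sum_e kmx P1 Q1 r th a e * kmx P2 Q2 r th e a = pairing P1 Q1 P2 Q2 r.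
Proof.
move=> s0 c0; rewrite !sum5 /kmx /vdual /pairing.
have sE := sin2cos2 th.
(* The angular factor of the magnetic term is the constant 4, taken twice by the trace: this is the
   8 in [pairing]. *)
have E1 : sc2 th ^+ 2 * (sin th * cos th) ^- 2 = 4.
  by rewrite /sc2; field; rewrite s0 c0.
rewrite /dt /dr /dth /dchi /xi /sig /evec /dphi /dpsi sE /=.
move: ((sin th * cos th) ^- 2) (sc2 th) E1 => Z S E1.
move: (f r)^-1 (bb m N r)^-1 (grr f m N r)^-1 (aa f m r)^-1 => F B G A.
move: (derive1 P1 r) (derive1 Q1 r) (derive1 P2 r) (derive1 Q2 r) => p1' q1' p2' q2'.
move: (Q1 r) (Q2 r) (w r) (cos th ^+ 2) => q1 q2 W c.
ring: E1.
Qed.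

(** The radial logarithmic derivative of |det g|, which is f B G A^2 up to an angular factor, with
    B, G, A standing for [bb], [grr], [aa]. *)
Definition tr_dr r : R :=
  derive1 f r / f r + derive1 (bb m N) r / bb m N r + derive1 (grr f m N) r / grr f m N r
  + 2 * derive1 (aa f m) r / aa f m r.

Lemma sum_hmx_dr r th : sin th != 0 -> cos th != 0 ->
  f r != 0 -> bb m N r != 0 -> grr f m N r != 0 -> aa f m r != 0 ->
  derivable f r 1 -> derivable (bb m N) r 1 -> derivable w r 1 ->
  \sum_a \sum_d hmx' r th a d * gmx_dr f m N w r th a d = tr_dr r.
Proof.
move=> s0 c0 f0 b0 g0 a0 df db dw.
have dw2 : derivable (fun t => w t * w t) r 1 := derivableM1 dw dw.
have E1 : derive1 (gtt f m N w) r = - derive1 f r + (derive1 (bb m N) r * w r ^+ 2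
    + bb m N r * (2 * w r * derive1 w r)).
  transitivity (derive1 (fun t => -1 * f t + bb m N t * (w t * w t)) r).
    by congr (derive1 _ r); apply/funext => t; rewrite /gtt mulN1r expr2.
  have dmf : derivable (fun t => -1 * f t) r 1 := derivableM1 (derivable_cst (-1 : R) r 1) df.
  rewrite (derive1D dmf (derivableM1 db dw2)) (derive1M db dw2) (derive1M dw dw).
  by rewrite (derive1M (derivable_cst (-1 : R) r 1) df) derive1_cst /=; ring.
have E2 : derive1 (gts m N w) r = - derive1 (bb m N) r * w r - bb m N r * derive1 w r.
  transitivity (derive1 (fun t => -1 * (bb m N t * w t)) r).
    by congr (derive1 _ r); apply/funext => t; rewrite /gts mulN1r.
  rewrite (derive1M (derivable_cst (-1 : R) r 1) (derivableM1 db dw)) derive1_cst (derive1M db dw) /=.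
  by ring.
rewrite !sum5 /hmx /gmx_dr E1 E2 /tr_dr.
have sE := sin2cos2 th.
have E3 : (sin th * cos th) ^+ 2 != 0 by rewrite expf_neq0// mulf_neq0.
rewrite /dt /dr /dth /dchi /xi /sig /evec /dphi /dpsi sE /=.
move: ((sin th * cos th) ^+ 2) E3 => S E3.
move: (cos th ^+ 2) (derive1 f r) (derive1 (bb m N) r) (derive1 w r) (derive1 (grr f m N) r) (derive1 (aa f m) r) => c f' b' w' g' a'.
move: (f r) (bb m N r) (grr f m N r) (aa f m r) (w r) f0 b0 g0 a0 => F B G A W f0 b0 g0 a0.
field.
by rewrite f0 b0 g0 a0 E3.
Qed.

End Contractions.

(** The difference quotient along such a coordinate is identically zero. *)
Lemma partial_chart_invariant (R : realType) (U : set 'rV[R]_5) (h : 'rV[R]_5 -> R)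
    (Psi : R -> R -> R) (k : 'I_5) x : open U -> U x ->
  (forall y, U y -> h y = Psi (y 0 i_rad) (y 0 i_th)) -> k != i_rad -> k != i_th ->
  partial k h x = 0.
Proof.
move=> oU Ux e kr kt.
rewrite (partial_eq_on k oU Ux e) /partial /derive.
rewrite (_ : (fun _ => _) = fun=> 0); first exact: lim_cst.
have e1 (t : R) j : k != j -> (t *: dx R k + x) 0 j = x 0 j.
  by move=> kj; rewrite mxE [X in X + _]mxE dxE eq_sym (negbTE kj) mulr0 add0r.
by apply/funext => t /=; rewrite !e1// subrr scaler0.
Qed.

Lemma smooth_derivable (R : realType) (D : set R) (p : R -> R) r :
  smooth_on D p -> D r -> derivable p r 1.
Proof. by move=> sp; exact: (sp 0%N). Qed.

Section ContractionAlgebra.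
Variables (R : realType) (I : finType).
Variables (u v : I -> R) (A C G : I -> I -> I -> R).

(** The contractions are moved inside the products, so that besides the trace only Christoffel
    symbols contracted with [u] or [v] occur; for Killing vectors these are explicit. *)
Lemma ricci_contraction :
  \sum_b u b * (\sum_k v k * (\sum_a (A a k b - C a k b
      + \sum_e (G a a e * G e k b - G a k e * G e a b))))
  = \sum_a \sum_b u b * (\sum_k v k * A a k b) - \sum_a \sum_b u b * (\sum_k v k * C a k b)
    + \sum_a \sum_e G a a e * (\sum_b u b * (\sum_k v k * G e k b))
    - \sum_a \sum_e (\sum_k v k * G a k e) * (\sum_b u b * G e a b).
Proof.
have -> : \sum_a \sum_e G a a e * (\sum_b u b * (\sum_k v k * G e k b))
    = \sum_a \sum_b \sum_k \sum_e u b * v k * (G a a e * G e k b).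
  apply: eq_bigr => a _; under eq_bigr do rewrite mulr_sumr.
  rewrite exchange_big; apply: eq_bigr => b _ /=.
  rewrite exchange_big /=; apply: eq_bigr => e _.
  by rewrite !mulr_sumr; apply: eq_bigr => k _; ring.
have -> : \sum_a \sum_e (\sum_k v k * G a k e) * (\sum_b u b * G e a b)
    = \sum_a \sum_b \sum_k \sum_e u b * v k * (G a k e * G e a b).
  apply: eq_bigr => a _; under eq_bigr do rewrite mulr_sumr.
  rewrite exchange_big; apply: eq_bigr => b _ /=.
  rewrite exchange_big /=; apply: eq_bigr => e _.
  by rewrite mulr_suml; apply: eq_bigr => k _; ring.
transitivity (\sum_a \sum_b \sum_k (u b * (v k * A a k b) - u b * (v k * C a k b)
  + (\sum_e u b * v k * (G a a e * G e k b) - \sum_e u b * v k * (G a k e * G e a b)))).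
  transitivity (\sum_b \sum_k \sum_a (u b * (v k * A a k b) - u b * (v k * C a k b)
    + (\sum_e u b * v k * (G a a e * G e k b) - \sum_e u b * v k * (G a k e * G e a b)))).
    apply: eq_bigr => b _; rewrite mulr_sumr; apply: eq_bigr => k _.
    rewrite !mulr_sumr; apply: eq_bigr => a _; rewrite !mulrDr !mulrN; congr (_ + _).
    by rewrite -sumrB !mulr_sumr; apply: eq_bigr => e _; ring.
  by rewrite [RHS]exchange_big; apply: eq_bigr => b _; rewrite exchange_big.
rewrite -addrA -!sumrB -big_split; apply: eq_bigr => a _ /=.
rewrite -!sumrB -big_split; apply: eq_bigr => b _ /=.
rewrite !mulr_sumr -!sumrB -big_split; apply: eq_bigr => k _ //=.
Qed.

Lemma maxwell_contraction (h : I -> I -> R) (K : I -> I -> R) :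
  \sum_b u b * (\sum_c \sum_a h c a * (A c a b - \sum_e (G e c a * K e b + G e c b * K a e)))
  = \sum_c \sum_a h c a * (\sum_b u b * A c a b)
    - \sum_c \sum_a h c a * (\sum_e G e c a * (\sum_b u b * K e b))
    - \sum_c \sum_a h c a * (\sum_e (\sum_b u b * G e c b) * K a e).
Proof.
transitivity (\sum_c \sum_a \sum_b (u b * (h c a * A c a b)
   - u b * (h c a * \sum_e G e c a * K e b) - u b * (h c a * \sum_e G e c b * K a e))).
  transitivity (\sum_b \sum_c \sum_a (u b * (h c a * A c a b)
   - u b * (h c a * \sum_e G e c a * K e b) - u b * (h c a * \sum_e G e c b * K a e))).
    apply: eq_bigr => b _; rewrite mulr_sumr; apply: eq_bigr => c _.
    rewrite mulr_sumr; apply: eq_bigr => a _; rewrite big_split /=; ring.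
  by rewrite exchange_big; apply: eq_bigr => c _; rewrite exchange_big.
rewrite -!sumrB; apply: eq_bigr => c _; rewrite -!sumrB; apply: eq_bigr => a _.
rewrite !sumrB; congr (_ - _ - _).
- by rewrite mulr_sumr; apply: eq_bigr => b _; ring.
- transitivity (\sum_b \sum_e h c a * (G e c a * (u b * K e b))).
    by apply: eq_bigr => b _; rewrite !mulr_sumr; apply: eq_bigr => e _; ring.
  rewrite exchange_big mulr_sumr; apply: eq_bigr => e _ /=.
  by rewrite !mulr_sumr.
- transitivity (\sum_b \sum_e h c a * (u b * G e c b * K a e)).
    by apply: eq_bigr => b _; rewrite !mulr_sumr; apply: eq_bigr => e _; ring.
  rewrite exchange_big mulr_sumr; apply: eq_bigr => e _ /=.
  by rewrite mulr_suml mulr_sumr.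
Qed.

End ContractionAlgebra.

Section FieldEquations.
Variable R : realType.
Implicit Types (x y : 'rV[R]_5) (a b c d e i j : 'I_5).
Variables (D : set R) (f m N w : R -> R).
Hypotheses (oD : open D) (sf : smooth_on D f) (sm : smooth_on D m) (sN : smooth_on D N)
  (sw : smooth_on D w) (pos : forall r, D r -> [/\ 0 < f r, 0 < m r & 0 < N r]).
Local Notation U := (chart_region D).
Local Notation g := (ansatz_metric f m N w).
Local Notation hmx' := (hmx f m N w).
Local Notation kmx := (kmx f m N w).
Local Notation Gr := (grr f m N).
Local Notation Dg := (gmx_dr f m N w).
Local Notation Pair := (pairing f m N w).
Local Notation Gam := (christoffel g).
Local Notation rad x := (x 0 i_rad).
Local Notation tht x := (x 0 i_th).

Let oU : open U := chart_region_open oD.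
Let gS y i j (Uy : U y) : g y i j = g y j i := ansatz_metric_sym w pos i j Uy.
Let gu y (Uy : U y) : g y \in unitmx := metric_unit w pos Uy.
Let gs i j : cdiff 1 U (fun y => g y i j) := cdiff_metric oD sf sm sN sw pos 1 i j.
Let pG k i j x (Ux : U x) := partial_metric oD sf sm sN sw pos k i j Ux.
Let s0 x (Ux : U x) : sin (tht x) != 0. Proof. by rewrite gt_eqF// (chart_sin_gt0 Ux). Qed.
Let c0 x (Ux : U x) : cos (tht x) != 0. Proof. by rewrite gt_eqF// (chart_cos_gt0 Ux). Qed.
Let dGm x a b c (Ux : U x) : differentiable (Gam a b c) x :=
  christoffel_differentiable oU gu gs a b c Ux.

Lemma partial_christoffel_killing x k a b c : U x -> k != i_rad -> k != i_th ->
  partial k (Gam a b c) x = 0.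
Proof.
move=> Ux kr kt.
pose DG (r th : R) k i j := dr R k * Dg r th i j + dth R k * gmx_dth f m N w r th i j.
apply: (@partial_chart_invariant R U _ (fun r th => 2^-1 * \sum_d hmx' r th a d *
  (DG r th b d c + DG r th c d b - DG r th d b c))) => // y Uy.
rewrite /christoffel; congr (_ * _); apply: eq_bigr => d _.
by rewrite (ginvE w pos _ _ Uy) !(pG _ _ _ Uy).
Qed.

(** A constant vector along cyclic coordinates whose lowered form is P dt + Q sigma. The instances
    are d_t and d_phi + d_psi. *)
Record killing_pair (v : 'I_5 -> R) (P Q : R -> R) : Prop := KillingPair {
  killing_rad : v i_rad = 0;
  killing_th : v i_th = 0;
  killing_low : forall r th d, \sum_k v k * gmx f m N w r th d k = P r * dt R d + Q r * sig th d;
  killing_smooth : smooth_on D P /\ smooth_on D Q }.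

Lemma killing_dt : killing_pair (dt R) (gtt f m N w) (gts m N w).
Proof.
apply: (KillingPair _ _ _ (conj (smooth_gtt oD sf sm sN sw pos) (smooth_gts oD sm sN sw pos))).
- by rewrite /dt.
- by rewrite /dt.
- by move=> r th d; rewrite sum5 /gmx /gts /gtt /sig /dchi /dt /dr /dth /dphi /dpsi /=; ring.
Qed.

Lemma killing_xi : killing_pair (xi R) (gts m N w) (bb m N).
Proof.
apply: (KillingPair _ _ _ (conj (smooth_gts oD sm sN sw pos) (smooth_bb oD sm sN pos))).
- by rewrite /xi /dphi /dpsi /= addr0.
- by rewrite /xi /dphi /dpsi /= addr0.
move=> r th d; have sE := sin2cos2 th.
by rewrite sum5 /xi /gmx /gts /gtt /sig /dchi /dt /dr /dth /dphi /dpsi /= sE; ring.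
Qed.

(** For constant components the left side is nabla_b v^a, and the Killing equation makes its lowered
    form antisymmetric, hence half the exterior derivative of the lowered v. *)
Lemma christoffel_killing v P Q x a b : killing_pair v P Q -> U x ->
  \sum_k v k * Gam a k b x = 2^-1 * kmx P Q (rad x) (tht x) a b.
Proof.
move=> kv Ux; have [Dr _] := Ux; have [sP sQ] := killing_smooth kv.
have dP : derivable P (rad x) 1 := sP 0%N _ Dr.
have dQ : derivable Q (rad x) 1 := sQ 0%N _ Dr.
rewrite -(sum_hmx_fmx f m N w P Q (rad x) a b (s0 Ux) (c0 Ux)).
have dgx i j : differentiable (fun y => g y i j) x := cdiff_differentiable (gs i j) Ux.
have low e d : \sum_k v k * partial e (fun y => g y d k) x = partial e (fun y => oneform P Q y d) x.
  transitivity (partial e (fun y => \sum_k v k * g y d k) x).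
    have cv k : differentiable (fun _ : 'rV[R]_5 => v k) x by exact: differentiable_cst.
    rewrite partial_sum => [|k]; last exact: (differentiableM_fun (cv k) (dgx d k)).
    by apply: eq_bigr => k _; rewrite (partialM _ (cv k) (dgx d k)) partial_cst mul0r add0r.
  apply: (partial_eq_on _ oU Ux) => y Uy; rewrite /oneform -(killing_low kv).
  by apply: eq_bigr => k _; rewrite (metricE w pos _ _ Uy).
transitivity (2^-1 * \sum_d ginv g x a d *
  (\sum_k v k * partial b (fun y => g y d k) x - \sum_k v k * partial d (fun y => g y b k) x)).
  transitivity (\sum_k 2^-1 * \sum_d v k * (ginv g x a d *
    (partial k (fun y => g y d b) x + partial b (fun y => g y d k) x - partial d (fun y => g y k b) x))).
    by apply: eq_bigr => k _; rewrite /christoffel mulrCA mulr_sumr.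
  rewrite -mulr_sumr exchange_big; congr (_ * _); apply: eq_bigr => d _ /=.
  rewrite -sumrB mulr_sumr; apply: eq_bigr => k _.
  have vk : v k * partial k (fun y => g y d b) x = 0.
    rewrite pG// /dr /dth; elim/ind5: k => /=; rewrite ?(killing_rad kv) ?(killing_th kv); ring.
  rewrite (partial_eq_on d oU Ux (fun y Uy => gS k b Uy)).
  transitivity (ginv g x a d * (v k * partial k (fun y => g y d b) x
    + v k * partial b (fun y => g y d k) x - v k * partial d (fun y => g y b k) x)); first by ring.
  by rewrite vk add0r.
congr (_ * _); apply: eq_bigr => d _.
rewrite (ginvE w pos _ _ Ux) !low !partial_oneform// /fmx; congr (_ * _); ring.
Qed.

(** Contraction with [u] retains the dt and sigma parts of a covector with weights [ct] and [cs] and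
    discards the rest, so d_t and d_phi + d_psi are treated at once. *)
Record probe (u : 'I_5 -> R) (ct cs : R) : Prop := Probe {
  probe_rad : u i_rad = 0;
  probe_th : u i_th = 0;
  probe_dt : \sum_b u b * dt R b = ct;
  probe_sig : forall th, \sum_b u b * sig th b = cs;
  probe_dchi : \sum_b u b * dchi R b = 0 }.

Lemma probe_of_dt : probe (dt R) 1 0.
Proof.
by split=> [| | |th|]; rewrite ?sum5 /dt /sig /dchi /dphi /dpsi /=; ring.
Qed.

Lemma probe_of_xi : probe (xi R) 0 1.
Proof.
by split=> [| | |th|]; rewrite ?sum5 /xi /dt /sig /dchi /dphi /dpsi /= ?sin2cos2; ring.
Qed.

Definition radial_part (ct cs : R) (P Q : R -> R) (r : R) : R :=
  ct * derive1 P r + cs * derive1 Q r.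

Lemma sum_probe_kmx u ct cs P Q r th a : probe u ct cs ->
  \sum_b u b * kmx P Q r th a b = - (dr R a * (radial_part ct cs P Q r / Gr r)).
Proof.
move=> pu.
have ur : \sum_b u b * dr R b = 0 by rewrite sum5 /dr /= (probe_rad pu); ring.
have uh : \sum_b u b * dth R b = 0 by rewrite sum5 /dth /= (probe_th pu); ring.
transitivity (vdual f m N w P Q r a * (\sum_b u b * dr R b)
  - dr R a / Gr r * (derive1 P r * (\sum_b u b * dt R b) + derive1 Q r * (\sum_b u b * sig th b))
  + Q r * sc2 th / aa f m r * ((sin th * cos th) ^- 2 * evec th a * (\sum_b u b * dth R b)
     - dth R a * (\sum_b u b * dchi R b))).
  by rewrite /kmx !sum5; ring.
by rewrite ur uh (probe_dt pu) (probe_sig pu) (probe_dchi pu) /radial_part; ring.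
Qed.

Let aa0 r (Dr : D r) : aa f m r != 0. Proof. by rewrite gt_eqF// (aa_gt0 pos Dr). Qed.
Let bb0 r (Dr : D r) : bb m N r != 0. Proof. by rewrite gt_eqF// (bb_gt0 pos Dr). Qed.
Let grr0 r (Dr : D r) : Gr r != 0. Proof. by rewrite gt_eqF// (grr_gt0 pos Dr). Qed.

Lemma smooth_radial_part ct cs P Q : smooth_on D P -> smooth_on D Q ->
  smooth_on D (radial_part ct cs P Q).
Proof.
move=> sP sQ; exact: (smoothD oD (smoothM oD (@smooth_cst R D ct) (smooth_on_derive1 sP))
  (smoothM oD (@smooth_cst R D cs) (smooth_on_derive1 sQ))).
Qed.

Lemma smooth_radial_ratio ct cs P Q : smooth_on D P -> smooth_on D Q ->
  smooth_on D (fun r => radial_part ct cs P Q r / Gr r).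
Proof.
move=> sP sQ.
exact: (smoothM oD (smooth_radial_part sP sQ) (smoothV oD grr0 (smooth_grr oD sf sm sN pos))).
Qed.

Let trE x (Ux : U x) : \sum_a \sum_d hmx' (rad x) (tht x) a d * Dg (rad x) (tht x) a d
  = tr_dr f m N (rad x).
Proof.
have [Dr _] := Ux; have df := smooth_derivable sf Dr; have dw := smooth_derivable sw Dr.
have db := smooth_derivable (smooth_bb oD sm sN pos) Dr.
exact: (sum_hmx_dr (s0 Ux) (c0 Ux) (f_neq0 pos Dr) (bb0 Dr) (grr0 Dr) (aa0 Dr) df db dw).
Qed.

(** Half the logarithmic derivative of the determinant. The other two terms are antisymmetric and
    contract to zero with the symmetric inverse metric, which is [sc]. *)
Lemma sum_christoffel_trace x : U x ->
  \sum_a Gam a a i_rad x = 2^-1 * tr_dr f m N (rad x).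
Proof.
move=> Ux; rewrite -(trE Ux).
rewrite /christoffel -mulr_sumr; congr (_ * _).
have sc E : \sum_a \sum_d ginv g x a d * (E a d - E d a) = 0 :> R.
  under eq_bigr do under eq_bigr do rewrite mulrBr.
  under eq_bigr do rewrite sumrB.
  rewrite sumrB; apply/eqP; rewrite subr_eq0; apply/eqP; rewrite exchange_big.
  apply: eq_bigr => a _; apply: eq_bigr => d _; congr (_ * _).
  by rewrite !(ginvE w pos _ _ Ux) /hmx; ring.
transitivity (\sum_a \sum_d (hmx' (rad x) (tht x) a d * Dg (rad x) (tht x) a d)
   + \sum_a \sum_d ginv g x a d * (partial a (fun y => g y d i_rad) x - partial d (fun y => g y a i_rad) x)).
  rewrite -big_split; apply: eq_bigr => a _; rewrite -big_split; apply: eq_bigr => d _ /=.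
  rewrite (ginvE w pos _ _ Ux) (pG i_rad _ _ Ux) /dr /dth /=.
  have -> : Dg (rad x) (tht x) d a = Dg (rad x) (tht x) a d by rewrite /gmx_dr; ring.
  by ring.
by rewrite (sc (fun a d => partial a (fun y => g y d i_rad) x)) addr0.
Qed.

(** The contracted Christoffel symbols are field strengths, and with both vectors inserted only a
    radial component survives. So one radial derivative, one trace term and one pairing make up the
    Ricci component. *)
Lemma ricci_killing u ct cs v P Q Pu Qu x : U x ->
  probe u ct cs -> killing_pair v P Q -> killing_pair u Pu Qu ->
  \sum_b u b * (\sum_k v k * ricci g b k x)
  = - 2^-1 * derive1 (fun r => radial_part ct cs P Q r / Gr r) (rad x)
    - 4^-1 * tr_dr f m N (rad x) * (radial_part ct cs P Q (rad x) / Gr (rad x))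
    - 4^-1 * Pair P Q Pu Qu (rad x).
Proof.
move=> Ux pu kv ku; have [Dr _] := Ux; have [sP sQ] := killing_smooth kv.
rewrite /ricci /riemann.
rewrite (ricci_contraction u v (fun a k b => partial a (Gam a k b) x)
  (fun a k b => partial k (Gam a a b) x) (fun a b c => Gam a b c x)).
have T2 : \sum_a \sum_b u b * (\sum_k v k * partial k (Gam a a b) x) = 0.
  apply: big1 => a _; apply: big1 => b _; rewrite big1 ?mulr0// => k _.
  have [->|kr] := eqVneq k i_rad; first by rewrite (killing_rad kv) mul0r.
  have [->|kt] := eqVneq k i_th; first by rewrite (killing_th kv) mul0r.
  by rewrite (partial_christoffel_killing _ _ _ Ux kr kt) mulr0.
have cE y a : U y -> \sum_b u b * (\sum_k v k * Gam a k b y)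
   = - 2^-1 * (dr R a * (radial_part ct cs P Q (rad y) / Gr (rad y))).
  move=> Uy; rewrite mulNr -mulrN -(sum_probe_kmx P Q (rad y) (tht y) a pu) mulr_sumr.
  by apply: eq_bigr => b _; rewrite (christoffel_killing _ _ kv Uy); ring.
have T1 : \sum_a \sum_b u b * (\sum_k v k * partial a (Gam a k b) x)
    = - 2^-1 * derive1 (fun r => radial_part ct cs P Q r / Gr r) (rad x).
  have sr := smooth_derivable (smooth_radial_ratio (ct := ct) (cs := cs) sP sQ) Dr.
  transitivity (\sum_a - 2^-1 * (dr R a * (dr R a * derive1 (fun r => radial_part ct cs P Q r / Gr r) (rad x)))).
    apply: eq_bigr => a _.
    have cst (t : R) : differentiable (fun _ : 'rV[R]_5 => t) x by exact: differentiable_cst.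
    have dvG b k := differentiableM_fun (cst (v k)) (dGm a k b Ux).
    have dvS b := differentiable_sum_fun (index_enum 'I_5) xpredT (dvG b).
    transitivity (partial a (fun y => \sum_b u b * (\sum_k v k * Gam a k b y)) x).
      rewrite partial_sum => [|b]; last exact: (differentiableM_fun (cst (u b)) (dvS b)).
      apply: eq_bigr => b _; rewrite (partialM _ (cst (u b)) (dvS b)) partial_cst mul0r add0r.
      congr (_ * _); rewrite partial_sum//; apply: eq_bigr => k _.
      by rewrite (partialM _ (cst (v k)) (dGm a k b Ux)) partial_cst mul0r add0r.
    rewrite (partial_eq_on a oU Ux (fun y Uy => cE y a Uy)).
    have ds := differentiable_coord_comp sr.
    rewrite (partialM _ (cst (- 2^-1)) (differentiableM_fun (cst (dr R a)) ds)) partial_cst mul0r add0r.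
    rewrite (partialM _ (cst (dr R a)) ds) partial_cst mul0r add0r.
    by rewrite (partial_coord_comp a sr).
  by rewrite sum5 /dr /=; ring.
have T3 : \sum_a \sum_e Gam a a e x * (\sum_b u b * (\sum_k v k * Gam e k b x))
   = - 4^-1 * tr_dr f m N (rad x) * (radial_part ct cs P Q (rad x) / Gr (rad x)).
  transitivity (\sum_a Gam a a i_rad x * (- 2^-1 * (radial_part ct cs P Q (rad x) / Gr (rad x)))).
    apply: eq_bigr => a _; rewrite (bigD1 i_rad)//= [X in _ + X]big1 => [|e er]; rewrite (cE _ _ Ux) /dr.
      by rewrite eqxx mul1r addr0.
    by rewrite (negbTE er) mul0r !mulr0.
  by rewrite -mulr_suml (sum_christoffel_trace Ux); field; rewrite grr0.
have T4 : \sum_a \sum_e (\sum_k v k * Gam a k e x) * (\sum_b u b * Gam e a b x)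
   = 4^-1 * Pair P Q Pu Qu (rad x).
  rewrite -(sum_kmx f m N w P Q Pu Qu (rad x) (s0 Ux) (c0 Ux)) mulr_sumr.
  apply: eq_bigr => a _; rewrite mulr_sumr; apply: eq_bigr => e _.
  rewrite (christoffel_killing _ _ kv Ux).
  have -> : \sum_b u b * Gam e a b x = \sum_b u b * Gam e b a x.
    by apply: eq_bigr => b _; rewrite (christoffel_sym oU gS e a b Ux).
  by rewrite (christoffel_killing _ _ ku Ux); field.
have combine A A' B C C' E E' : A = A' -> B = 0 -> C = C' -> E = E' ->
  A - B + C - E = A' + C' - E' :> R by move=> -> -> -> ->; rewrite subr0.
by rewrite (combine _ _ _ _ _ _ _ T1 T2 T3 T4); ring.
Qed.

Variables a0 ap : R -> R.
Hypotheses (sa0 : smooth_on D a0) (sap : smooth_on D ap).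
Local Notation F := (ansatz_field a0 ap).

Lemma sum_probe_field u ct cs y e : probe u ct cs -> U y ->
  \sum_b u b * F y e b = dr R e * radial_part ct cs a0 ap (rad y).
Proof.
move=> pu [Dr _].
have ur : \sum_b u b * dr R b = 0 by rewrite sum5 /dr /= (probe_rad pu); ring.
have uh : \sum_b u b * dth R b = 0 by rewrite sum5 /dth /= (probe_th pu); ring.
pose r := rad y; pose th := tht y.
transitivity (dr R e * (derive1 a0 r * (\sum_b u b * dt R b) + derive1 ap r * (\sum_b u b * sig th b))
  - (\sum_b u b * dr R b) * (derive1 a0 r * dt R e + derive1 ap r * sig th e)
  + ap r * sc2 th * (dth R e * (\sum_b u b * dchi R b) - (\sum_b u b * dth R b) * dchi R e)).
  rewrite !sum5 !(fieldE _ _ (smooth_derivable sa0 Dr) (smooth_derivable sap Dr)) /fmx -/r -/th; ring.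
by rewrite ur uh (probe_dt pu) (probe_sig pu) (probe_dchi pu) /radial_part -/r; ring.
Qed.

(** Minus the wave operator applied to the radial coordinate. *)
Lemma sum_ginv_christoffel_rad x : U x ->
  \sum_c \sum_a ginv g x c a * Gam i_rad c a x
  = (derive1 (Gr) (rad x) / Gr (rad x) - 2^-1 * tr_dr f m N (rad x)) / Gr (rad x).
Proof.
move=> Ux; have [Dr _] := Ux; pose r := rad x; pose th := tht x.
have chr c a : Gam i_rad c a x = 2^-1 * ((Gr r)^-1 *
   (2 * (dr R c * dr R a) * derive1 (Gr) r - Dg r th c a)).
  rewrite /christoffel; congr (_ * _); rewrite (bigD1 i_rad)//= big1 => [|d dr0]; last first.
    by rewrite (ginvE w pos _ _ Ux) /hmx /dt /dr /dth /xi /evec /dphi /dpsi (negbTE dr0) /=; ring.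
  rewrite addr0 (ginvE w pos _ _ Ux) !pG//; congr (_ * _).
    by rewrite /hmx /dt /dr /dth /xi /evec /dphi /dpsi /=; ring.
  have drr : dr R i_rad = 1 by [].
  have dtr : dt R i_rad = 0 by [].
  have dthr : dth R i_rad = 0 by [].
  have dchr : dchi R i_rad = 0 by rewrite /dchi /dphi /dpsi subrr.
  have sigr : sig th i_rad = 0 by rewrite /sig /dphi /dpsi /=; ring.
  have gr l : Dg r th i_rad l = derive1 (Gr) r * dr R l.
    by rewrite /gmx_dr drr dtr dthr dchr sigr; ring.
  have gh l : gmx_dth f m N w r th i_rad l = 0.
    by rewrite /gmx_dth dtr dchr sigr; ring.
  by rewrite -/r -/th !gr !gh drr dthr; ring.
transitivity (2^-1 * (Gr r)^-1 * (2 * derive1 (Gr) r *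
    (\sum_c \sum_a hmx' r th c a * (dr R c * dr R a))
   - \sum_c \sum_a hmx' r th c a * Dg r th c a)).
  rewrite [X in _ * (X - _)]mulr_sumr -sumrB mulr_sumr; apply: eq_bigr => c _.
  rewrite mulr_sumr -sumrB mulr_sumr; apply: eq_bigr => a _.
  by rewrite (ginvE w pos _ _ Ux) chr -/r -/th; ring.
rewrite (trE Ux).
have -> : \sum_c \sum_a hmx' r th c a * (dr R c * dr R a) = (Gr r)^-1.
  by rewrite !sum5 /hmx /dt /dr /dth /xi /evec /dphi /dpsi /=; ring.
by rewrite -/r; field; rewrite grr0.
Qed.

(** With the free index contracted with a Killing vector, Gamma^e_{cb} u^b is again half a field
    strength, and its product with [F] is a pairing. *)
Lemma maxwell_killing u ct cs Pu Qu x : U x -> probe u ct cs -> killing_pair u Pu Qu ->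
  \sum_b u b * (\sum_c \sum_a ginv g x c a * cov_deriv2 g F c a b x)
  = derive1 (radial_part ct cs a0 ap) (rad x) / Gr (rad x)
    - radial_part ct cs a0 ap (rad x)
      * ((derive1 (Gr) (rad x) / Gr (rad x) - 2^-1 * tr_dr f m N (rad x)) / Gr (rad x))
    + 2^-1 * Pair a0 ap Pu Qu (rad x).
Proof.
move=> Ux pu ku; have [Dr _] := Ux.
rewrite /cov_deriv2 (maxwell_contraction u (fun c a b => partial c (fun y => F y a b) x)
  (fun a b c => Gam a b c x) (fun c a => ginv g x c a) (fun a b => F x a b)).
have T1 : \sum_c \sum_a ginv g x c a * (\sum_b u b * partial c (fun y => F y a b) x)
   = derive1 (radial_part ct cs a0 ap) (rad x) / Gr (rad x).
  have sr := smooth_derivable (smooth_radial_part (ct := ct) (cs := cs) sa0 sap) Dr.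
  have dF a b : differentiable (fun y => F y a b) x.
    have d0 := smooth_derivable (smooth_on_derive1 sa0) Dr.
    have dp := smooth_derivable (smooth_on_derive1 sap) Dr.
    have [csin ccos _] := cdiff_angular oD 0 i_t.
    have cc (t : R) : cdiff 0 U (fun=> t) := cdiff_cst 0 U t.
    have csig l : cdiff 0 U (fun y => sig (tht y) l) by have [] := cdiff_angular oD 0 l.
    have crad p : smooth_on D p -> cdiff 0 U (fun y => p (rad y)) := @cdiff_radial R 0 D p oD.
    have form l : cdiff 0 U (fun y => derive1 a0 (rad y) * dt R l + derive1 ap (rad y) * sig (tht y) l) :=
      cdiffD oU (cdiffM oU (crad _ (smooth_on_derive1 sa0)) (cc _)) (cdiffM oU (crad _ (smooth_on_derive1 sap)) (csig l)).
    have csc : cdiff 0 U (fun y => ap (rad y) * sc2 (tht y)) :=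
      cdiffM oU (crad _ sap) (cdiffM oU (cdiffM oU (cc 2) csin) ccos).
    have cF : cdiff 0 U (fun y => fmx a0 ap (rad y) (tht y) a b) :=
      cdiffD oU (cdiffB oU (cdiffM oU (cc _) (form b)) (cdiffM oU (cc _) (form a))) (cdiffM oU csc (cc _)).
    apply: (differentiable_near_eq oU Ux _ (cdiff_differentiable cF Ux)) => y [Dy _].
    by rewrite (fieldE _ _ (smooth_derivable sa0 Dy) (smooth_derivable sap Dy)).
  have pF c a : \sum_b u b * partial c (fun y => F y a b) x
     = dr R a * (dr R c * derive1 (radial_part ct cs a0 ap) (rad x)).
    have cst (t : R) : differentiable (fun _ : 'rV[R]_5 => t) x by exact: differentiable_cst.
    transitivity (partial c (fun y => \sum_b u b * F y a b) x).
      rewrite partial_sum => [|b]; last exact: (differentiableM_fun (cst (u b)) (dF a b)).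
      by apply: eq_bigr => b _; rewrite (partialM _ (cst (u b)) (dF a b)) partial_cst mul0r add0r.
    rewrite (partial_eq_on c oU Ux (fun y Uy => sum_probe_field a pu Uy)).
    rewrite (partialM _ (cst (dr R a)) (differentiable_coord_comp sr)) partial_cst mul0r add0r.
    by rewrite (partial_coord_comp c sr).
  transitivity (\sum_c \sum_a hmx' (rad x) (tht x) c a * (dr R a * (dr R c * derive1 (radial_part ct cs a0 ap) (rad x)))).
    by apply: eq_bigr => c _; apply: eq_bigr => a _; rewrite pF (ginvE w pos _ _ Ux).
  by rewrite !sum5 /hmx /dt /dr /dth /xi /evec /dphi /dpsi /=; ring.
have T2 : \sum_c \sum_a ginv g x c a * (\sum_e Gam e c a x * (\sum_b u b * F x e b))
  = radial_part ct cs a0 ap (rad x)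
      * ((derive1 (Gr) (rad x) / Gr (rad x) - 2^-1 * tr_dr f m N (rad x)) / Gr (rad x)).
  rewrite -(sum_ginv_christoffel_rad Ux) mulr_sumr; apply: eq_bigr => c _.
  rewrite mulr_sumr; apply: eq_bigr => a _.
  rewrite (bigD1 i_rad)//= [X in _ + X]big1 => [|e er]; rewrite (sum_probe_field _ pu Ux) /dr.
    by rewrite eqxx mul1r addr0; ring.
  by rewrite (negbTE er) mul0r mulr0.
have T3 : \sum_c \sum_a ginv g x c a * (\sum_e (\sum_b u b * Gam e c b x) * F x a e)
   = - 2^-1 * Pair a0 ap Pu Qu (rad x).
  rewrite -(sum_kmx f m N w a0 ap Pu Qu (rad x) (s0 Ux) (c0 Ux)) mulr_sumr.
  apply: eq_bigr => c _.
  transitivity (\sum_e (\sum_a ginv g x c a * F x a e) * (\sum_b u b * Gam e c b x)).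
    under eq_bigr do rewrite mulr_sumr.
    rewrite exchange_big; apply: eq_bigr => e _ /=.
    by rewrite mulr_suml; apply: eq_bigr => a _; ring.
  rewrite mulr_sumr; apply: eq_bigr => e _.
  have -> : \sum_b u b * Gam e c b x = \sum_b u b * Gam e b c x.
    by apply: eq_bigr => b _; rewrite (christoffel_sym oU gS e c b Ux).
  rewrite (christoffel_killing _ _ ku Ux) -(sum_hmx_fmx f m N w a0 ap (rad x) c e (s0 Ux) (c0 Ux)).
  have -> : \sum_a ginv g x c a * F x a e = - \sum_d hmx' (rad x) (tht x) c d * fmx a0 ap (rad x) (tht x) e d.
    rewrite -sumrN; apply: eq_bigr => a _.
    rewrite (ginvE w pos _ _ Ux) (fieldE _ _ (smooth_derivable sa0 Dr) (smooth_derivable sap Dr)) /fmx; ring.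
  by ring.
have combine A A' B B' E E' : A = A' -> B = B' -> E = E' ->
  A - B - E = A' - B' - E' :> R by move=> -> -> ->.
by rewrite (combine _ _ _ _ _ _ T1 T2 T3) mulNr opprK.
Qed.

End FieldEquations.

(** * Trace reversal of the Einstein equations *)

Section EinsteinTrace.
Variable R : realType.
Implicit Types (a b i j : 'I_5).
Variables (g F : 'rV[R]_5 -> 'M[R]_5) (x : 'rV[R]_5).
Hypotheses (gsym : forall i j, g x i j = g x j i) (gunit : g x \in unitmx).
Hypothesis einstein : forall a b, ricci g a b x - 2^-1 * scalar_curvature g x * g x a b
  = 2 * stress_energy g F x a b.

Lemma ginv_sym i j : ginv g x i j = ginv g x j i.
Proof.
have gT : (g x)^T = g x by apply/matrixP => k l; rewrite mxE gsym.
by rewrite /ginv -{1}gT -trmx_inv mxE.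
Qed.

Lemma field_normE : field_norm g F x = \sum_a \sum_b ginv g x a b * field_square g F x a b.
Proof.
rewrite /field_norm /mxtrace; under eq_bigr do rewrite mxE.
rewrite exchange_big; apply: eq_bigr => a _; apply: eq_bigr => b _ /=.
by rewrite ginv_sym.
Qed.

Lemma ginv_trace : \sum_a \sum_b ginv g x a b * g x a b = 5.
Proof.
transitivity (\tr (ginv g x *m g x)).
  rewrite /mxtrace; apply: eq_bigr => a _; rewrite mxE; apply: eq_bigr => b _.
  by rewrite gsym.
by rewrite /ginv mulVmx// mxtrace1.
Qed.

(** In dimension five the stress tensor has a trace: S - 5/2 S = 2 (1 - 5/4) F^2, so the scalar
    curvature S is one third of F^2, the field norm. *)
Lemma einstein_ricci a b :
  ricci g a b x = 2 * field_square g F x a b - 3^-1 * field_norm g F x * g x a b.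
Proof.
have se i j : stress_energy g F x i j
    = field_square g F x i j - 4^-1 * field_norm g F x * g x i j.
  by rewrite /stress_energy !mxE.
pose S := scalar_curvature g x; pose FN := field_norm g F x.
have tr : S - 5 / 2 * S = 2 * (FN - 5 / 4 * FN).
  transitivity (\sum_i \sum_j ginv g x i j * (2 * stress_energy g F x i j)).
    transitivity (S - 2^-1 * S * (\sum_i \sum_j ginv g x i j * g x i j)).
      by rewrite ginv_trace; field.
    rewrite {1}/S /scalar_curvature mulr_sumr -sumrB; apply: eq_bigr => i _.
    rewrite mulr_sumr -sumrB; apply: eq_bigr => j _.
    by rewrite -einstein -/S; ring.
  transitivity (2 * (FN - 4^-1 * FN * (\sum_i \sum_j ginv g x i j * g x i j))).
    rewrite {1}/FN field_normE mulr_sumr -sumrB mulr_sumr; apply: eq_bigr => i _.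
    rewrite mulr_sumr -sumrB mulr_sumr; apply: eq_bigr => j _.
    by rewrite se -/FN; ring.
  by rewrite ginv_trace; field.
have SE : S = 3^-1 * FN by lra.
have := einstein a b; rewrite se -/S -/FN SE; lra.
Qed.

End EinsteinTrace.

Section ReducedEquations.
Variable R : realType.
Implicit Types (x : 'rV[R]_5) (a b c d e i j : 'I_5).
Variables (D : set R) (f m N w a0 ap : R -> R).
Hypotheses (oD : open D) (sf : smooth_on D f) (sm : smooth_on D m) (sN : smooth_on D N)
  (sw : smooth_on D w) (sa0 : smooth_on D a0) (sap : smooth_on D ap)
  (pos : forall r, D r -> [/\ 0 < f r, 0 < m r & 0 < N r]).
Local Notation U := (chart_region D).
Local Notation g := (ansatz_metric f m N w).
Local Notation F := (ansatz_field a0 ap).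
Local Notation rad x := (x 0 i_rad).
Local Notation tht x := (x 0 i_th).
Local Notation pairing := (pairing f m N w).
Local Notation grr' := (grr f m N).
Hypothesis em : einstein_maxwell U g F.

Let s0 x (Ux : U x) : sin (tht x) != 0. Proof. by rewrite gt_eqF// (chart_sin_gt0 Ux). Qed.
Let c0 x (Ux : U x) : cos (tht x) != 0. Proof. by rewrite gt_eqF// (chart_cos_gt0 Ux). Qed.

(** A contracted field has only a radial component, so the inverse metric enters through g^{RR}
    alone. *)
Lemma field_square_probe u ct cs v ct' cs' x : U x -> probe u ct cs -> probe v ct' cs' ->
  \sum_b u b * (\sum_k v k * field_square g F x b k)
  = radial_part ct cs a0 ap (rad x) * radial_part ct' cs' a0 ap (rad x) / grr' (rad x).
Proof.
move=> Ux pu pv; have [Dr _] := Ux.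
have anti b e : F x b e = - F x e b.
  by rewrite !(fieldE _ _ (smooth_derivable sa0 Dr) (smooth_derivable sap Dr)) /fmx; ring.
have su z ct1 cs1 e : probe z ct1 cs1 -> \sum_b z b * F x b e = - (dr R e * radial_part ct1 cs1 a0 ap (rad x)).
  move=> pz; rewrite -(sum_probe_field sa0 sap e pz Ux) -sumrN; apply: eq_bigr => b _.
  by rewrite anti mulrN.
transitivity (\sum_e \sum_d (\sum_b u b * F x b e) * ginv g x e d * (\sum_k v k * F x k d)).
  transitivity (\sum_b \sum_k \sum_e \sum_d u b * v k * (F x b e * ginv g x e d * F x k d)).
    apply: eq_bigr => b _; rewrite mulr_sumr; apply: eq_bigr => k _.
    rewrite mulrA /field_square mxE mulr_sumr exchange_big /=; apply: eq_bigr => d _.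
    by rewrite !mxE mulr_suml mulr_sumr; apply: eq_bigr => e _.
  transitivity (\sum_b \sum_e \sum_d \sum_k u b * v k * (F x b e * ginv g x e d * F x k d)).
    apply: eq_bigr => b _; rewrite exchange_big; apply: eq_bigr => e _ /=.
    by rewrite exchange_big.
  rewrite exchange_big; apply: eq_bigr => e _ /=.
  rewrite exchange_big; apply: eq_bigr => d _ /=.
  rewrite !mulr_suml; apply: eq_bigr => b _.
  by rewrite mulr_sumr; apply: eq_bigr => k _; ring.
transitivity (\sum_e \sum_d (dr R e * radial_part ct cs a0 ap (rad x)) * ginv g x e d * (dr R d * radial_part ct' cs' a0 ap (rad x))).
  apply: eq_bigr => e _; apply: eq_bigr => d _.
  by rewrite (su u ct cs e pu) (su v ct' cs' d pv); ring.
rewrite !sum5 /dr /= !(ginvE w pos _ _ Ux) /hmx /dt /dr /dth /xi /evec /dphi /dpsi /=; ring.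
Qed.

Lemma field_norm_pairing x : U x -> field_norm g F x = - pairing a0 ap a0 ap (rad x).
Proof.
move=> Ux; have [Dr _] := Ux.
rewrite -(sum_kmx f m N w a0 ap a0 ap (rad x) (s0 Ux) (c0 Ux)) -sumrN.
rewrite /field_norm /mxtrace; apply: eq_bigr => a _.
have FE i j := fieldE i j (smooth_derivable sa0 Dr) (smooth_derivable sap Dr).
have -> : (ginv g x *m field_square g F x) a a
   = \sum_c (ginv g x *m F x) a c * (ginv g x *m (F x)^T) c a.
  by rewrite /field_square !mulmxA -mulmxA mxE.
rewrite -sumrN; apply: eq_bigr => c _.
rewrite -!(sum_hmx_fmx f m N w a0 ap (rad x) _ _ (s0 Ux) (c0 Ux)) -mulNr; congr (_ * _).
  rewrite mxE -sumrN; apply: eq_bigr => b _.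
  by rewrite (ginvE w pos _ _ Ux) FE /fmx; ring.
by rewrite mxE; apply: eq_bigr => b _; rewrite mxE (ginvE w pos _ _ Ux) FE.
Qed.

Lemma killing_dotE u ct cs v P Q x : U x -> probe u ct cs -> killing_pair D f m N w v P Q ->
  \sum_b u b * (\sum_k v k * g x b k) = ct * P (rad x) + cs * Q (rad x).
Proof.
move=> Ux pu kv.
transitivity (\sum_b u b * (P (rad x) * dt R b + Q (rad x) * sig (tht x) b)).
  apply: eq_bigr => b _; rewrite -(killing_low kv); congr (_ * _).
  by apply: eq_bigr => k _; rewrite (metricE w pos _ _ Ux).
rewrite -(probe_dt pu) -(probe_sig pu (tht x)) !mulr_suml -big_split.
by apply: eq_bigr => b _ /=; ring.
Qed.

(* Both the Maxwell and the Einstein equations reduce to the same radial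
   operator, applied to the potential and to the lowered Killing vectors. *)
Definition radial_operator ct cs P Q Pu Qu r : R :=
  derive1 (radial_part ct cs P Q) r + radial_part ct cs P Q r * (derive1 N r / N r)
  + 2^-1 * grr' r * pairing P Q Pu Qu r.

(** The left side is half the logarithmic derivative of G / (f B A^2), a quotient that equals 1 / (4
    N^2) for the ansatz. *)
Lemma derive1_grr r : D r ->
  derive1 grr' r / grr' r - 2^-1 * tr_dr f m N r = - (derive1 N r / N r).
Proof.
move=> Dr; have [f0 m0 N0] := pos Dr.
have df := smooth_derivable sf Dr; have dm := smooth_derivable sm Dr.
have dN := smooth_derivable sN Dr.
have fn : f r != 0 by rewrite gt_eqF. have mn : m r != 0 by rewrite gt_eqF.
have Nn : N r != 0 by rewrite gt_eqF.
have dVf := derivableV1 fn df; have dVm := derivableV1 mn dm; have dVN := derivableV1 Nn dN.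
have bE : derive1 (bb m N) r = derive1 N r / m r - N r * derive1 m r / m r ^+ 2.
  by rewrite /bb (derive1M dN dVm) (derive1V mn dm); ring.
have aE : derive1 (aa f m) r = derive1 m r / f r - m r * derive1 f r / f r ^+ 2.
  by rewrite /aa (derive1M dm dVf) (derive1V fn df); ring.
have gE : derive1 grr' r = 4^-1 * (derive1 m r / (f r * N r) - m r * derive1 f r / (f r ^+ 2 * N r)
    - m r * derive1 N r / (f r * N r ^+ 2)).
  transitivity (derive1 (fun t => 4^-1 * (m t * ((f t)^-1 * (N t)^-1))) r).
    by congr (derive1 _ r); apply/funext => t; rewrite /grr -mulrA !invfM; ring.
  rewrite (derive1M (derivable_cst (4^-1 : R) r 1) (derivableM1 dm (derivableM1 dVf dVN))) derive1_cst.
  rewrite (derive1M dm (derivableM1 dVf dVN)) (derive1M dVf dVN) (derive1V fn df) (derive1V Nn dN).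
  rewrite /=; field.
  by rewrite fn Nn.
rewrite /tr_dr bE aE gE /grr /bb /aa; field.
by rewrite fn mn Nn.
Qed.

Lemma reduced_maxwell u ct cs Pu Qu r : D r -> probe u ct cs -> killing_pair D f m N w u Pu Qu ->
  radial_operator ct cs a0 ap Pu Qu r = 0.
Proof.
move=> Dr pu ku; have [x Ux <-] := chart_region_halfway Dr.
have := maxwell_killing oD sf sm sN sw pos sa0 sap Ux pu ku.
rewrite big1 => [|b _]; last by rewrite (em.1 x Ux b) mulr0.
have [Drx _] := Ux.
rewrite (derive1_grr Drx) => h.
have g0 : grr' (rad x) != 0 by rewrite gt_eqF// (grr_gt0 pos Drx).
rewrite -[RHS](mulr0 (grr' (rad x))) h /radial_operator; field.
by rewrite g0 (N_neq0 pos Drx).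
Qed.

Lemma reduced_einstein u ct cs v ct' cs' P Q Pu Qu r : D r ->
  probe u ct cs -> probe v ct' cs' ->
  killing_pair D f m N w v P Q -> killing_pair D f m N w u Pu Qu ->
  radial_operator ct cs P Q Pu Qu r
  = - 4 * radial_part ct cs a0 ap r * radial_part ct' cs' a0 ap r
    - 2 / 3 * grr' r * pairing a0 ap a0 ap r * (ct * P r + cs * Q r).
Proof.
move=> Dr pu pv kv ku; have [x Ux <-] := chart_region_halfway Dr; have [Drx _] := Ux.
have gS i j := ansatz_metric_sym w pos i j Ux.
have gu := metric_unit w pos Ux.
have [sP sQ] := killing_smooth kv.
have := ricci_killing oD sf sm sN sw pos Ux pu kv ku.
have -> : \sum_b u b * (\sum_k v k * ricci g b k x)
  = 2 * (\sum_b u b * (\sum_k v k * field_square g F x b k))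
    - 3^-1 * field_norm g F x * (\sum_b u b * (\sum_k v k * g x b k)).
  rewrite [2 * _]mulr_sumr [_ * field_norm _ _ _ * _]mulr_sumr -sumrB; apply: eq_bigr => b _.
  transitivity (u b * (2 * (\sum_k v k * field_square g F x b k)
    - 3^-1 * field_norm g F x * (\sum_k v k * g x b k))); last by ring.
  congr (_ * _); rewrite [2 * _]mulr_sumr [_ * field_norm _ _ _ * _]mulr_sumr -sumrB.
  by apply: eq_bigr => k _; rewrite (einstein_ricci gS gu (em.2 x Ux)); ring.
rewrite (field_square_probe Ux pu pv) (field_norm_pairing Ux) (killing_dotE Ux pu kv).
have g0 : grr' (rad x) != 0 by rewrite gt_eqF// (grr_gt0 pos Drx).
have dr_ := smooth_derivable (smooth_radial_part oD (ct := ct) (cs := cs) sP sQ) Drx.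
have dg := smooth_derivable (smooth_grr oD sf sm sN pos) Drx.
rewrite (derive1M dr_ (derivableV1 g0 dg)) (derive1V g0 dg) /radial_operator.
have := derive1_grr Drx.
move=> /(canRL (subrK _)) dE h.
have -> : derive1 N (rad x) / N (rad x) = 2^-1 * tr_dr f m N (rad x) - derive1 grr' (rad x) / grr' (rad x).
  by rewrite dE; ring.
move: h; move: (derive1 (radial_part _ _ _ _) _) (radial_part ct cs P Q _) (derive1 grr' _) (tr_dr _ _ _ _).
move: (radial_part ct cs a0 ap _) (radial_part ct' cs' a0 ap _) (pairing P Q Pu Qu _) (pairing a0 ap a0 ap _) => A B Y Z p' p g' L h.
move: (grr' (rad x)) g0 h => G g0 h.
(* The radial operator is - 2 G times the contracted Ricci tensor, where G is g_RR. *)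
have -> : p' + p * (2^-1 * L - g' / G) + 2^-1 * G * Y
   = - 2 * G * (- 2^-1 * (p' * G^-1 + p * (- g' / G ^+ 2)) - 4^-1 * L * (p / G) - 4^-1 * Y).
  by field.
by rewrite -h; field.
Qed.

End ReducedEquations.

(** * The five ordinary differential equations *)

Section RadialEquations.
Variable R : realType.
Variables (D : set R) (f m N w a0 ap : R -> R).
Hypotheses (oD : open D) (sf : smooth_on D f) (sm : smooth_on D m) (sN : smooth_on D N)
  (sw : smooth_on D w) (sa0 : smooth_on D a0) (sap : smooth_on D ap)
  (pos : forall r, D r -> [/\ 0 < f r, 0 < m r & 0 < N r])
  (em : einstein_maxwell (chart_region D) (ansatz_metric f m N w) (ansatz_field a0 ap)).
Local Notation d1 h := (derive1 h).
Local Notation d2 h := (derive1 (derive1 h)).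
Local Notation B := (bb m N).
Local Notation gtt' := (gtt f m N w).
Local Notation gts' := (gts m N w).

Let sB : smooth_on D B := smooth_bb oD sm sN pos.

Let dd (h : R -> R) r : smooth_on D h -> D r -> derivable (d1 h) r 1.
Proof. by move=> sh; exact: (smooth_derivable (smooth_on_derive1 sh)). Qed.

Lemma derive1_bb r : D r -> m r * d1 B r = d1 N r - d1 m r * B r.
Proof.
move=> Dr; have dm := smooth_derivable sm Dr; have dB := smooth_derivable sB Dr.
(* Differentiating N = m B avoids the quotient rule. *)
have -> : d1 N r = d1 (fun t => m t * B t) r.
  by apply: (derive1_eq_on oD Dr) => t Dt; rewrite /bb; field; rewrite (m_neq0 pos Dt).
by rewrite (derive1M dm dB); ring.
Qed.

Lemma derive2_bb r : D r -> m r * d2 B r = d2 N r - d2 m r * B r - 2 * d1 m r * d1 B r.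
Proof.
move=> Dr; have dm := smooth_derivable sm Dr; have dB := smooth_derivable sB Dr.
have -> : d2 N r = d1 (fun t => m t * d1 B t + d1 m t * B t) r.
  by apply: (derive1_eq_on oD Dr) => t Dt; rewrite derive1_bb//; ring.
rewrite (derive1D (derivableM1 dm (dd sB Dr)) (derivableM1 (dd sm Dr) dB)).
rewrite (derive1M dm (dd sB Dr)) (derive1M (dd sm Dr) dB).
by move: (d2 B r) (d2 m r) (d1 B r) (d1 m r) (B r) (m r) => *; ring.
Qed.

Let derive1N1 (h : R -> R) r : derivable h r 1 -> d1 (fun t => - h t) r = - d1 h r.
Proof. by move=> dh; rewrite !derive1E -deriveN. Qed.

Lemma derive1_gts r : D r -> d1 gts' r = - (d1 B r * w r + B r * d1 w r).
Proof.
move=> Dr; have dw := smooth_derivable sw Dr; have dB := smooth_derivable sB Dr.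
by rewrite /gts (derive1N1 (derivableM1 dB dw)) (derive1M dB dw).
Qed.

Lemma derive2_gts r : D r ->
  d2 gts' r = - (d2 B r * w r + 2 * (d1 B r * d1 w r) + B r * d2 w r).
Proof.
move=> Dr; have dw := smooth_derivable sw Dr; have dB := smooth_derivable sB Dr.
have := dd sw Dr; have := dd sB Dr => dB1 dw1.
rewrite (derive1_eq_on oD Dr derive1_gts).
rewrite (derive1N1 (derivableD1 (derivableM1 dB1 dw) (derivableM1 dB dw1))).
rewrite (derive1D (derivableM1 dB1 dw) (derivableM1 dB dw1)) (derive1M dB1 dw) (derive1M dB dw1).
move: (d2 B r) (d2 w r) (d1 B r) (d1 w r) (B r) (w r) => *; ring.
Qed.

Lemma gttE t : gtt' t = - (f t + gts' t * w t).
Proof. by rewrite /gtt /gts; ring. Qed.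

Lemma derive1_gtt r : D r -> d1 gtt' r = - (d1 f r + (d1 gts' r * w r + gts' r * d1 w r)).
Proof.
move=> Dr; have dw := smooth_derivable sw Dr; have df := smooth_derivable sf Dr.
have dg := smooth_derivable (smooth_gts oD sm sN sw pos) Dr.
rewrite (derive1_eq_on oD Dr (fun t _ => gttE t)).
rewrite (derive1N1 (derivableD1 df (derivableM1 dg dw))).
by rewrite (derive1D df (derivableM1 dg dw)) (derive1M dg dw).
Qed.

Lemma derive2_gtt r : D r -> d2 gtt' r
  = - (d2 f r + (d2 gts' r * w r + 2 * (d1 gts' r * d1 w r) + gts' r * d2 w r)).
Proof.
move=> Dr; have dw := smooth_derivable sw Dr; have df := dd sf Dr.
have sg := smooth_gts oD sm sN sw pos.
have dg := smooth_derivable sg Dr.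
have dg1 := dd sg Dr; have dw1 := dd sw Dr.
rewrite (derive1_eq_on oD Dr derive1_gtt).
have e := derivableD1 (derivableM1 dg1 dw) (derivableM1 dg dw1).
rewrite (derive1N1 (derivableD1 df e)) (derive1D df e).
rewrite (derive1D (derivableM1 dg1 dw) (derivableM1 dg dw1)) (derive1M dg1 dw) (derive1M dg dw1).
move: (d2 f r) (d2 gts' r) (d2 w r) (d1 gts' r) (d1 w r) (gts' r) (w r) => *; ring.
Qed.

Lemma derive1_radial_part ct cs P Q r : smooth_on D P -> smooth_on D Q -> D r ->
  d1 (radial_part ct cs P Q) r = ct * d2 P r + cs * d2 Q r.
Proof.
move=> sP sQ Dr; have cst (t : R) : derivable (fun=> t) r 1 by exact: derivable_cst.
have dP := dd sP Dr; have dQ := dd sQ Dr.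
rewrite /radial_part (derive1D (derivableM1 (cst ct) dP) (derivableM1 (cst cs) dQ)).
rewrite (derive1M (cst ct) dP) (derive1M (cst cs) dQ).
rewrite (derive1_cst ct) (derive1_cst cs) /=.
by move: (d2 P r) (d2 Q r) (d1 P r) (d1 Q r) => *; ring.
Qed.

Lemma radial_operatorE ct cs P Q Pu Qu r : smooth_on D P -> smooth_on D Q -> D r ->
  radial_operator f m N w ct cs P Q Pu Qu r
  = ct * d2 P r + cs * d2 Q r + (ct * d1 P r + cs * d1 Q r) * (d1 N r / N r)
    + (d1 P r + w r * d1 Q r) * (d1 Pu r + w r * d1 Qu r) / f r
    - d1 Q r * d1 Qu r / B r - Q r * Qu r * f r / (m r * N r).
Proof.
move=> sP sQ Dr; rewrite /radial_operator (derive1_radial_part _ _ sP sQ Dr) /radial_part.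
have f0 := f_neq0 pos Dr; have m0 := m_neq0 pos Dr; have N0 := N_neq0 pos Dr.
rewrite /pairing /grr /aa /bb.
move: (d2 P r) (d2 Q r) (d1 N r) (d1 Pu r) (d1 Qu r) (d1 P r) (d1 Q r) (Q r) (Qu r) (w r) => *.
move: (f r) (m r) (N r) f0 m0 N0 => F M NN f0 m0 N0; field.
by rewrite f0 m0 N0.
Qed.

Definition efield' r : R := d2 a0 r + d1 w r * d1 ap r + w r * d2 ap r.
Local Notation X := (efield w a0 ap).
Local Notation X' := efield'.

(** The equations are taken along xi and along d_t + w xi, the vector dual to dt in the orthogonal
    frame. Then w enters only through its derivatives and through the electric component X and its
    derivative X'. Denominators are cleared for the expansion at infinity. *)
Lemma radial_equations r : D r ->
  [/\ (d1 N r * X r + N r * X' r) * f r = N r * X r * d1 f r,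
   m r ^+ 2 * f r * d2 ap r + m r * d1 m r * f r * d1 ap r
     = N r * m r * X r * d1 w r + ap r * f r ^+ 2,
   2 * d1 N r * d1 w r * m r * f r + N r * d2 w r * m r * f r
     = N r * d1 w r * (d1 m r * f r + m r * d1 f r) + 4 * d1 ap r * X r * m r ^+ 2 * f r,
   3 * m r * (d1 N r * d1 f r * f r + N r * d2 f r * f r - N r * d1 f r ^+ 2)
     = 3 * N r ^+ 2 * d1 w r ^+ 2 * f r + 8 * N r * X r ^+ 2 * f r * m r
       + 4 * m r ^+ 2 * f r ^+ 2 * d1 ap r ^+ 2 + 4 * ap r ^+ 2 * f r ^+ 3 &
   3 * f r * (d1 N r * d1 m r * m r + N r * d2 m r * m r - N r * d1 m r ^+ 2)
     = 3 * d2 N r * m r ^+ 2 * f r + 3 * N r ^+ 2 * d1 w r ^+ 2 * m r - 3 * N r * f r ^+ 2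
       + 8 * m r ^+ 3 * f r * d1 ap r ^+ 2 + 4 * N r * X r ^+ 2 * m r ^+ 2
       - 4 * ap r ^+ 2 * f r ^+ 2 * m r].
Proof.
move=> Dr.
have f0 := f_neq0 pos Dr; have m0 := m_neq0 pos Dr; have N0 := N_neq0 pos Dr.
have kt := killing_dt oD sf sm sN sw pos; have kx := killing_xi oD sm sN sw pos.
have pt := probe_of_dt R; have px := probe_of_xi R.
have st := smooth_gtt oD sf sm sN sw pos; have ss := smooth_gts oD sm sN sw pos.
have mt := reduced_maxwell oD sf sm sN sw sa0 sap pos em Dr pt kt.
have mx := reduced_maxwell oD sf sm sN sw sa0 sap pos em Dr px kx.
have ett := reduced_einstein oD sf sm sN sw sa0 sap pos em Dr pt pt kt kt.
have etx := reduced_einstein oD sf sm sN sw sa0 sap pos em Dr pt px kx kt.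
have ext := reduced_einstein oD sf sm sN sw sa0 sap pos em Dr px pt kt kx.
have exx := reduced_einstein oD sf sm sN sw sa0 sap pos em Dr px px kx kx.
rewrite (radial_operatorE _ _ _ _ sa0 sap Dr) in mt.
rewrite (radial_operatorE _ _ _ _ sa0 sap Dr) in mx.
rewrite (radial_operatorE _ _ _ _ st ss Dr) in ett.
rewrite (radial_operatorE _ _ _ _ ss sB Dr) in etx.
rewrite (radial_operatorE _ _ _ _ st ss Dr) in ext.
rewrite (radial_operatorE _ _ _ _ ss sB Dr) in exx.
have B1 : d1 B r = d1 N r / m r - d1 m r * N r / m r ^+ 2.
  apply: (mulfI m0); rewrite derive1_bb// /bb.
  by move: (d1 N r) (d1 m r) (N r) (m r) m0 => *; field.
have B2 : d2 B r = d2 N r / m r - d2 m r * N r / m r ^+ 2 - 2 * d1 m r * d1 N r / m r ^+ 2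
   + 2 * d1 m r ^+ 2 * N r / m r ^+ 3.
  apply: (mulfI m0); rewrite derive2_bb// B1 /bb.
  by move: (d2 N r) (d2 m r) (d1 N r) (d1 m r) (N r) (m r) m0 => *; field.
move: mt mx ett etx ext exx; rewrite !derive2_gtt// !derive2_gts// !derive1_gtt// !derive1_gts//.
rewrite B1 B2 /radial_part /pairing /efield /efield' /gtt /gts /grr /aa /bb.
move: (d2 f r) (d2 m r) (d2 N r) (d2 w r) (d2 a0 r) (d2 ap r) => f2 m2 N2 w2 e2 p2.
move: (d1 f r) (d1 m r) (d1 N r) (d1 w r) (d1 a0 r) (d1 ap r) => f1 m1 N1 w1 e1 p1.
move: (f r) (m r) (N r) (w r) (ap r) f0 m0 N0 => F M NN W p F0 M0 NN0.
have fld (a b : R) : a - b = 0 -> a = b by move/eqP; rewrite subr_eq0 => /eqP.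
move=> mt mx ett etx ext exx; split; apply: fld.
- lazymatch type of mt with ?L = _ => lazymatch type of mx with ?L' = _ =>
    transitivity (NN * F * (L + W * L')) end end; last by rewrite mt mx; ring.
  by field; rewrite F0 M0 NN0.
- lazymatch type of mx with ?L' = _ =>
    transitivity (M ^+ 2 * F * L') end; last by rewrite mx; ring.
  by field; rewrite F0 M0 NN0.
- lazymatch type of etx with ?L = ?L' => lazymatch type of exx with ?K = ?K' =>
    transitivity (- M ^+ 2 * F * ((L - L') + W * (K - K'))) end end; last by rewrite etx exx; ring.
  by field; rewrite F0 M0 NN0.
(* Both slots of the Einstein equation are filled with d_t + w xi; the prefactor clears
   denominators. *)
- lazymatch type of ett with ?L = ?L' => lazymatch type of exx with ?K = ?K' =>
  lazymatch type of etx with ?G = ?G' => lazymatch type of ext with ?H = ?H' =>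
    transitivity (- 3 * M * F * NN * ((L - L') + W * (G - G') + W * (H - H') + W ^+ 2 * (K - K')))
  end end end end; last by rewrite ett etx ext exx; ring.
  by field; rewrite F0 M0 NN0.
- lazymatch type of exx with ?K = ?K' =>
    transitivity (- 3 * F * M ^+ 3 * (K - K')) end; last by rewrite exx; ring.
  by field; rewrite F0 M0 NN0.
Qed.

End RadialEquations.

(** * Expansions at infinity *)

Section Series.
Variable R : realType.
Implicit Types (h : R -> R) (t s : R * R * R * R) (u : R).

Lemma normD4_le (a b c d a' b' c' d' : R) :
  `|a| <= a' -> `|b| <= b' -> `|c| <= c' -> `|d| <= d' -> `|a + b + c + d| <= a' + b' + c' + d'.
Proof.
move=> ha hb hc hd.
apply: (le_trans (ler_normD _ _)); apply: lerD hd.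
apply: (le_trans (ler_normD _ _)); apply: lerD hc.
by apply: (le_trans (ler_normD _ _)); apply: lerD hb.
Qed.

Definition ev t u : R := t.1.1.1 + t.1.1.2 * u + t.1.2 * u ^+ 2 + t.2 * u ^+ 3.

(** The tuple holds the coefficients of 1, 1/r, 1/r^2 and 1/r^3, with an error O(1/r^4). Asymptotic
    expansions thus become truncated power series with the arithmetic of [addT] and [mulT]. *)
Definition ap4 h t : Prop :=
  exists2 C : R, 0 <= C & \forall r \near +oo, `|h r - ev t r^-1| <= C * r^-1 ^+ 4.

Lemma near_inv01 : \forall r \near (+oo : set_system R), 0 < r /\ 0 < r^-1 <= 1.
Proof.
near=> r; have r1 : 1 <= r by near: r; exact: nbhs_pinfty_ge.
have r0 : 0 < r by exact: lt_le_trans r1.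
by split=> //; rewrite invr_gt0 r0 invf_le1.
Unshelve. all: by end_near.
Qed.

Definition sum_abs t : R := `|t.1.1.1| + `|t.1.1.2| + `|t.1.2| + `|t.2|.

Lemma ev_le t u : 0 < u <= 1 -> `|ev t u| <= sum_abs t.
Proof.
case/andP=> u0 u1; rewrite /ev /sum_abs.
have un n : `|u ^+ n| <= 1 by rewrite ger0_norm ?exprn_ge0 ?exprn_ile1// ltW.
apply: normD4_le.
- by [].
- by rewrite normrM ler_piMr// (un 1%N).
- by rewrite normrM ler_piMr.
- by rewrite normrM ler_piMr.
Qed.

Lemma sum_abs_ge0 t : 0 <= sum_abs t.
Proof. by rewrite /sum_abs !addr_ge0. Qed.

Lemma ap4_ext h1 h2 t : (\forall r \near +oo, h1 r = h2 r) -> ap4 h1 t -> ap4 h2 t.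
Proof.
move=> e [C C0 hC]; exists C => //; near=> r.
have <- : h1 r = h2 r by near: r.
by near: r.
Unshelve. all: by end_near.
Qed.

Lemma ap4_ev t : ap4 (fun r => ev t r^-1) t.
Proof. by exists 0 => //; near=> r; rewrite subrr normr0 mul0r. Unshelve. all: by end_near. Qed.

Definition addT t s : R * R * R * R :=
  (t.1.1.1 + s.1.1.1, t.1.1.2 + s.1.1.2, t.1.2 + s.1.2, t.2 + s.2).
Definition cstT (a : R) : R * R * R * R := (a, 0, 0, 0).
Definition mulT t s : R * R * R * R :=
  (t.1.1.1 * s.1.1.1, t.1.1.1 * s.1.1.2 + t.1.1.2 * s.1.1.1,
   t.1.1.1 * s.1.2 + t.1.1.2 * s.1.1.2 + t.1.2 * s.1.1.1,
   t.1.1.1 * s.2 + t.1.1.2 * s.1.2 + t.1.2 * s.1.1.2 + t.2 * s.1.1.1).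

Lemma ap4D h1 h2 t s : ap4 h1 t -> ap4 h2 s -> ap4 (fun r => h1 r + h2 r) (addT t s).
Proof.
move=> [C C0 hC] [E E0 hE]; exists (C + E); first exact: addr_ge0.
near=> r; rewrite mulrDl.
have -> : h1 r + h2 r - ev (addT t s) r^-1 = (h1 r - ev t r^-1) + (h2 r - ev s r^-1).
  by rewrite /ev /addT /=; ring.
by apply: (le_trans (ler_normD _ _)); apply: lerD; near: r.
Unshelve. all: by end_near.
Qed.

Lemma ap4M h1 h2 t s : ap4 h1 t -> ap4 h2 s -> ap4 (fun r => h1 r * h2 r) (mulT t s).
Proof.
move=> [C C0 hC] [E E0 hE].
(* The coefficients of orders four to six in the product of the two cubic polynomials, which
   truncation moves into the error term. *)
pose S := (t.1.1.2 * s.2 + t.1.2 * s.1.2 + t.2 * s.1.1.2, t.1.2 * s.2 + t.2 * s.1.2, t.2 * s.2, 0 : R).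
exists (C * E + sum_abs t * E + sum_abs s * C + sum_abs S).
  by rewrite !addr_ge0 ?mulr_ge0 ?sum_abs_ge0.
near=> r.
have [r0 u01] : 0 < r /\ 0 < r^-1 <= 1 by near: r; exact: near_inv01.
have h1C : `|h1 r - ev t r^-1| <= C * r^-1 ^+ 4 by near: r.
have h2E : `|h2 r - ev s r^-1| <= E * r^-1 ^+ 4 by near: r.
set u := r^-1 in u01 h1C h2E *.
have /andP[u0 u1] := u01.
have u40 : 0 <= u ^+ 4 by rewrite exprn_ge0// ltW.
have u41 : u ^+ 4 <= 1 by rewrite exprn_ile1 ?(ltW u0).
have -> : h1 r * h2 r - ev (mulT t s) u = (h1 r - ev t u) * (h2 r - ev s u)
   + ev t u * (h2 r - ev s u) + ev s u * (h1 r - ev t u) + ev S u * u ^+ 4.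
  by rewrite /ev /mulT /=; ring.
have -> : (C * E + sum_abs t * E + sum_abs s * C + sum_abs S) * u ^+ 4
   = C * E * u ^+ 4 + sum_abs t * E * u ^+ 4 + sum_abs s * C * u ^+ 4 + sum_abs S * u ^+ 4 by ring.
apply: normD4_le.
- have hCE : `|h1 r - ev t u| * `|h2 r - ev s u| <= C * u ^+ 4 * (E * u ^+ 4) by rewrite ler_pM.
  rewrite normrM; apply: (le_trans hCE).
  have -> : C * u ^+ 4 * (E * u ^+ 4) = C * E * u ^+ 4 * u ^+ 4 by ring.
  by apply: ler_piMr => //; exact: (mulr_ge0 (mulr_ge0 C0 E0) u40).
- by rewrite normrM -[leRHS]mulrA; apply: ler_pM => //; exact: ev_le.
- by rewrite normrM -[leRHS]mulrA; apply: ler_pM => //; exact: ev_le.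
- by rewrite normrM (ger0_norm u40) ler_wpM2r//; exact: ev_le.
Unshelve. all: by end_near.
Qed.

Lemma ap4_cst a : ap4 (fun=> a) (cstT a).
Proof.
by apply: ap4_ext (ap4_ev (cstT a)); near=> r; rewrite /ev /=; ring.
Unshelve. all: by end_near.
Qed.

Lemma ap4_inv : ap4 (fun r => r^-1) (0, 1, 0, 0).
Proof.
by apply: ap4_ext (ap4_ev (0, 1, 0, 0)); near=> r; rewrite /ev /=; ring.
Unshelve. all: by end_near.
Qed.

Lemma eq0_of_le_inv (a K : R) : 0 <= K -> (\forall r \near +oo, `|a| <= K * r^-1) -> a = 0.
Proof.
move=> K0 h; apply/eqP; apply: contraT => a0.
have na : 0 < `|a| by rewrite normr_gt0.
near (+oo : set_system R) => r.
have : `|a| <= K * r^-1 by near: r.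
have r0 : 0 < r by near: r; exact: nbhs_pinfty_gt.
have rK : K / `|a| < r by near: r; apply: nbhs_pinfty_gt; exact: num_real.
rewrite ler_pdivlMr// leNgt => /negP[].
by rewrite mulrC -ltr_pdivrMr.
Unshelve. all: by end_near.
Qed.

(** Uniqueness of asymptotic coefficients, one order at a time: once the lower ones vanish, division
    by u^n and r -> +oo isolate the next. *)
Lemma ap4_eq0 h t : (\forall r \near +oo, h r = 0) -> ap4 h t ->
  [/\ t.1.1.1 = 0, t.1.1.2 = 0, t.1.2 = 0 & t.2 = 0].
Proof.
move=> h0 /(ap4_ext h0)[C C0 hC] {h h0}.
have {}hC : \forall r \near +oo, `|ev t r^-1| <= C * r^-1 ^+ 4.
  by near=> r; rewrite -normrN -sub0r; near: r.
have step (a : R) (v : R -> R) (K : R) (n : nat) : 0 <= K ->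
    (\forall r \near +oo, `|v r^-1| <= K) ->
    (\forall r \near +oo, `|(a + v r^-1 * r^-1) * r^-1 ^+ n| <= C * r^-1 ^+ n.+1) -> a = 0.
  move=> K0 hv ha; apply: (@eq0_of_le_inv a (C + K)); first exact: addr_ge0.
  near=> r.
  have [r0 /andP[u0 u1]] : 0 < r /\ 0 < r^-1 <= 1 by near: r; exact: near_inv01.
  have vK : `|v r^-1| <= K by near: r.
  have : `|(a + v r^-1 * r^-1) * r^-1 ^+ n| <= C * r^-1 ^+ n.+1 by near: r.
  have un : 0 < r^-1 ^+ n by rewrite exprn_gt0.
  rewrite normrM (gtr0_norm un) exprSr mulrA mulrAC ler_pM2r// => h.
  have -> : a = (a + v r^-1 * r^-1) - v r^-1 * r^-1 by ring.
  apply: (le_trans (ler_normB _ _)); rewrite mulrDl; apply: lerD => //.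
  by rewrite normrM (gtr0_norm u0) ler_pM2r.
have mono n : (n <= 4)%N -> \forall r \near +oo, C * r^-1 ^+ 4 <= C * r^-1 ^+ n :> R.
  move=> n4; near=> r.
  have [r0 /andP[u0 u1]] : 0 < r /\ 0 < r^-1 <= 1 by near: r; exact: near_inv01.
  by rewrite ler_wpM2l// ler_wiXn2l// ltW.
have bnd t' : \forall r \near +oo, `|ev t' r^-1| <= sum_abs t'.
  by near=> r; apply: ev_le; have [] : 0 < r /\ 0 < r^-1 <= 1 by near: r; exact: near_inv01.
have a0 : t.1.1.1 = 0.
  apply: (step _ (ev (t.1.1.2, t.1.2, t.2, 0)) _ 0%N (sum_abs_ge0 _) (bnd _)).
  near=> r; apply: (@le_trans _ _ (C * r^-1 ^+ 4)); last by near: r; exact: mono.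
  rewrite expr0 mulr1 (_ : _ + _ = ev t r^-1); first by near: r.
  by rewrite /ev /=; ring.
have a1 : t.1.1.2 = 0.
  apply: (step _ (ev (t.1.2, t.2, 0, 0)) _ 1%N (sum_abs_ge0 _) (bnd _)).
  near=> r; apply: (@le_trans _ _ (C * r^-1 ^+ 4)); last by near: r; exact: mono.
  rewrite (_ : _ * _ = ev t r^-1); first by near: r.
  by rewrite /ev /= a0; ring.
have a2 : t.1.2 = 0.
  apply: (step _ (ev (t.2, 0, 0, 0)) _ 2%N (sum_abs_ge0 _) (bnd _)).
  near=> r; apply: (@le_trans _ _ (C * r^-1 ^+ 4)); last by near: r; exact: mono.
  rewrite (_ : _ * _ = ev t r^-1); first by near: r.
  by rewrite /ev /= a0 a1; ring.
split=> //.
apply: (step _ (ev (0, 0, 0, 0)) _ 3%N (sum_abs_ge0 _) (bnd _)).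
near=> r; apply: (@le_trans _ _ (C * r^-1 ^+ 4)); last by near: r; exact: mono.
rewrite (_ : _ * _ = ev t r^-1); first by near: r.
by rewrite /ev /= a0 a1 a2; ring.
Unshelve. all: by end_near.
Qed.

End Series.

Section Expansion.
Variable R : realType.
Implicit Types (h : R -> R) (r : R).

Lemma is_derive_exprn n r : is_derive r 1 (fun u : R => u ^+ n.+1) (n.+1%:R * r ^+ n).
Proof.
apply: DeriveDef; first exact: exprn_derivable.
by rewrite exp_derive /GRing.scale/= mulr1.
Qed.

Lemma is_derive_exprz (z : int) r : r != 0 ->
  is_derive r 1 (fun u : R => u ^ z) (z%:~R * r ^ (z - 1)).
Proof.
move=> r0; case: z => [[|n]|n].
- by apply: is_derive_eq (is_derive_cst (1 : R) r 1) _; rewrite mul0r.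
- rewrite (_ : n.+1%:Z - 1 = n%:Z); last by rewrite -addn1 PoszD addrK.
  exact: is_derive_exprn.
- have rn : r ^+ n.+1 != 0 by rewrite expf_neq0.
  have e := is_derive_exprn n r.
  have [dX dE] := e.
  rewrite (_ : (fun u : R => u ^ Negz n) = (fun u => (u ^+ n.+1)^-1)); last by apply/funext.
  apply: DeriveDef; first exact: (@derivableV1 _ (fun u => u ^+ n.+1) r rn dX).
  rewrite -derive1E (@derive1V _ (fun u => u ^+ n.+1) r rn dX) derive1E dE.
  have -> : Negz n - 1 = Negz n.+1 by rewrite !NegzE -opprD -PoszD addn1.
  rewrite NegzE mulrNz -pmulrn.
  have -> : r ^ Negz n.+1 = (r ^+ n.+2)^-1 by [].
  rewrite !exprS; move: (r ^+ n) (expf_neq0 n r0) (n.+1%:R : R) => X X0 Y; field.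
  by rewrite r0 X0.
Qed.

Definition powsum (a : nat -> R) (z : int) r : R := \sum_(k < 4) a k * r ^ (z - k%:Z).

Lemma is_derive_powsum a z r : r != 0 ->
  is_derive r 1 (powsum a z) (powsum (fun k => (z - k%:Z)%:~R * a k) (z - 1) r).
Proof.
move=> r0.
have e (k : 'I_4) : is_derive r 1 (fun u => a k * u ^ (z - k%:Z))
   ((z - k%:Z)%:~R * a k * r ^ (z - 1 - k%:Z)).
  have := is_derive_exprz (z - k%:Z) r0 => dz.
  have [dX dE] : is_derive r 1 (fun u : R => a k * u ^ (z - k%:Z)) (a k *: ((z - k%:Z)%:~R * r ^ (z - k%:Z - 1))).
    exact: is_deriveZ.
  apply: DeriveDef => //; rewrite dE /GRing.scale/= addrAC; ring.
have [dS dSE] := is_derive_sum e.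
rewrite /powsum (_ : (fun r => _) = \sum_(k < 4) (fun u => a k * u ^ (z - k%:Z))).
  by apply: DeriveDef.
by apply/funext => u; rewrite fct_sumE.
Qed.

(** Multiplication by r^(-z) turns an expansion with leading power z into a series in 1/r. *)
Lemma ap4_of_bound (X : R -> R) (a : nat -> R) (z : int) :
  (exists C : R, \forall r \near +oo, `|X r - powsum a z r| <= C * r ^ (z - 4%:Z)) ->
  ap4 (fun r => r ^ (- z) * X r) (a 0%N, a 1%N, a 2%N, a 3%N).
Proof.
case=> C hC; exists `|C|; rewrite ?normr_ge0//; near=> r.
have r0 : 0 < r by near: r; exact: nbhs_pinfty_gt.
have rn : r != 0 by rewrite gt_eqF.
have zp k : r ^ (- z) * r ^ (z - k%:Z) = r^-1 ^+ k.
  by rewrite -expfzDr// addrA addNr add0r -exprz_inv.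
have -> : r ^ (- z) * X r - ev (a 0%N, a 1%N, a 2%N, a 3%N) r^-1 = r ^ (- z) * (X r - powsum a z r).
  rewrite mulrBr; congr (_ - _); rewrite /powsum mulr_sumr !big_ord_recl big_ord0 /=.
  rewrite !(mulrCA (r ^ (- z))) !zp /bump /= /ev /=; ring.
have p0 : 0 < r ^ (- z) by rewrite exprz_gt0.
rewrite normrM (gtr0_norm p0).
have h : `|X r - powsum a z r| <= C * r ^ (z - 4%:Z) by near: r.
apply: (le_trans (ler_wpM2l (ltW p0) h)).
rewrite mulrCA zp ler_wpM2r ?ler_norm// exprn_ge0// invr_ge0 ltW.
Unshelve. all: by end_near.
Qed.

(** The expansion is used with four terms and with 0, 1 and 2 derivatives; the partial sum is
    differentiated explicitly, each time lowering the leading power by one. *)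
Lemma asymptotic_ap4 h (p : int) (c : nat -> R) (r0 : R) : 0 <= r0 ->
  smooth_on [set r | r0 < r] h -> asymptotic_expansion h p c ->
  [/\ ap4 (fun r => r ^ (- p) * h r) (c 0%N, c 1%N, c 2%N, c 3%N),
      ap4 (fun r => r ^ (- (p - 1)) * derive1 h r)
        (let a k := (p - k%:Z)%:~R * c k in (a 0%N, a 1%N, a 2%N, a 3%N)) &
      ap4 (fun r => r ^ (- (p - 1 - 1)) * derive1 (derive1 h) r)
        (let a k := (p - 1 - k%:Z)%:~R * ((p - k%:Z)%:~R * c k) in (a 0%N, a 1%N, a 2%N, a 3%N))].
Proof.
move=> r00 sh ah; set D := [set r | r0 < r].
have oD : open D.
  rewrite (_ : D = `]r0, +oo[%classic); first exact: interval_open.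
  by apply/seteqP; split=> t; rewrite /D /= in_itv /= andbT.
have nD : \forall r \near +oo, D r by apply: nbhs_pinfty_gt; exact: num_real.
have rn r : D r -> r != 0 by move=> Dr; rewrite gt_eqF// (le_lt_trans r00).
have sh1 := smooth_on_derive1 sh.
pose a1 k := (p - k%:Z)%:~R * c k; pose a2 k := (p - 1 - k%:Z)%:~R * a1 k.
have dS (a : nat -> R) z (X : R -> R) r : D r -> derivable X r 1 ->
   derive1 (fun u => X u - powsum a z u) r = derive1 X r - powsum (fun k => (z - k%:Z)%:~R * a k) (z - 1) r.
  move=> Dr dX; have [dp dpE] := is_derive_powsum a z (rn r Dr).
  by rewrite !derive1E deriveB// dpE.
have e1 r : D r -> derive1 (fun u => h u - powsum c p u) r = derive1 h r - powsum a1 (p - 1) r.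
  by move=> Dr; apply: dS => //; exact: (sh 0%N).
have e2 r : D r -> derive1n 2 (fun u => h u - powsum c p u) r = derive1 (derive1 h) r - powsum a2 (p - 1 - 1) r.
  move=> Dr; rewrite derive1nS derive1n1 (derive1_eq_on oD Dr e1).
  by apply: dS => //; exact: (sh1 0%N).
split; apply: ap4_of_bound.
- have [C hC] := ah 4%N 0%N; exists C; near=> r.
  have : `|derive1n 0 (fun u => h u - \sum_(k < 4) c k * u ^ (p - k%:Z)) r| <= C * r ^ (p - 4%:Z - 0%:Z) by near: r.
  by rewrite derive1n0 subr0.
- have [C hC] := ah 4%N 1%N; exists C; near=> r.
  have Dr : D r by near: r.
  rewrite -[X in X - _]/(derive1 h r) -(e1 r Dr).
  have : `|derive1n 1 (fun u => h u - \sum_(k < 4) c k * u ^ (p - k%:Z)) r| <= C * r ^ (p - 4%:Z - 1%:Z) by near: r.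
  by rewrite derive1n1 [p - 4%:Z - 1]addrAC.
- have [C hC] := ah 4%N 2%N; exists C; near=> r.
  have Dr : D r by near: r.
  rewrite -(e2 r Dr).
  have : `|derive1n 2 (fun u => h u - \sum_(k < 4) c k * u ^ (p - k%:Z)) r| <= C * r ^ (p - 4%:Z - 2%:Z) by near: r.
  by rewrite (_ : p - 4%:Z - 2%:Z = p - 1 - 1 - 4%:Z)//; ring.
Unshelve. all: by end_near.
Qed.

End Expansion.

(** * The equations as truncated series, and the elimination of their coefficients *)

Section SeriesAlgebra.
Variable R : realType.
Local Notation T4 := (R * R * R * R)%type.
Local Notation "a +' b" := (addT a b) (at level 50, left associativity).
Local Notation "a *' b" := (mulT a b) (at level 40, left associativity).
Definition scT (a : R) (t : T4) : T4 := (a * t.1.1.1, a * t.1.1.2, a * t.1.2, a * t.2).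
Definition shT (t : T4) : T4 := (0, t.1.1.1, t.1.1.2, t.1.2).
Definition vanishes (t : T4) := [/\ t.1.1.1 = 0, t.1.1.2 = 0, t.1.2 = 0 & t.2 = 0].

(** The series of r^2 X. As w and ap' are each normalised by r^2, their product needs two shifts;
    [efieldT'] does the same for r^3 X'. *)
Definition efieldT (a w p : T4) : T4 := a +' shT (shT (w *' p)).
Definition efieldT' (a w w' p p' : T4) : T4 := a +' shT (shT (w' *' p +' w *' p')).

(* The two Maxwell and three Einstein equations of [radial_equations], for functions multiplied
   by the powers of [r] that make them bounded at infinity; [shT] is multiplication by [1 / r]. *)
Definition eqM1 (N0 N1 X X' F0 F1 : T4) : T4 :=
  (N1 *' X +' N0 *' X') *' F0 +' scT (-1) (N0 *' X *' F1).
Definition eqM2 (N0 X M0 M1 W1 F0 P0 P1 P2 : T4) : T4 :=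
  M0 *' F0 *' (M0 *' P2 +' M1 *' P1) +' scT (-1) (shT (N0 *' M0 *' X *' W1) +' P0 *' F0 *' F0).
Definition eqE1 (N0 N1 X M0 M1 W1 W2 F0 F1 P1 : T4) : T4 :=
  (scT 2 (N1 *' W1) +' N0 *' W2) *' (M0 *' F0)
  +' scT (-1) (N0 *' W1 *' (M1 *' F0 +' M0 *' F1) +' scT 4 (shT (P1 *' X *' M0 *' M0 *' F0))).
Definition eqE2 (N0 N1 X M0 W1 F0 F1 F2 P0 P1 : T4) : T4 :=
  scT 3 (M0 *' ((N1 *' F1 +' N0 *' F2) *' F0 +' scT (-1) (N0 *' (F1 *' F1))))
  +' scT (-1) (shT (shT (scT 8 (N0 *' (X *' X) *' (F0 *' M0))
    +' shT (F0 *' (scT 3 (N0 *' N0 *' (W1 *' W1)) +' scT 4 (M0 *' M0 *' F0 *' (P1 *' P1))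
      +' scT 4 (P0 *' P0 *' (F0 *' F0))))))).
Definition eqE3 (N0 N1 X M0 M1 M2 W1 F0 P0 P1 : T4) : T4 :=
  scT 3 (F0 *' ((N1 *' M1 +' N0 *' M2) *' M0 +' scT (-1) (N0 *' (M1 *' M1))))
  +' scT (-6) (M0 *' M0 *' F0) +' scT 3 (N0 *' (F0 *' F0))
  +' scT (-1) (shT (shT (M0 *' (scT 4 (N0 *' (X *' X) *' M0)
    +' shT (scT 3 (N0 *' N0 *' (W1 *' W1)) +' scT 8 (M0 *' M0 *' F0 *' (P1 *' P1))
      +' scT (-4) (P0 *' P0 *' (F0 *' F0))))))).
Definition eqG (A1 A2 P1 P2 : T4) : T4 := P1 *' A2 +' scT (-1) (A1 *' P2).

(** Solves a relation L = 0 for an unknown [x] occurring linearly; [k] is the reciprocal of its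
    coefficient in L. *)
Lemma solve_linear (L x v k : R) : L = 0 -> x - v = k * L -> x = v.
Proof. by move=> -> /eqP; rewrite mulr0 subr_eq0 => /eqP. Qed.

(** With p_i = c q_i at lower orders, the Wronskian has coefficient n (n + 1) (Q p_n - p_0 q_n) at
    order n, which explains the multipliers 1/2, 1/6 and 1/12. *)
Lemma geodesic_series (Q q1 q2 q3 p0 p1 p2 p3 : R) : Q != 0 ->
  vanishes (eqG (- Q, -2 * q1, -3 * q2, -4 * q3) (2 * Q, 6 * q1, 12 * q2, 20 * q3)
    (- p0, -2 * p1, -3 * p2, -4 * p3) (2 * p0, 6 * p1, 12 * p2, 20 * p3)) ->
  exists c : R, [/\ p0 = c * Q, p1 = c * q1, p2 = c * q2 & p3 = c * q3].
Proof.
rewrite /vanishes /eqG /addT /mulT /scT /= => Q0 [_ z1 z2 z3].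
exists (p0 / Q); have e0 : p0 = p0 / Q * Q by rewrite divfK.
move: e0; move: (p0 / Q) => c ?; subst p0.
have ? : p1 = c * q1.
  by apply: (mulfI Q0); apply: (solve_linear z1 (k := 1 / 2)); field.
subst p1.
have ? : p2 = c * q2.
  by apply: (mulfI Q0); apply: (solve_linear z2 (k := 1 / 6)); field.
subst p2.
have ? : p3 = c * q3.
  by apply: (mulfI Q0); apply: (solve_linear z3 (k := 1 / 12)); field.
by split.
Qed.

(* The coefficients are eliminated order by order; the last two orders of the
   angular Maxwell equation then force [Q ^+ 3 * c ^+ 3 = 0]. *)
Lemma series_inconsistent (M Q s n c J f2 f3 m1 m2 m3 q1 q2 q3 w1 w2 w3 : R) :
  J != 0 -> Q != 0 ->
  let F0 : T4 := (1, - M, f2, f3) in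
  let F1 : T4 := (0, M, -2 * f2, -3 * f3) in
  let F2 : T4 := (0, -2 * M, 6 * f2, 12 * f3) in
  let M0 : T4 := (1, m1, m2, m3) in
  let M1 : T4 := (1, 0, - m2, -2 * m3) in
  let M2 : T4 := (0, 0, 2 * m2, 6 * m3) in
  let A1 : T4 := (- Q, -2 * q1, -3 * q2, -4 * q3) in
  let A2 : T4 := (2 * Q, 6 * q1, 12 * q2, 20 * q3) in
  let P0 : T4 := (c * Q, c * q1, c * q2, c * q3) in
  let P1 : T4 := (- (c * Q), -2 * (c * q1), -3 * (c * q2), -4 * (c * q3)) in
  let P2 : T4 := (2 * (c * Q), 6 * (c * q1), 12 * (c * q2), 20 * (c * q3)) in
  let W0 : T4 := (J, w1, w2, w3) in
  let W1 : T4 := (-2 * J, -3 * w1, -4 * w2, -5 * w3) in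
  let W2 : T4 := (6 * J, 12 * w1, 20 * w2, 30 * w3) in
  let N0 : T4 := (1, - s, n, 0) in
  let N1 : T4 := (2, - s, 0, 0) in
  let X := efieldT A1 W0 P1 in
  let X' := efieldT' A2 W0 W1 P1 P2 in
  vanishes (eqM1 N0 N1 X X' F0 F1) ->
  vanishes (eqM2 N0 X M0 M1 W1 F0 P0 P1 P2) ->
  vanishes (eqE1 N0 N1 X M0 M1 W1 W2 F0 F1 P1) ->
  vanishes (eqE2 N0 N1 X M0 W1 F0 F1 F2 P0 P1) ->
  vanishes (eqE3 N0 N1 X M0 M1 M2 W1 F0 P0 P1) -> False.
Proof.
move=> J0 Q0 F0 F1 F2 M0 M1 M2 A1 A2 P0 P1 P2 W0 W1 W2 N0 N1 X X'.
rewrite /vanishes /eqM1 /eqM2 /eqE1 /eqE2 /eqE3.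
unfold X, X', efieldT, efieldT', F0, F1, F2, M0, M1, M2, A1, A2, P0, P1, P2, W0, W1, W2, N0, N1.
cbv beta iota zeta delta [addT mulT scT shT fst snd]; clear F0 F1 F2 M0 M1 M2 A1 A2 P0 P1 P2 W0 W1 W2 N0 N1 X X'.
(* The name records the equation and the order in 1/r of the coefficient. *)
move=> [_ M1_1 M1_2 M1_3] [_ M2_1 M2_2 M2_3] [_ E1_1 E1_2 _] [_ _ E2_2 E2_3] [_ E3_1 _ E3_3].
have w1E : w1 = (-2 / 3 * J * M) + 2 / 3 * J * m1 + 4 / 3 * J * s + 4 / 3 * Q ^+ 2 * c.
  by apply: (solve_linear E1_1 (k := 1/3)); field.
subst w1.
have m1E : m1 = (-1 / 2 * M) + (-1 / 2 * s).
  by apply: (solve_linear E3_1 (k := -1/6)); field.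
subst m1.
have q1E : q1 = (-1 / 2 * M * Q) + 1 / 2 * Q * s.
  by apply: (solve_linear M1_1 (k := 1/2)); field.
subst q1.
(* The first order of the angular Maxwell equation ties rotation to mass through [c]. *)
have JE : J = - c * M.
  apply: (mulfI Q0); apply: (solve_linear M2_1 (k := - 1 / 2)); field=> //.
subst J.
have w2E : w2 = (-2 * M * Q ^+ 2 * c) + (-1 / 2 * M * c * f2) + (-1 / 2 * M * c * m2) + M * c * n +
    (-1 * M * c * s ^+ 2) + 5 / 4 * M ^+ 2 * c * s + (-1 / 4 * M ^+ 3 * c) + 2 * Q ^+ 2 * c * s.
  by apply: (solve_linear E1_2 (k := 1/8)); field.
subst w2.
have f2E : f2 = (-1 / 2 * M * s) + 1 / 2 * M ^+ 2 + 4 / 3 * Q ^+ 2.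
  by apply: (solve_linear E2_2 (k := 1/6)); field.
subst f2.
have q2E : q2 = 1 / 3 * M * Q * c ^+ 2 + (-1 / 2 * M * Q * s) + 1 / 6 * M ^+ 2 * Q + (-1 / 3 * Q *
    n) + 1 / 3 * Q * s ^+ 2 + 4 / 9 * Q ^+ 3.
  by apply: (solve_linear M1_2 (k := 1/6)); field.
subst q2.
have f3E : f3 = (-16 / 9 * M * Q ^+ 2) + 1 / 3 * M * n + (-1 / 3 * M * s ^+ 2) + 2 / 3 * M ^+ 2 * c
    ^+ 2 + 1 / 2 * M ^+ 2 * s + (-1 / 6 * M ^+ 3) + 4 / 9 * Q ^+ 2 * c ^+ 2 + 4 / 3 * Q ^+ 2 * s.
  by apply: (solve_linear E2_3 (k := 1/18)); field.
subst f3.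
have m3E : m3 = (-2 / 9 * M * Q ^+ 2) + (-1 / 2 * M * m2) + 1 / 6 * M * n + (-1 / 24 * M * s ^+ 2) +
    5 / 6 * M ^+ 2 * c ^+ 2 + 1 / 24 * M ^+ 3 + 2 / 9 * Q ^+ 2 * c ^+ 2 + 1 / 2 * m2 * s.
  by apply: (solve_linear E3_3 (k := 1/12)); field.
subst m3.
have q3E : q3 = 1 / 2 * M * Q * c ^+ 2 * s + 1 / 3 * M * Q * n + (-11 / 24 * M * Q * s ^+ 2) + (-4 /
    9 * M * Q ^+ 3) + (-1 / 3 * M ^+ 2 * Q * c ^+ 2) + 1 / 4 * M ^+ 2 * Q * s + (-1 / 24 * M ^+ 3 *
    Q) + (-1 / 2 * Q * n * s) + 1 / 4 * Q * s ^+ 3 + (-2 / 9 * Q ^+ 3 * c ^+ 2) + 2 / 3 * Q ^+ 3 *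
    s.
  by apply: (solve_linear M1_3 (k := 1/12)); field.
subst q3.
(* All unknowns determined so far have been substituted; the multipliers of the order-two and
   order-three relations are chosen so that every other term cancels. *)
have Qc : Q ^+ 3 * c ^+ 3 = 0.
  apply: (solve_linear M2_2 (k := 3 / 8 * (s * (3 / 2) - M * (11 / 4)))).
  by apply: (solve_linear M2_3 (k := - 3 / 8)); field.
move/eqP: Qc; rewrite mulf_eq0 !expf_eq0 /= (negbTE Q0) /= => /eqP c0.
by move: J0; rewrite c0 oppr0 mul0r eqxx.
Qed.

End SeriesAlgebra.

(** * Failure of the geodesic condition near infinity *)

Section AtInfinity.
Variable R : realType.
Implicit Types (h : R -> R) (t : R * R * R * R).

Lemma ap4_eqT h t s : t = s -> ap4 h t -> ap4 h s.
Proof. by move=> ->. Qed.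

Lemma ap4_scale h t a : ap4 h t -> ap4 (fun r => a * h r) (scT a t).
Proof.
move=> ht; apply: ap4_eqT (ap4M (ap4_cst a) ht).
by rewrite /mulT /cstT /scT /=; congr (_, _, _, _); ring.
Qed.

Lemma ap4_shift h t : ap4 h t -> ap4 (fun r => r^-1 * h r) (shT t).
Proof.
move=> ht; apply: ap4_eqT (ap4M (ap4_inv R) ht).
by rewrite /mulT /shT /=; congr (_, _, _, _); ring.
Qed.

Lemma ap4_exprn (z : int) (n : nat) h t s :
  ap4 (fun r => r ^ z * h r) t -> z = n -> t = s -> ap4 (fun r => r ^+ n * h r) s.
Proof. by move=> + zn ts; rewrite zn ts. Qed.

Lemma derive1_quadratic (a b : R) : derive1 (fun x : R => (x - a) * (x - b)) = (fun x => 2 * x - (a + b)).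
Proof.
apply/funext => x; apply: derive1_is.
have e (c : R) : is_derive x 1 (fun y : R => y - c) 1.
  by apply: is_derive_eq; rewrite subr0.
have [da dae] := e a; have [db dbe] := e b.
apply: DeriveDef; first exact: (derivableM1 da db).
by rewrite -derive1E (derive1M da db) !derive1E dae dbe; ring.
Qed.

Lemma derive1_affine (a b : R) : derive1 (fun x : R => a * x - b) = (fun=> a).
Proof.
apply/funext => x; apply: derive1_is.
by apply: is_derive_eq; rewrite /GRing.scale/= subr0 mulr1.
Qed.

Variables (rp2 rm2 M J Q : R) (f m N w a0 ap : R -> R).
Hypotheses (bh : charged_rotating_black_hole rp2 rm2 M J Q f m N w a0 ap) (J0 : J != 0)
  (Q0 : Q != 0).
Local Notation D := (exterior rp2).
Local Notation "a +! b" := (ap4D a b) (at level 50, left associativity).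
Local Notation "a *! b" := (ap4M a b) (at level 40, left associativity).
Local Notation d1 h := (derive1 h).
Local Notation d2 h := (derive1 (derive1 h)).

Lemma exterior_open : open D.
Proof.
rewrite (_ : D = `]rp2, +oo[%classic); first exact: interval_open.
by apply/seteqP; split=> x; rewrite /exterior /= in_itv /= andbT.
Qed.

Let rp0 : 0 <= rp2. Proof. by have [_ /ltW] := bh_constants bh. Qed.

Lemma near_exterior : \forall r \near +oo, D r.
Proof. by apply: nbhs_pinfty_gt; exact: num_real. Qed.

Lemma N_expansion r : D r ->
  [/\ N r = (r - rp2) * (r - rm2), d1 N r = 2 * r - (rp2 + rm2) & d2 N r = 2].
Proof.
move=> Dr; have NE := bh_N bh.
have N1 x : D x -> d1 N x = 2 * x - (rp2 + rm2).
  by move=> Dx; rewrite (derive1_eq_on exterior_open Dx NE) derive1_quadratic.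
split; [exact: NE|exact: N1|].
by rewrite (derive1_eq_on exterior_open Dr N1) derive1_affine.
Qed.

Lemma geodesic_condition_not_near_infinity :
  ~ (\forall r \near +oo, geodesic_condition a0 ap r).
Proof.
move=> geo.
have [sf sm sN sw [sa0 sap]] := bh_smooth bh.
have [[cf af [cf0 cf1]] [cm am cm0] [cp aap] [cw aw cw0] [ca aa0 ca0]] := bh_asymptotics bh.
have [F0 F1 F2] := asymptotic_ap4 rp0 sf af.
have [M0 M1 M2] := asymptotic_ap4 rp0 sm am.
have [P0 P1 P2] := asymptotic_ap4 rp0 sap aap.
have [A0 A1 A2] := asymptotic_ap4 rp0 sa0 aa0.
have [W0 W1 W2] := asymptotic_ap4 rp0 sw aw.
(* From here each function and its derivatives are multiplied by the power of r that makes them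
   bounded, with the known leading coefficients inserted. *)
have {}F0 : ap4 f (1, - M, cf 2%N, cf 3%N).
  by apply: (ap4_ext _ (ap4_eqT _ F0)); [near=> r; rewrite oppr0 expr0z mul1r|rewrite cf0 cf1].
have {}F1 : ap4 (fun r => r ^+ 1 * d1 f r) (0, M, -2 * cf 2%N, -3 * cf 3%N).
  by apply: (ap4_exprn F1) => //=; rewrite cf1; congr (_, _, _, _); ring.
have {}F2 : ap4 (fun r => r ^+ 2 * d2 f r) (0, -2 * M, 6 * cf 2%N, 12 * cf 3%N).
  by apply: (ap4_exprn F2) => //=; rewrite cf1; congr (_, _, _, _); ring.
have {}M0 : ap4 (fun r => r^-1 * m r) (1, cm 1%N, cm 2%N, cm 3%N).
  by apply: (ap4_ext _ (ap4_eqT _ M0)); [near=> r|rewrite cm0].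
have {}M1 : ap4 (d1 m) (1, 0, - cm 2%N, -2 * cm 3%N).
  apply: (ap4_ext _ (ap4_eqT _ M1)); first by near=> r; rewrite subrr oppr0 expr0z mul1r.
  by rewrite /= cm0; congr (_, _, _, _); ring.
have {}M2 : ap4 (fun r => r ^+ 1 * d2 m r) (0, 0, 2 * cm 2%N, 6 * cm 3%N).
  by apply: (ap4_exprn M2) => //=; rewrite cm0; congr (_, _, _, _); ring.
have {}A0 : ap4 (fun r => r ^+ 1 * a0 r) (Q, ca 1%N, ca 2%N, ca 3%N).
  by apply: (ap4_exprn A0) => //=; rewrite ca0.
have {}A1 : ap4 (fun r => r ^+ 2 * d1 a0 r) (- Q, -2 * ca 1%N, -3 * ca 2%N, -4 * ca 3%N).
  by apply: (ap4_exprn A1) => //=; rewrite ca0; congr (_, _, _, _); ring.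
have {}A2 : ap4 (fun r => r ^+ 3 * d2 a0 r) (2 * Q, 6 * ca 1%N, 12 * ca 2%N, 20 * ca 3%N).
  by apply: (ap4_exprn A2) => //=; rewrite ca0; congr (_, _, _, _); ring.
have {}P0 : ap4 (fun r => r ^+ 1 * ap r) (cp 0%N, cp 1%N, cp 2%N, cp 3%N).
  exact: (ap4_exprn P0).
have {}P1 : ap4 (fun r => r ^+ 2 * d1 ap r) (- cp 0%N, -2 * cp 1%N, -3 * cp 2%N, -4 * cp 3%N).
  by apply: (ap4_exprn P1) => //=; congr (_, _, _, _); ring.
have {}P2 : ap4 (fun r => r ^+ 3 * d2 ap r) (2 * cp 0%N, 6 * cp 1%N, 12 * cp 2%N, 20 * cp 3%N).
  by apply: (ap4_exprn P2) => //=; congr (_, _, _, _); ring.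
have {}W0 : ap4 (fun r => r ^+ 2 * w r) (J, cw 1%N, cw 2%N, cw 3%N).
  by apply: (ap4_exprn W0) => //=; rewrite cw0.
have {}W1 : ap4 (fun r => r ^+ 3 * d1 w r) (-2 * J, -3 * cw 1%N, -4 * cw 2%N, -5 * cw 3%N).
  by apply: (ap4_exprn W1) => //=; rewrite cw0; congr (_, _, _, _); ring.
have {}W2 : ap4 (fun r => r ^+ 4 * d2 w r) (6 * J, 12 * cw 1%N, 20 * cw 2%N, 30 * cw 3%N).
  by apply: (ap4_exprn W2) => //=; rewrite cw0; congr (_, _, _, _); ring.
move: (cf 2%N) (cf 3%N) (cm 1%N) (cm 2%N) (cm 3%N) (ca 1%N) (ca 2%N) (ca 3%N)
  (cp 0%N) (cp 1%N) (cp 2%N) (cp 3%N) (cw 1%N) (cw 2%N) (cw 3%N) F0 F1 F2 M0 M1 M2 A0 A1 A2 P0 P1 P2 W0 W1 W2.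
move=> f2 f3 m1 m2 m3 q1 q2 q3 p0 p1 p2 p3 w1 w2 w3 F0 F1 F2 M0 M1 M2 A0 A1 A2 P0 P1 P2 W0 W1 W2.
have big : \forall r \near +oo, D r /\ r != 0.
  near=> r; have Dr : D r by near: r; exact: near_exterior.
  by split=> //; rewrite gt_eqF// (le_lt_trans rp0 Dr).
have N0 : ap4 (fun r => r^-1 * (r^-1 * N r)) (1, - (rp2 + rm2), rp2 * rm2, 0).
  apply: (ap4_ext _ (ap4_ev _)); near=> r.
  have [Dr r0] : D r /\ r != 0 by near: r.
  by have [-> _ _] := N_expansion Dr; rewrite /ev /=; field.
have N1 : ap4 (fun r => r^-1 * d1 N r) (2, - (rp2 + rm2), 0, 0).
  apply: (ap4_ext _ (ap4_ev _)); near=> r.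
  have [Dr r0] : D r /\ r != 0 by near: r.
  by have [_ -> _] := N_expansion Dr; rewrite /ev /=; field.
(* This is r^5 times the Wronskian of a0' and ap'; its vanishing makes the series of [ap] equal to c
   times that of [a0]. *)
have G := ap4D (ap4M P1 A2) (ap4_scale (-1) (ap4M A1 P2)).
have G0 : \forall r \near +oo, r ^+ 2 * d1 ap r * (r ^+ 3 * d2 a0 r) + -1 * (r ^+ 2 * d1 a0 r * (r ^+ 3 * d2 ap r)) = 0.
  near=> r; have : geodesic_condition a0 ap r by near: r.
  rewrite /geodesic_condition => g.
  transitivity (r ^+ 5 * (d1 ap r * d2 a0 r - d1 a0 r * d2 ap r)); last by rewrite g mulr0.
  by move: (d1 ap r) (d2 a0 r) (d1 a0 r) (d2 ap r) => *; ring.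
have [c [? ? ? ?]] := geodesic_series Q0 (ap4_eq0 G0 G).
subst p0 p1 p2 p3 => {G G0}.
have XX := A1 +! ap4_shift (ap4_shift (W0 *! P1)).
have XX' := A2 +! ap4_shift (ap4_shift (W1 *! P1 +! W0 *! P2)).
(* [E1] to [E5] assemble the expansions in the shape of [eqM1], [eqM2], [eqE1], [eqE2], [eqE3], so
   their coefficients are those of [series_inconsistent]. *)
have E1 := (N1 *! XX +! N0 *! XX') *! F0 +! ap4_scale (-1) (N0 *! XX *! F1).
have E2 := M0 *! F0 *! (M0 *! P2 +! M1 *! P1) +! ap4_scale (-1) (ap4_shift (N0 *! M0 *! XX *! W1) +!
  P0 *! F0 *! F0).
have E3 := (ap4_scale 2 (N1 *! W1) +! N0 *! W2) *! (M0 *! F0) +! ap4_scale (-1) (N0 *! W1 *! (M1 *!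
  F0 +! M0 *! F1) +! ap4_scale 4 (ap4_shift (P1 *! XX *! M0 *! M0 *! F0))).
have E4 := ap4_scale 3 (M0 *! ((N1 *! F1 +! N0 *! F2) *! F0 +! ap4_scale (-1) (N0 *! (F1 *! F1))))
  +! ap4_scale (-1) (ap4_shift (ap4_shift (ap4_scale 8 (N0 *! (XX *! XX) *! (F0 *! M0)) +! ap4_shift
  (F0 *! (ap4_scale 3 (N0 *! N0 *! (W1 *! W1)) +! ap4_scale 4 (M0 *! M0 *! F0 *! (P1 *! P1)) +!
  ap4_scale 4 (P0 *! P0 *! (F0 *! F0))))))).
have E5 := ap4_scale 3 (F0 *! ((N1 *! M1 +! N0 *! M2) *! M0 +! ap4_scale (-1) (N0 *! (M1 *! M1))))
  +! ap4_scale (-6) (M0 *! M0 *! F0) +! ap4_scale 3 (N0 *! (F0 *! F0)) +! ap4_scale (-1) (ap4_shift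
  (ap4_shift (M0 *! (ap4_scale 4 (N0 *! (XX *! XX) *! M0) +! ap4_shift (ap4_scale 3 (N0 *! N0 *! (W1
  *! W1)) +! ap4_scale 8 (M0 *! M0 *! F0 *! (P1 *! P1)) +! ap4_scale (-4) (P0 *! P0 *! (F0 *!
  F0))))))).
have RE r : D r -> _ := @radial_equations R D f m N w a0 ap exterior_open sf sm sN sw sa0 sap (bh_positive bh) (bh_einstein_maxwell bh) r.
have V1 := ap4_eq0 _ E1; have V2 := ap4_eq0 _ E2; have V3 := ap4_eq0 _ E3.
have V4 := ap4_eq0 _ E4; have V5 := ap4_eq0 _ E5.
apply: (series_inconsistent J0 Q0 (V1 _) (V2 _) (V3 _) (V4 _) (V5 _)); near=> r.
all: have [Dr r0] : D r /\ r != 0 by near: r.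
all: have [e1 e2 e3 e4 e5] := RE r Dr; have [_ _ N2] := N_expansion Dr.
all: rewrite N2 /efield /efield' in e1 e2 e3 e4 e5.
all: move: e1 e2 e3 e4 e5.
all: move: (d2 f r) (d2 m r) (d2 w r) (d2 a0 r) (d2 ap r) => vf2 vm2 vw2 va2 vp2.
all: move: (d1 f r) (d1 m r) (d1 N r) (d1 w r) (d1 a0 r) (d1 ap r) => vf1 vm1 vN1 vw1 va1 vp1.
all: move: (f r) (m r) (N r) (w r) (ap r) => vf vm vN vw vp e1 e2 e3 e4 e5.
all: have sol (a b x k : R) : a = b -> x = k * (a - b) -> x = 0 by move=> ->; rewrite subrr mulr0.
(* The fourth argument is the power of r by which the equation was normalised. *)
- by apply: (sol _ _ _ r e1); field.
- by apply: (sol _ _ _ r e2); field.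
- by apply: (sol _ _ _ r e3); field.
- by apply: (sol _ _ _ r^-1 e4); field.
- by apply: (sol _ _ _ (r^-1 ^+ 2) e5); field.
Unshelve. all: by end_near.
Qed.

End AtInfinity.

(** * Black holes *)

Section Alignment.
Variable R : realType.
Implicit Types (x : 'rV[R]_5) (i j : 'I_5) (v u : 'cV[R]_5).
Variables (D : set R) (f m N w a0 ap : R -> R).
Hypotheses (sa0 : smooth_on D a0) (sap : smooth_on D ap)
  (pos : forall r, D r -> [/\ 0 < f r, 0 < m r & 0 < N r]).
Local Notation U := (chart_region D).
Local Notation g := (ansatz_metric f m N w).
Local Notation F := (ansatz_field a0 ap).
Local Notation rad x := (x 0 i_rad).
Local Notation tht x := (x 0 i_th).

Lemma inner_coframe x v u : U x ->
  let S z := vS w (rad x) (tht x) (fun i => z i 0) in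
  let C z : R := (z : 'cV[R]_5) i_phi 0 - z i_psi 0 in
  inner g x v u = - f (rad x) * (v i_t 0 * u i_t 0) + bb m N (rad x) * (S v * S u)
    + grr f m N (rad x) * (v i_rad 0 * u i_rad 0)
    + aa f m (rad x) * (v i_th 0 * u i_th 0 + (sin (tht x) * cos (tht x)) ^+ 2 * (C v * C u)).
Proof.
move=> Ux S C; have [Gt Gr Gh Gp Gs] := metric_action w pos u Ux.
rewrite innerE sum5 Gt Gr Gh Gp Gs /C; have -> : S u = vS w (rad x) (tht x) (fun i => u i 0) by [].
move: (vS _ _ _ (fun i => u i 0)) => Su; rewrite /S /vS /=.
by move: (sin _) (cos _) => s c; ring.
Qed.

(** In the orthogonal coframe dt is the only negative direction, so without it the squared length is
    a sum of non-negative terms. *)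
Lemma spatial_null_eq0 x v : U x -> inner g x v v = 0 -> v i_t 0 = 0 -> v = 0.
Proof.
move=> Ux; rewrite inner_coframe// => + t0; have [Dr _] := Ux.
rewrite t0 mulr0 mulr0 add0r -!expr2.
have A0 := aa_gt0 pos Dr; have B0 := bb_gt0 pos Dr; have G0 := grr_gt0 pos Dr.
have s0 := chart_sin_gt0 Ux; have c0 := chart_cos_gt0 Ux.
have k0 : 0 < (sin (tht x) * cos (tht x)) ^+ 2 by rewrite exprn_gt0// mulr_gt0.
set S := vS _ _ _ _; set C := v i_phi 0 - v i_psi 0.
have S2 := sqr_ge0 S; have C2 := sqr_ge0 C.
have r2 := sqr_ge0 (v i_rad 0); have h2 := sqr_ge0 (v i_th 0).
have sq a b : 0 < a -> a * b ^+ 2 = 0 -> b = 0 :> R.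
  by move=> a0' /eqP; rewrite mulf_eq0 sqrf_eq0 gt_eqF//= => /eqP.
have P0 : 0 <= bb m N (rad x) * S ^+ 2 by rewrite mulr_ge0// ltW.
have P1 : 0 <= grr f m N (rad x) * v i_rad 0 ^+ 2 by rewrite mulr_ge0// ltW.
have P2 : 0 <= aa f m (rad x) * v i_th 0 ^+ 2 by rewrite mulr_ge0// ltW.
have P3 : 0 <= aa f m (rad x) * (sin (tht x) * cos (tht x)) ^+ 2 * C ^+ 2.
  exact: (mulr_ge0 (mulr_ge0 (ltW A0) (ltW k0)) C2).
rewrite mulrDr [aa f m _ * (_ * C ^+ 2)]mulrA => e.
have S0 : S = 0 by apply: sq B0 _; lra.
have r0 : v i_rad 0 = 0 by apply: sq G0 _; lra.
have h0 : v i_th 0 = 0 by apply: sq A0 _; lra.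
have C0 : C = 0 by apply: sq (mulr_gt0 A0 k0) _; lra.
have pq : v i_phi 0 = v i_psi 0 by apply/eqP; rewrite -subr_eq0; apply/eqP.
have p0 : v i_psi 0 = 0.
  by rewrite -S0 /S /vS t0 pq sin2cos2; ring.
apply/matrixP => i z; rewrite ord1 mxE; elim/ind5: i => //.
by rewrite pq.
Qed.

Lemma null_proportional x v u : U x -> v != 0 ->
  inner g x v v = 0 -> inner g x v u = 0 -> inner g x u u = 0 -> exists lam, u = lam *: v.
Proof.
(* Subtracting the multiple of [v] with the same t component leaves a null vector without t
   component, which is zero. *)
move=> Ux v0 nv vu nu.
have T0 : v i_t 0 != 0 by apply: contra_neq v0 => /(spatial_null_eq0 Ux nv).
pose lam := u i_t 0 / v i_t 0; exists lam.
apply/eqP; rewrite -subr_eq0; apply/eqP; apply: (spatial_null_eq0 Ux).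
  have -> : inner g x (u - lam *: v) (u - lam *: v)
     = inner g x u u - 2 * lam * inner g x v u + lam ^+ 2 * inner g x v v.
    rewrite !inner_coframe// /vS !mxE.
    by move: (sin _) (cos _) lam => s c lam; ring.
  by rewrite nv vu nu; ring.
by rewrite !mxE /lam divfK// subrr.
Qed.

(* [field_square] evaluated on [v] is the square of [ginv g *m F *m v], a vector
   orthogonal to [v]; two orthogonal null vectors are parallel. *)
Lemma null_eigenvector_of_field_square x v : U x ->
  0 < discriminant f m N w a0 ap (rad x) -> v != 0 -> inner g x v v = 0 ->
  (v^T *m field_square g F x *m v) 0 0 = 0 -> null_eigenvector g F x v.
Proof.
move=> Ux disc0 v0 nv sq0; have [Dr _] := Ux.
have gu := metric_unit w pos Ux.
have gT : (g x)^T = g x by apply/matrixP => i j; rewrite mxE (ansatz_metric_sym w pos).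
have FT : (F x)^T = - F x by apply/matrixP => i j; rewrite !mxE opprB.
have giT : (ginv g x)^T = ginv g x by rewrite /ginv trmx_inv gT.
pose u := ginv g x *m F x *m v.
have gu' : g x *m u = F x *m v by rewrite /u !mulmxA mulmxV// mul1mx.
have nu : inner g x u u = 0.
  (* The squared length of [u] is the quadratic form of [field_square]; the signs are those of the
     antisymmetric field. *)
  by rewrite /inner -mulmxA gu' /u !trmx_mul giT FT -[RHS]sq0 /field_square FT !(mulmxN, mulNmx) !mulmxA.
have vu : inner g x v u = 0.
  rewrite /inner -mulmxA gu' mulmxA.
  have : (v^T *m F x *m v)^T = - (v^T *m F x *m v).
    by rewrite !trmx_mul trmxK FT mulNmx mulmxN mulmxA.
  move/matrixP/(_ 0 0); rewrite mxE [RHS]mxE; lra.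
have [lam uE] := null_proportional Ux v0 nv vu nu.
split=> //; exists lam => //; apply: contra_neq v0 => lam0.
(* A zero eigenvalue means F v = 0, whose radial row reads X v^t + ap' S = 0, with X the electric
   component. With nullness and a positive discriminant this forces v = 0. *)
move: gu'; rewrite uE lam0 scale0r mulmx0 => /matrixP/(_ i_rad 0).
have [_ Fr _ _ _] := field_action sa0 sap v Ux; rewrite Fr mxE => /esym e.
have X0 := efield_neq0 pos Dr disc0.
have nvx := nv; move: nv; rewrite inner_coframe// => nv; move: disc0; rewrite discE.
have A0 := aa_gt0 pos Dr; have B0 := bb_gt0 pos Dr; have G0 := grr_gt0 pos Dr.
set S := vS _ _ _ _ in nv; set B := bb _ _ _ in nv B0 *; move: e.
have -> : derive1 a0 (rad x) * v i_t 0 + derive1 ap (rad x)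
    * (sin (tht x) ^+ 2 * v i_phi 0 + cos (tht x) ^+ 2 * v i_psi 0)
  = efield w a0 ap (rad x) * v i_t 0 + derive1 ap (rad x) * S.
  by rewrite /efield /S /vS; move: (derive1 a0 _) (derive1 ap _) => *; ring.
move: (efield _ _ _ _) X0 (derive1 ap _) (f (rad x)) nv => X X0 b f' nv e disc0.
have le : B * S ^+ 2 <= f' * v i_t 0 ^+ 2.
  have : 0 <= grr f m N (rad x) * (v i_rad 0 * v i_rad 0) by rewrite -expr2 mulr_ge0 ?sqr_ge0// ltW.
  have : 0 <= aa f m (rad x) * (v i_th 0 * v i_th 0 + (sin (tht x) * cos (tht x)) ^+ 2
      * ((v i_phi 0 - v i_psi 0) * (v i_phi 0 - v i_psi 0))).
    by rewrite -!expr2; exact: (mulr_ge0 (ltW A0) (addr_ge0 (sqr_ge0 _) (mulr_ge0 (sqr_ge0 _) (sqr_ge0 _)))).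
  lra.
have S0 : S = 0.
  apply/eqP; apply: contraT => Sn0.
  have S2 : 0 < S ^+ 2 by rewrite exprn_even_gt0.
  (* Nullness gives B S^2 <= f (v^t)^2; multiplied by X^2 and combined with the radial row, it
     yields disc S^2 <= 0. *)
  have : 0 < (- f' * b ^+ 2 + B * X ^+ 2) * S ^+ 2 by exact: mulr_gt0.
  have : X ^+ 2 * (B * S ^+ 2) <= X ^+ 2 * (f' * v i_t 0 ^+ 2) by rewrite ler_wpM2l// sqr_ge0.
  have -> : X ^+ 2 * (f' * v i_t 0 ^+ 2) = f' * b ^+ 2 * S ^+ 2.
    by have -> : f' * b ^+ 2 * S ^+ 2 = f' * (X * v i_t 0 - (X * v i_t 0 + b * S)) ^+ 2; [ring|rewrite e; ring].
  lra.
have t0 : v i_t 0 = 0.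
  by apply: (mulfI X0); move: e; rewrite S0 !mulr0 addr0.
exact: (spatial_null_eq0 Ux nvx t0).
Qed.

End Alignment.

Lemma ap4_gt0 (R : realType) (h : R -> R) t : ap4 h t -> 0 < t.1.1.1 -> \forall r \near +oo, 0 < h r.
Proof.
move=> [C C0 hC] t0; pose K := C + sum_abs (t.1.1.2, t.1.2, t.2, 0).
have K0 : 0 <= K by rewrite addr_ge0// sum_abs_ge0.
near=> r.
have [r0 u01] : 0 < r /\ 0 < r^-1 <= 1 by near: r; exact: near_inv01.
have Kr : K * r^-1 < t.1.1.1.
  rewrite ltr_pdivrMr// mulrC -ltr_pdivrMr//.
  by near: r; apply: nbhs_pinfty_gt; exact: num_real.
have : `|h r - ev t r^-1| <= C * r^-1 ^+ 4 by near: r.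
have := ev_le (t.1.1.2, t.1.2, t.2, 0) u01.
case/andP: u01; move: r^-1 Kr => u Kr u0 u1 evu hu.
have u4 : C * u ^+ 4 <= C * u.
  by rewrite ler_wpM2l// exprS; apply: ler_piMr; rewrite ?exprn_ile1// ltW.
have e1 : ev t u = t.1.1.1 + u * ev (t.1.1.2, t.1.2, t.2, 0) u by rewrite /ev /=; ring.
move: hu evu; rewrite !ler_norml e1 => /andP[hu _] /andP[evu _].
have : u * - sum_abs (t.1.1.2, t.1.2, t.2, 0) <= u * ev (t.1.1.2, t.1.2, t.2, 0) u.
  by rewrite ler_wpM2l// ltW.
move: Kr; rewrite /K; lra.
Unshelve. all: by end_near.
Qed.

Lemma minkowski_form_unit (R : realType) : minkowski_form R \in unitmx.
Proof.
rewrite unitmxE det_diag unitfE; apply/prodf_neq0 => i _.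
by rewrite mxE; case: ifP; rewrite ?oppr_eq0 oner_eq0.
Qed.

(** * Exclusion of the Kerr-Schild form *)

Section BlackHole.
Variable R : realType.
Variables (rp2 rm2 M J Q : R) (f m N w a0 ap : R -> R).
Hypotheses (bh : charged_rotating_black_hole rp2 rm2 M J Q f m N w a0 ap) (J0 : J != 0)
  (Q0 : Q != 0).
Local Notation g := (ansatz_metric f m N w).
Local Notation F := (ansatz_field a0 ap).
Local Notation disc := (discriminant f m N w a0 ap).

(** Multiplied by r^2 m, the discriminant tends to Q^2: the electric term dominates, the other one
    carrying an extra factor 1/r. *)
Lemma discriminant_near_infinity : \forall r \near +oo, 0 < disc r.
Proof.
have [sf sm sN sw [sa0 sap]] := bh_smooth bh; have [_ /ltW rp0] := bh_constants bh.
have [[cf af _] [cm am _] [cp aap] [cw aw _] [ca aa0 ca0]] := bh_asymptotics bh.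
have [F0 _ _] := asymptotic_ap4 rp0 sf af.
have [M0 _ _] := asymptotic_ap4 rp0 sm am.
have [_ P1 _] := asymptotic_ap4 rp0 sap aap.
have [_ A1 _] := asymptotic_ap4 rp0 sa0 aa0.
have [W0 _ _] := asymptotic_ap4 rp0 sw aw.
have N0 : ap4 (fun r => r^-1 * (r^-1 * N r)) (1, - (rp2 + rm2), rp2 * rm2, 0).
  apply: (ap4_ext _ (ap4_ev _)); near=> r.
  have Dr : exterior rp2 r by near: r; exact: near_exterior.
  have r0 : r != 0 by rewrite gt_eqF// (le_lt_trans rp0 Dr).
  by have [-> _ _] := N_expansion bh Dr; rewrite /ev /=; field.
have XX := ap4D A1 (ap4_shift (ap4_shift (ap4M W0 P1))).
have dd := ap4D (ap4M N0 (ap4M XX XX)) (ap4_scale (-1) (ap4_shift (ap4M (ap4M F0 M0) (ap4M P1 P1)))).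
have {}dd := ap4_gt0 dd _; near=> r.
have Dr : exterior rp2 r by near: r; exact: near_exterior.
have r0 : 0 < r by exact: (le_lt_trans rp0 Dr).
have [f0 m0 n0] := bh_positive bh Dr.
have k0 : 0 < r ^+ 2 * m r by rewrite mulr_gt0// exprn_gt0.
rewrite -(pmulr_rgt0 _ k0).
suff -> : r ^+ 2 * m r * disc r = r^-1 * (r^-1 * N r) * ((r ^+ 2 * derive1 a0 r
     + r^-1 * (r^-1 * (r ^+ 2 * w r * (r ^+ 2 * derive1 ap r))))
   * (r ^+ 2 * derive1 a0 r
     + r^-1 * (r^-1 * (r ^+ 2 * w r * (r ^+ 2 * derive1 ap r)))))
   + -1 * (r^-1 * (r ^+ 0 * f r * (r ^- 1 * m r) * (r ^+ 2 * derive1 ap r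
     * (r ^+ 2 * derive1 ap r)))).
  near: r; apply: dd; rewrite /= ca0 !(mul0r, mulr0, add0r, addr0, mulr1, mul1r).
  by rewrite [ltRHS](_ : _ = Q ^+ 2); [rewrite exprn_even_gt0|ring].
rewrite /discriminant.
move: (derive1 a0 r) (derive1 ap r) => a b; field.
by rewrite !gt_eqF.
Unshelve. all: by end_near.
Qed.

Lemma black_hole_not_kerr_schild : ~ kerr_schild (chart_region (exterior rp2)) g.
Proof.
move=> [eta [H [k [[se le fe] sH sk nk [geo ks]]]]].
have [B [_ hB]] := discriminant_near_infinity.
(* The outer region on which the discriminant is positive; all data are restricted to it. *)
pose D0 := exterior (Num.max B rp2).
have D0r r : D0 r -> B < r /\ rp2 < r by rewrite /D0 /exterior /= gt_max => /andP[].
have D0e r (Dr : D0 r) : exterior rp2 r := (D0r r Dr).2.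
have oD0 : open D0 := @exterior_open R _.
have oU0 := chart_region_open oD0.
have U0 x : chart_region D0 x -> chart_region (exterior rp2) x.
  by case=> Dx tx; split=> //; exact: D0e.
have sub h (sh : smooth_on (exterior rp2) h) : smooth_on D0 h := fun j r Dr => sh j r (D0e r Dr).
have subs h n (sh : smooth_scalar (chart_region (exterior rp2)) h) : cdiff n (chart_region D0) h.
  by have /smooth_scalarP := (fun s x Ux => sh s x (U0 x Ux)) : smooth_scalar (chart_region D0) h; exact.
have [/sub sf /sub sm /sub sN /sub sw [/sub sa0 /sub sap]] := bh_smooth bh.
have pos r (Dr : D0 r) := bh_positive bh (D0e r Dr).
have disc0 r (Dr : D0 r) : 0 < disc r := hB r (D0r r Dr).1.
have gsym x i j : chart_region D0 x -> g x i j = g x j i by exact: (ansatz_metric_sym w pos).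
have gunit x : chart_region D0 x -> g x \in unitmx by exact: (metric_unit w pos).
have low x i : (g x *m k x) i 0 = lower g k x i by rewrite mxE.
have ksE x i j : chart_region D0 x -> g x i j = eta x i j - 2 * H x * (lower g k x i * lower g k x j).
  move=> /U0 Ux; have := ks x Ux; rewrite /lowered_square /lower.
  move: (g x) => G /matrixP/(_ i j) ->.
  by rewrite !mxE big_ord1 !mxE.
(* Symmetry of the background is inherited from that of [g] and of k_mu k_nu. *)
have esym x i j : chart_region D0 x -> eta x i j = eta x j i.
  move=> Ux; have := gsym x i j Ux; rewrite !ksE//.
  by rewrite [lower g k x j * _]mulrC => /addIr.
have eunit x : chart_region D0 x -> eta x \in unitmx.
  move=> /U0 Ux; have [P Pu e] := le x Ux.
  by have := minkowski_form_unit R; rewrite -e !unitmx_mul => /andP[/andP[]].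
have null x : chart_region D0 x -> \sum_d k x d 0 * lower g k x d = 0.
  by move=> /U0 Ux; have [_ e] := nk x Ux; rewrite -[RHS]e innerE.
have geo0 : geodesic (chart_region D0) g k := fun x Ux => geo x (U0 x Ux).
have sk0 : smooth_vector (chart_region D0) k := fun i s x Ux => sk i s x (U0 x Ux).
(* As Ric(k,k) = 0 and g(k,k) = 0, the Einstein equation in the form of [einstein_ricci] leaves only
   the quadratic form of [field_square] on [k], which therefore vanishes. *)
have neig x : chart_region D0 x -> null_eigenvector g F x (k x).
  move=> Ux; have [k0 nkx] := nk x (U0 x Ux).
  apply: (null_eigenvector_of_field_square sa0 sap pos Ux _ k0 nkx); first by exact: disc0 Ux.1.
  have := kerr_schild_ricci_null oU0 gsym gunit (cdiff_metric oD0 sf sm sN sw pos 1) esym eunit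
    (fun i j => subs _ 1%N (se i j)) (fun i => subs _ 1%N (sk i)) (subs _ 1%N sH) ksE null geo0 Ux.
  rewrite [RHS]big1 => [|b _]; last first.
    apply: big1 => d _; rewrite /ricci big1 ?mul0r// => a _; exact: fe (U0 x Ux) _ _ _ _.
  have em := (bh_einstein_maxwell bh).2 x (U0 x Ux).
  under eq_bigr do under eq_bigr do rewrite (einstein_ricci (fun i j => gsym x i j Ux) (gunit x Ux) em).
  have -> : \sum_b \sum_d (2 * field_square g F x b d - 3^-1 * field_norm g F x * g x b d) * k x b 0 * k x d 0
     = 2 * ((k x)^T *m field_square g F x *m k x) 0 0 - 3^-1 * field_norm g F x * inner g x (k x) (k x).
    have E (B' : 'M[R]_5) : ((k x)^T *m B' *m k x) 0 0 = \sum_b \sum_d B' b d * k x b 0 * k x d 0.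
      rewrite mxE exchange_big; apply: eq_bigr => d _; rewrite mxE mulr_suml.
      by apply: eq_bigr => b _; rewrite mxE [k x b 0 * _]mulrC.
    rewrite /inner !E !mulr_sumr -sumrB; apply: eq_bigr => b _.
    rewrite !mulr_sumr -sumrB; apply: eq_bigr => d _; ring.
  by rewrite nkx mulr0 subr0 => /eqP; rewrite mulf_eq0 pnatr_eq0 => /eqP.
have [cond _] := geodesic_iff oD0 sf sm sN sw sa0 sap pos disc0 sk0 neig.
apply: (geodesic_condition_not_near_infinity bh J0 Q0).
near=> r; apply: (cond geo0); near: r.
exact: near_exterior.
Unshelve. all: by end_near.
Qed.

End BlackHole.

Theorem mainTheorem6 (R : realType) :
  (forall (I : set R) (f m N w a0 ap : R -> R),
     open I -> is_interval I ->
     smooth_on I f -> smooth_on I m -> smooth_on I N ->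
     smooth_on I w -> smooth_on I a0 -> smooth_on I ap ->
     (forall r, I r -> [/\ 0 < f r, 0 < m r & 0 < N r]) ->
     (forall r, I r -> 0 < discriminant f m N w a0 ap r) ->
     let U := chart_region I in
     let g := ansatz_metric f m N w in
     let F := ansatz_field a0 ap in
     (exists l n, null_eigendirections U g F l n) /\
     (forall l n, null_eigendirections U g F l n ->
        (geodesic U g l <-> forall r, I r -> geodesic_condition a0 ap r) /\
        (geodesic U g n <-> forall r, I r -> geodesic_condition a0 ap r)))
  /\
  (forall (rp2 rm2 M J Q : R) (f m N w a0 ap : R -> R),
     charged_rotating_black_hole rp2 rm2 M J Q f m N w a0 ap ->
     J != 0 -> Q != 0 ->
     let g := ansatz_metric f m N w in
     let F := ansatz_field a0 ap in
     let V := chart_region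
       [set r | exterior rp2 r /\ 0 < discriminant f m N w a0 ap r] in
     [/\ ~ (forall r, exterior rp2 r -> geodesic_condition a0 ap r),
         (exists l n, null_eigendirections V g F l n) /\
         (forall l n, null_eigendirections V g F l n ->
            ~ geodesic V g l /\ ~ geodesic V g n) &
         ~ kerr_schild (chart_region (exterior rp2)) g]).
Proof.
split=> [D f m N w a0 ap oD _ sf sm sN sw sa0 sap pos disc_gt0 U g F|].
  exact: (null_eigendirections_geodesic oD sf sm sN sw sa0 sap pos disc_gt0).
move=> rp2 rm2 M J Q f m N w a0 ap bh J0 Q0 g F V.
have ninf := geodesic_condition_not_near_infinity bh J0 Q0.
have [sf sm sN sw [sa0 sap]] := bh_smooth bh.
have sdisc := smooth_disc (@exterior_open R rp2) sf sm sN sw sa0 sap (bh_positive bh).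
pose D := [set r | exterior rp2 r /\ 0 < discriminant f m N w a0 ap r].
(* The discriminant is smooth, hence continuous, so its positivity region is open. *)
have oD : open D.
  rewrite openE => r [Dr d0]; near=> t; split.
    by near: t; exact: (open_nbhs_nbhs (conj (@exterior_open R rp2) Dr)).
  near: t.
  have c : {for r, continuous (discriminant f m N w a0 ap)}.
    by apply: differentiable_continuous; apply/derivable1_diffP; exact: (sdisc 0%N r Dr).
  exact: c (open_nbhs_nbhs (conj (@open_gt R 0) d0)).
have sub h (sh : smooth_on (exterior rp2) h) : smooth_on D h := fun j r Dr => sh j r Dr.1.
have pos r (Dr : D r) := bh_positive bh Dr.1.
have [ex iff] := null_eigendirections_geodesic oD (sub f sf) (sub m sm) (sub N sN) (sub w sw)
  (sub a0 sa0) (sub ap sap) pos (fun r (Dr : D r) => Dr.2).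
(* The region [D] contains a neighbourhood of infinity, where the condition fails. *)
have nD : ~ (forall r, D r -> geodesic_condition a0 ap r).
  move=> h; apply: ninf; near=> r; apply: h; split.
    by near: r; exact: near_exterior.
  by near: r; exact: (discriminant_near_infinity bh Q0).
split.
- by move=> h; apply: nD => r [Dr _]; exact: h.
- split=> // l n ln; have [[gl _] [gn _]] := iff l n ln.
  by split=> [/gl|/gn].
- exact: (black_hole_not_kerr_schild bh J0 Q0).
Unshelve. all: by end_near.
Qed.
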